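(* Let $N\geq 5$ and $0<\mu<N-4$, and let $$C_{\mu,1}=\frac{N^2-4N+8}{2(N-4)^2}\mu[2(N-4)-\mu],\qquad C_{\mu,2}=\frac{N^2}{16(N-4)^2}\mu^2[2(N-4)-\mu]^2-\frac{N-2}{2}\mu[2(N-4)-\mu],$$ and $2^{**}=\frac{2N}{N-4}$. Then the problem $$\Delta^2 u+C_{\mu,1}\,\mathrm{div}\Big(\frac{\nabla u}{|x|^2}\Big)+C_{\mu,2}\frac{u}{|x|^4}=u^{2^{**}-1},\quad u>0\ \text{ in } \mathbb{R}^N\setminus\{0\},\quad u\in\mathcal{E}_\mu,$$ admits a unique (up to scalings) positive radial solution, which is of the form $U_{\mu,\lambda}(x)=\lambda^{\frac{N-4}{2}}U_\mu(\lambda x)$, $\lambda>0$, where $$U_\mu(x)=K_{N,\mu}|x|^{-\frac{\mu}{2}}\left(1+|x|^{2(1-\frac{\mu}{N-4})}\right)^{-\frac{N-4}{2}},\qquad K_{N,\mu}=\left[\Big(1-\frac{\mu}{N-4}\Big)^4(N-4)(N-2)N(N+2)\right]^{\frac{N-4}{8}}.$$ That is, every positive radial solution equals $U_{\mu,\lambda}$ for some $\lambda>0$.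
   Context: $\mathcal{D}^{2,2}_0(\mathbb{R}^N)=\{u\in L^{2^{**}}(\mathbb{R}^N):\Delta u\in L^2(\mathbb{R}^N)\}$. $\mathcal{E}_\mu$ is the set of $u\in\mathcal{D}^{2,2}_0(\mathbb{R}^N)$ with $\int_{\mathbb{R}^N}|\Delta u|^2dx-C_{\mu,1}\int_{\mathbb{R}^N}\frac{|\nabla u|^2}{|x|^2}dx+C_{\mu,2}\int_{\mathbb{R}^N}\frac{u^2}{|x|^4}dx<\infty$, equipped with the inner product $\langle u,v\rangle_\mu=\int_{\mathbb{R}^N}\Delta u\Delta v\,dx-C_{\mu,1}\int_{\mathbb{R}^N}\frac{\nabla u\cdot\nabla v}{|x|^2}dx+C_{\mu,2}\int_{\mathbb{R}^N}\frac{uv}{|x|^4}dx$ and norm $\|u\|_\mu=\langle u,u\rangle_\mu^{1/2}$. *)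

(* Defs.v *)
From HB Require Import structures.
From mathcomp Require Import all_boot all_order all_algebra.
From mathcomp Require Import all_classical all_reals all_analysis.
Set Implicit Arguments. Unset Strict Implicit. Unset Printing Implicit Defensive.
Import Order.TTheory GRing.Theory Num.Theory.
Import numFieldNormedType.Exports.
Local Open Scope classical_set_scope.
Local Open Scope ring_scope.

Section RN.
Variables (R : realType) (N : nat).

Notation V := 'rV[R]_N.

Definition enorm (x : V) : R := Num.sqrt (\sum_(i < N) (x ord0 i) ^+ 2).

Definition upd (x : V) (k : nat) (t : R) : V :=
  \row_(j < N) (if val j == k then t else x ord0 j).

Fixpoint iint (k : nat) (f : V -> \bar R) (x : V) : \bar R :=
  match k with
  | 0 => f x
  | k'.+1 => (\int[@lebesgue_measure R]_t iint k' f (upd x k' t))%E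
  end.

(* Lebesgue integral over R^N (as iterated integral; Fubini/Tonelli) *)
Definition intRN (f : V -> \bar R) : \bar R := iint N f 0.

Definition borelRN (A : set V) : Prop := <<s [set U : set V | open U] >> A.
Definition measRN (f : V -> R) : Prop :=
  forall B : set R, measurable B -> borelRN (f @^-1` B).

Definition nullRN (A : set V) : Prop :=
  exists B, borelRN B /\ A `<=` B /\ intRN (fun x => (\1_B x)%:E) = 0%E.
Definition ae_eqRN (f g : V -> R) : Prop := nullRN [set x | f x != g x].

Definition inLp (p : R) (f : V -> R) : Prop :=
  measRN f /\ (intRN (fun x => (`|f x| `^ p)%:E) < +oo)%E.

Definition locint (f : V -> R) : Prop :=
  measRN f /\ forall r : R,
    (intRN (fun x => (`|f x| * \1_[set y | enorm y <= r] x)%:E) < +oo)%E.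

Definition pd (i : 'I_N) (f : V -> R) (x : V) : R :=
  derive1 (fun t => f (upd x i t)) (x ord0 i).
Definition ipd (s : seq 'I_N) (f : V -> R) : V -> R := foldr pd f s.

Definition smooth (f : V -> R) : Prop :=
  forall (s : seq 'I_N) (x : V),
    {for x, continuous (ipd s f)} /\
    forall i : 'I_N, derivable (fun t => ipd s f (upd x i t)) (x ord0 i) 1.

Definition testfn (phi : V -> R) : Prop :=
  smooth phi /\ exists r : R, forall x, r < enorm x -> phi x = 0.

Definition lap (phi : V -> R) (x : V) : R := \sum_(i < N) ipd [:: i; i] phi x.

Definition wgrad (u : V -> R) (g : 'I_N -> V -> R) : Prop :=
  locint u /\ (forall i, locint (g i)) /\
  forall phi, testfn phi -> forall i : 'I_N,
    intRN (fun x => (u x * pd i phi x)%:E) =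
    (- intRN (fun x => (g i x * phi x)%:E))%E.

Definition wlap (u : V -> R) (h : V -> R) : Prop :=
  locint u /\ locint h /\
  forall phi, testfn phi ->
    intRN (fun x => (u x * lap phi x)%:E) = intRN (fun x => (h x * phi x)%:E).

Definition crit_exp : R := 2 * N%:R / (N%:R - 4).

Definition D22 (u : V -> R) : Prop :=
  inLp crit_exp u /\ exists h, wlap u h /\ inLp 2 h.

Definition gradsq (g : 'I_N -> V -> R) (x : V) : R := \sum_(i < N) (g i x) ^+ 2.
Definition gradprod (g g' : 'I_N -> V -> R) (x : V) : R :=
  \sum_(i < N) g i x * g' i x.

Definition Cmu1 (mu : R) : R :=
  (N%:R ^+ 2 - 4 * N%:R + 8) / (2 * (N%:R - 4) ^+ 2) * mu * (2 * (N%:R - 4) - mu).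
Definition Cmu2 (mu : R) : R :=
  N%:R ^+ 2 / (16 * (N%:R - 4) ^+ 2) * mu ^+ 2 * (2 * (N%:R - 4) - mu) ^+ 2
  - (N%:R - 2) / 2 * mu * (2 * (N%:R - 4) - mu).

(* E_mu : u in D^{2,2}_0 with finite ||u||_mu (each term finite) *)
Definition Emu (u : V -> R) : Prop :=
  D22 u /\ exists g, wgrad u g /\
    (intRN (fun x => (gradsq g x / enorm x ^+ 2)%:E) < +oo)%E /\
    (intRN (fun x => (u x ^+ 2 / enorm x ^+ 4)%:E) < +oo)%E.

Definition weak_sol (mu : R) (u : V -> R) : Prop :=
  Emu u /\
  forall (phi : V -> R) h g h' g',
    Emu phi -> wlap u h -> wgrad u g -> wlap phi h' -> wgrad phi g' ->
    (intRN (fun x => (h x * h' x)%:E)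
     - (Cmu1 mu)%:E * intRN (fun x => (gradprod g g' x / enorm x ^+ 2)%:E)
     + (Cmu2 mu)%:E * intRN (fun x => (u x * phi x / enorm x ^+ 4)%:E))%E
    = intRN (fun x => (u x `^ (crit_exp - 1) * phi x)%:E).

Definition radial (u : V -> R) : Prop :=
  forall x y, enorm x = enorm y -> u x = u y.
Definition positive (u : V -> R) : Prop :=
  forall x, x != 0 -> 0 < u x.

Definition KNmu (mu : R) : R :=
  ((1 - mu / (N%:R - 4)) ^+ 4 * (N%:R - 4) * (N%:R - 2) * N%:R * (N%:R + 2))
    `^ ((N%:R - 4) / 8).
Definition Umu (mu : R) (x : V) : R :=
  KNmu mu * enorm x `^ (- (mu / 2))
  * (1 + enorm x `^ (2 * (1 - mu / (N%:R - 4)))) `^ (- ((N%:R - 4) / 2)).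
Definition Umul (mu lam : R) (x : V) : R :=
  lam `^ ((N%:R - 4) / 2) * Umu mu (lam *: x).

End RN.

Arguments weak_sol {R} N mu u.
Arguments Umul {R} N mu lam x.
Arguments Umu {R} N mu x.
Arguments radial {R N} u.
Arguments positive {R N} u.
Arguments ae_eqRN {R N} f g.

(* Main.v *)
Require Import Defs.
From HB Require Import structures.
From mathcomp Require Import all_boot all_order all_algebra.
From mathcomp Require Import all_classical all_reals all_analysis.
From mathcomp Require Import measurable_realfun ring lra.
Set Implicit Arguments. Unset Strict Implicit. Unset Printing Implicit Defensive.
Import Order.TTheory GRing.Theory Num.Theory.
Import numFieldNormedType.Exports.
Local Open Scope classical_set_scope.
Local Open Scope ring_scope.

(** In the variable [t = ln |x|], writing [u = e^{-kap t} w(t)] with [kap = (N-4)/2], the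
equation for radial functions becomes [(D^2 - a^2) (D^2 - b^2) w = w^p], where
[a = al kap], [b = al (kap+2)] and [al = 1 - mu/(N-4)]; the functions [U_{mu,lam}]
correspond to the translates of [W(t) = K (2 cosh (al t))^{-kap}].

Existence: [W] and its derivatives decay exponentially, so that the cutoffs
[chi(t/n) W(t)] are radial test functions for which Green's formula holds, and the
weak formulation is obtained by dominated convergence.

Uniqueness: testing with radial functions gives the ODE for [w] weakly. Testing with
the Green kernel [G] of [(D^2 - a^2) (D^2 - b^2)] yields [w = G * w^p] almost
everywhere, hence [w] is smooth and decays at infinity, so its conserved energy
vanishes. At a local maximum [t0] the energy determines [w''(t0)] from [w(t0)].
Compare [w] with [k W], translated so as to peak at [t0] and scaled so as to agree with
[w] there. If [w(t0) <> W(t0)], one of the two is a supersolution and the other a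
subsolution, the difference is convex at [t0], and since the operator is a product of
two operators [D^2 - c^2] with [c > 0] the difference keeps growing in one direction
of time, which is impossible for square integrable functions. If [w(t0) = W(t0)], the
same argument shows that the third derivatives agree too, and [w] is a translate of
[W] by uniqueness for the Cauchy problem. *)

(** * Lebesgue measure on row vectors *)

(** [intRN] is an iterated integral, which takes a conventional value on functions that are not
    integrable; it is therefore identified with integration against a measure [vol], and integral
    identities come with integrability proofs. The passage to [t = ln |x|] needs no spherical
    coordinates: by scaling, a ball of radius [r] has volume proportional to [r^N], and this
    determines the image of [vol] under [ln |x|]. The two constants of the equation are those for
    which the operator in [t] has the real roots [a], [-a], [b], [-b]. The factorization serves
    three times: each factor acts simply on powers of [1 / cosh], the Green kernel is positive, and
    the comparison of two solutions becomes a first-order system with nonnegative coefficients,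
    which stands in for the maximum principle. A given solution is only measurable; the bounds kept
    from [Emu] are the integrals of [w^2] and of [w^p w]. They do not make [w^p] integrable, so that
    it is split into a small constant and an integrable part. Multiplication by [k] is compatible
    with the linear part but not with the power, whence sub- and supersolutions. *)

Section Borel.
Variables (R : realType) (N : nat).
Notation V := 'rV[R]_N.

(** The sigma-algebra of [borelRN] attached to a type, so that [measRN] and [borelRN] become
    [measurable_fun] and [measurable]. *)
Definition VB : measurableType _ := g_sigma_algebraType [set U : set V | open U].

Definition box (a b : V) : set V :=
  [set x | forall i, a ord0 i < x ord0 i < b ord0 i].

(** Balls of row vectors are cubes, so a box with rational corners fits between a point and the
    boundary of [U]; rationality keeps the union countable. *)
Lemma open_box_cover (U : set V) : open U -> U = \bigcup_(q in
   [set q : 'rV[rat]_N * 'rV[rat]_N |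
     box (map_mx ratr q.1) (map_mx ratr q.2) `<=` U])
   box (map_mx ratr q.1) (map_mx ratr q.2).
Proof.
move=> oU; apply/seteqP; split=> [x Ux|x [q /= qU]]; last exact: qU.
have /nbhs_ballP[e /= e0 eU] := open_nbhs_nbhs (conj oU Ux).
have /choice[a ha] (i : 'I_N) : exists q, ratr q \in `]x ord0 i - e, x ord0 i[.
  by apply: rat_in_itvoo; rewrite ltrBlDr ltrDl.
have /choice[b hb] (i : 'I_N) : exists q, ratr q \in `]x ord0 i, x ord0 i + e[.
  by apply: rat_in_itvoo; rewrite ltrDl.
exists (\row_i a i, \row_i b i) => /= [y hy|i]; last first.
  by rewrite !mxE; move: (ha i) (hb i); rewrite !in_itv /= => /andP[_ ->] /andP[-> _].
apply: eU; split=> // i j; rewrite (ord1 i).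
move: (hy j); rewrite !mxE => /andP[h1 h2].
move: (ha j) (hb j); rewrite !in_itv /= => /andP[h3 h4] /andP[h5 h6].
by rewrite /ball /= ltr_distlC; apply/andP; split; lra.
Qed.

Lemma measurable_coordP d (T : measurableType d) (f : T -> VB) :
  (forall i, measurable_fun setT (fun x => (f x : V) ord0 i)) ->
  measurable_fun setT f.
Proof.
move=> mf; apply: (@measurability _ _ T VB setT f [set U : set V | open U]) => //= _ [U oU <-].
rewrite setTI.
rewrite (open_box_cover oU) preimage_bigcup bigcup_mkcond.
apply: countable_bigcupT_measurable => //.
move=> q; case: ifP => // _; rewrite (_ : _ @^-1` _ = \bigcap_(i in [set: 'I_N])
   ((fun x => (f x : V) ord0 i) @^-1`
    `](ratr (q.1 ord0 i)), (ratr (q.2 ord0 i))[)).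
  apply: fin_bigcap_measurable; first exact: finite_finset.
  move=> i _; rewrite -[X in measurable X]setTI.
  by apply: mf => //; exact: measurable_itv.
apply/seteqP; split=> x /= H.
  by move=> i _ /=; rewrite in_itv /=; have := H i; rewrite !mxE.
by move=> i; have := H i I; rewrite /= in_itv /= !mxE.
Qed.

Lemma continuous_measurable (f : V -> R) :
  continuous f -> measurable_fun setT (f : VB -> R).
Proof.
move=> cf; apply: (measurability _ (RGenOInfty.measurableE R)) => _ [_ [a ->] <-].
rewrite setTI; apply: sub_sigma_algebra => /=.
by move/continuousP : cf; apply; exact: interval_open.
Qed.

Lemma measurable_coord (i : 'I_N) : measurable_fun setT (fun x : VB => (x : V) ord0 i).
Proof. by apply: continuous_measurable => x; exact: coord_continuous. Qed.

Notation RB := (g_sigma_algebraType (R.-ocitv.-measurable)).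

Lemma measurable_upd k :
  measurable_fun setT (fun xt : VB * RB => upd xt.1 k xt.2 : VB).
Proof.
apply: measurable_coordP => i /=.
rewrite [X in measurable_fun _ X](_ : _ = (fun xt : VB * RB =>
    if val i == k then xt.2 else (xt.1 : V) ord0 i)); last first.
  by apply/funext => xt; rewrite mxE.
case: (val i == k); first exact: measurable_snd.
by apply: measurableT_comp (measurable_coord i) _; exact: measurable_fst.
Qed.

(* Each structure is attached to its own constant: a single constant could carry
   only one canonical s-finite structure. *)
Section kprecomp.
Context d d' d3 (X : measurableType d) (Y : measurableType d') (Z : measurableType d3).
Variables (f : X -> Y).

Section kprecomp_fker.
Variables (k : R.-fker Y ~> Z) (mf : measurable_fun setT f).
Definition fkprecomp of measurable_fun setT f := fun x => k (f x) : {measure set Z -> \bar R}.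
Let measurable_kprecomp U : measurable U -> measurable_fun setT (fkprecomp mf ^~ U).
Proof. by move=> mU; exact: (measurableT_comp (measurable_kernel k U mU) mf). Qed.
HB.instance Definition _ := isKernel.Build _ _ _ _ _ (fkprecomp mf) measurable_kprecomp.
Let kprecomp_uub : measure_fam_uub (fkprecomp mf).
Proof. by have [r hr] := measure_uub k; exists r => x; exact: hr. Qed.
HB.instance Definition _ := Kernel_isFinite.Build _ _ _ _ _ (fkprecomp mf) kprecomp_uub.
End kprecomp_fker.

Section kprecomp_sfker.
Variables (k : R.-sfker Y ~> Z) (mf : measurable_fun setT f).
Definition kprecomp of measurable_fun setT f := fun x => k (f x) : {measure set Z -> \bar R}.
Let measurable_kprecomp U : measurable U -> measurable_fun setT (kprecomp mf ^~ U).
Proof. by move=> mU; exact: (measurableT_comp (measurable_kernel k U mU) mf). Qed.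
HB.instance Definition _ := isKernel.Build _ _ _ _ _ (kprecomp mf) measurable_kprecomp.
Let kprecomp_sfinite : exists s : (R.-fker X ~> Z)^nat,
    forall x U, measurable U -> kprecomp mf x U = kseries s x U.
Proof.
have [s hs] := sfinite_kernel k.
by exists (fun n => fkprecomp (s n) mf) => x U mU; rewrite /kprecomp hs.
Qed.
HB.instance Definition _ := Kernel_isSFinite.Build _ _ _ _ _ (kprecomp mf) kprecomp_sfinite.
End kprecomp_sfker.
End kprecomp.

Section kcst.
Context d d' (X : measurableType d) (Y : measurableType d').

Section kcst_fker.
Variable m : {finite_measure set Y -> \bar R}.
Definition fkcst := fun _ : X => m : {measure set Y -> \bar R}.
Let measurable_kcst U : measurable U -> measurable_fun setT (fkcst ^~ U).
Proof. by move=> mU; exact: measurable_cst. Qed.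
HB.instance Definition _ := isKernel.Build _ _ _ _ _ fkcst measurable_kcst.
Let kcst_uub : measure_fam_uub fkcst.
Proof.
exists (fine (m setT) + 1)%R => x; rewrite /fkcst EFinD fineK ?fin_num_measure//.
by rewrite lteDl ?fin_num_measure// lte_fin.
Qed.
HB.instance Definition _ := Kernel_isFinite.Build _ _ _ _ _ fkcst kcst_uub.
End kcst_fker.

Section kcst_sfker.
Variable m : {sfinite_measure set Y -> \bar R}.
Definition kcst := fun _ : X => m : {measure set Y -> \bar R}.
Let measurable_kcst U : measurable U -> measurable_fun setT (kcst ^~ U).
Proof. by move=> mU; exact: measurable_cst. Qed.
HB.instance Definition _ := isKernel.Build _ _ _ _ _ kcst measurable_kcst.
Let kcst_sfinite : exists s : (R.-fker X ~> Y)^nat,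
    forall x U, measurable U -> kcst x U = kseries s x U.
Proof.
exists (fun n => fkcst (sfinite_measure_seq m n)) => x U mU.
exact: (sfinite_measure_seqP m mU).
Qed.
HB.instance Definition _ := Kernel_isSFinite.Build _ _ _ _ _ kcst kcst_sfinite.
End kcst_sfker.
End kcst.

Notation leb := (@lebesgue_measure R).

Lemma measurable_VBid : measurable_fun setT (@idfun VB).
Proof. exact: measurable_id. Qed.

Import KCOMP_SFINITE_KERNEL.

Definition kleb : R.-sfker VB ~> RB := @kcst _ _ VB _ leb.

Definition kstep (K : R.-sfker VB ~> VB) k : R.-sfker (VB * RB) ~> VB :=
  kprecomp K (measurable_upd k).

(** Built by the same recursion as [iint], with integration over one coordinate replaced by
    composition of kernels. S-finite kernels are composed because Lebesgue measure is not finite. *)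
Fixpoint kvol (k : nat) : R.-sfker VB ~> VB :=
  match k with
  | 0 => kdirac measurable_VBid
  | k'.+1 => mkcomp kleb (kstep (kvol k') k')
  end.

Definition vol : {measure set VB -> \bar R} := kvol N 0.

Lemma iint_ge0E k (f : V -> \bar R) x : (forall x, 0 <= f x)%E ->
  measurable_fun setT (f : VB -> \bar R) ->
  iint k f x = (\int[kvol k x]_y f y)%E.
Proof.
move=> f0 mf; elim: k x => [|k ih] x /=.
  by rewrite integral_dirac// diracT mul1e.
rewrite integral_kcomp//; apply: eq_integral => t _.
by rewrite ih.
Qed.

(** Integrability plays no part: the inner integral is the difference of those of the positive and
    negative parts, and each of these is measurable by Tonelli. *)
Lemma measurable_iint k (f : V -> \bar R) :
  measurable_fun setT (f : VB -> \bar R) ->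
  measurable_fun setT (iint k f : VB -> \bar R).
Proof.
move=> mf; elim: k => [//|k ih] /=.
pose g (z : VB * RB) := iint k f (upd z.1 k z.2).
have mg : measurable_fun setT g := measurableT_comp ih (measurable_upd k).
rewrite (_ : (fun x => _) = (fun x : VB =>
   \int[kleb x]_t (g^\+ (x, t)) - \int[kleb x]_t (g^\- (x, t)))%E); last first.
  apply/funext => x; rewrite [LHS]integralE; congr (_ - _)%E;
    by apply: eq_integral => t _; rewrite ?funeposE ?funenegE.
apply: emeasurable_funB.
  apply: (measurable_fun_integral_sfinite_kernel (g^\+)%E) => //.
  exact: measurable_funepos.
apply: (measurable_fun_integral_sfinite_kernel (g^\-)%E) => //.
exact: measurable_funeneg.
Qed.

Lemma iintE k (f : V -> \bar R) x : measurable_fun setT (f : VB -> \bar R) ->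
  (\int[kvol k x]_y `|f y| < +oo)%E ->
  iint k f x = (\int[kvol k x]_y f y)%E.
Proof.
move=> mf; elim: k x => [|k ih] x /=.
  by move=> _; rewrite integral_dirac// diracT mul1e.
have mup : measurable_fun setT (fun t : RB => upd x k t : VB).
  exact: (measurableT_comp (measurable_upd k) (pair1_measurable x)).
have mA (g : VB -> \bar R) : (forall x, 0 <= g x)%E -> measurable_fun setT g ->
    measurable_fun setT (fun t : RB => \int[kvol k (upd x k t)]_y g y)%E.
  move=> g0 mg; apply: (measurableT_comp (f := fun x => \int[kvol k x]_y g y)%E) mup.
  apply: measurable_fun_integral_kernel => // U mU; exact: measurable_kernel.
have mfa : measurable_fun setT (fun x : VB => `|f x|)%E by exact: measurableT_comp.
have mfp : measurable_fun setT ((f : VB -> \bar R)^\+)%E by exact: measurable_funepos.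
have mfn : measurable_fun setT ((f : VB -> \bar R)^\-)%E by exact: measurable_funeneg.
rewrite integral_kcomp// => hoo.
have fin (g : VB -> \bar R) : (forall x, 0 <= g x)%E -> measurable_fun setT g ->
    (forall x, g x <= `|f x|)%E ->
    leb.-integrable setT (fun t : RB => \int[kvol k (upd x k t)]_y g y)%E.
  move=> g0 mg gf; apply/integrableP; split; first exact: mA.
  apply: le_lt_trans hoo; apply: ge0_le_integral => //.
  - by apply: measurableT_comp => //; exact: mA.
  - exact: mA.
  - move=> t _; rewrite gee0_abs; last exact: integral_ge0.
    by apply: ge0_le_integral.
have fin0 := fin _ (fun x => abse_ge0 (f x)) mfa (fun x => lexx _).
have finp := fin _ (fun x => funepos_ge0 f x) mfp.
have finn := fin _ (fun x => funeneg_ge0 f x) mfn.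
have {}finp : leb.-integrable setT (fun t : RB => \int[kvol k (upd x k t)]_y f^\+ y)%E.
  by apply: finp => y; rewrite funeposE ge_max abse_ge0 lee_abs.
have {}finn : leb.-integrable setT (fun t : RB => \int[kvol k (upd x k t)]_y f^\- y)%E.
  by apply: finn => y; rewrite funenegE ge_max abse_ge0 -abseN lee_abs.
rewrite [RHS]integralE !integral_kcomp// -integralB//.
apply: ae_eq_integral => //.
- by apply: measurableT_comp mup; exact: measurable_iint.
- by apply: emeasurable_funB; apply: mA.
(* [ih] applies only to those [t] for which the inner integral of [|f|] is finite; by [fin0] these
   are almost all. *)
- have := integrable_ae measurableT fin0; apply: filterS => t /(_ I) ht _.
  rewrite ih; first by rewrite integralE.
  by rewrite -ge0_fin_numE//; exact: integral_ge0.
Qed.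

Lemma intRN_ge0E (f : V -> \bar R) : (forall x, 0 <= f x)%E ->
  measurable_fun setT (f : VB -> \bar R) -> intRN f = (\int[vol]_x f x)%E.
Proof. exact: iint_ge0E. Qed.

Lemma intRNE (f : V -> \bar R) : vol.-integrable setT (f : VB -> \bar R) ->
  intRN f = (\int[vol]_x f x)%E.
Proof. by move=> /integrableP[mf h]; exact: iintE. Qed.

End Borel.

(** * Image measures, affine substitution and densities *)

Section pushforward_measure.
Context d1 d2 (X : measurableType d1) (Y : measurableType d2) (R : realType).
Variables (mu : {measure set X -> \bar R}) (phi : X -> Y).
Hypothesis mphi : measurable_fun setT phi.

Definition pfm : {measure set Y -> \bar R} :=
  measure_function_pushforward__canonical__measure_function_Measure mu mphi.

Lemma pfmE A : pfm A = mu (phi @^-1` A). Proof. by []. Qed.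

Lemma ge0_integral_pfm (f : Y -> \bar R) : (forall y, 0 <= f y)%E ->
  measurable_fun setT f -> (\int[pfm]_y f y = \int[mu]_x f (phi x))%E.
Proof. by move=> f0 mf; rewrite ge0_integral_pushforward. Qed.

End pushforward_measure.

Section affine1.
Variable R : realType.
Notation leb := (@lebesgue_measure R).
Notation RB := (measurableTypeR R).

(** The image of Lebesgue measure under [x |-> l x + c], multiplied by [l], gives each interval its
    length, so it is Lebesgue measure again. *)
Lemma ge0_integral_affine (l c : R) (f : RB -> \bar R) : 0 < l ->
  (forall x, 0 <= f x)%E -> measurable_fun setT f ->
  (\int[leb]_x f x = l%:E * \int[leb]_x f (l * x + c)%R)%E.
Proof.
move=> l0 f0 mf.
pose phi : RB -> RB := fun x => l * x + c.
have mphi : measurable_fun setT phi.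
  by apply: continuous_measurable_fun => x; apply: cvgD; [exact: mulrl_continuous|exact: cvg_cst].
pose nu : {measure set RB -> \bar R} := mscale (NngNum (ltW l0)) (pfm leb mphi).
have E A : measurable A -> leb A = nu A.
  apply: lebesgue_measure_unique => _ [[a b] _ <-] /=.
  rewrite /nu /mscale /= (pfmE _ mphi).
  rewrite (_ : phi @^-1` `]a, b]%classic = `](a - c) / l, (b - c) / l]%classic); last first.
    apply/seteqP; split=> x; rewrite /= !in_itv /= ltr_pdivrMr// ler_pdivlMr// [x * l]mulrC /phi;
    by rewrite ltrBlDr lerBrDr.
  rewrite (lebesgue_measure_itv `]a, b]).
  rewrite [X in (_ * X)%E](lebesgue_measure_itv `](a - c) / l, (b - c) / l]) /= !lte_fin.
  rewrite ltr_pM2r ?invr_gt0// ltrD2r; case: ifP => _; last by rewrite mule0.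
  by rewrite -EFinM; congr EFin; field; rewrite gt_eqF.
rewrite (@eq_measure_integral _ _ _ _ nu); last by move=> A mA _; exact: E.
by rewrite ge0_integral_mscale// ge0_integral_pfm.
Qed.

End affine1.

(** * Scaling and translation of the volume *)

Section volume.
Variables (R : realType) (N : nat).
Notation leb := (@lebesgue_measure R).
Notation V := 'rV[R]_N.
Notation VB := (VB R N).
Notation vol := (@vol R N).

Lemma iint_scale k l (f : V -> \bar R) x : 0 < l ->
  (forall x, 0 <= f x)%E -> measurable_fun setT (f : VB -> \bar R) ->
  (iint k f (l *: x)%R = (l ^+ k)%:E * iint k (fun y => f (l *: y)%R) x)%E.
Proof.
move=> l0 f0 mf; elim: k x => [|k ih] x /=; first by rewrite mul1e.
have mi := @measurable_iint R N k f mf.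
have i0 y : (0 <= iint k f y)%E by rewrite iint_ge0E//; exact: integral_ge0.
have mup (y : V) : measurable_fun setT (fun t : measurableTypeR R => upd y k t : VB).
  exact: (measurableT_comp (measurable_upd k) (pair1_measurable (y : VB))).
rewrite (ge0_integral_affine 0 l0)//; last first.
  exact: (measurableT_comp mi (mup _)).
rewrite exprS EFinM -muleA; congr (_ * _)%E.
have mf' : measurable_fun setT (fun y : VB => f (l *: (y : V))).
  apply: (measurableT_comp (f := f : VB -> _)) => //.
  apply: measurable_coordP => i.
  rewrite [X in measurable_fun _ X](_ : _ = (fun x : VB => l * (x : V) ord0 i)).
    by apply: measurable_funM; [exact: measurable_cst|exact: measurable_coord].
  by apply/funext => y; rewrite mxE.
rewrite -ge0_integralZl ?lee_fin ?exprn_ge0 ?ltW//.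
- apply: eq_integral => t _; rewrite -ih; congr iint.
  by apply/rowP => j; rewrite !mxE addr0; case: ifP.
- by apply: (measurableT_comp (f := iint k _ : VB -> _)) (mup _); exact: measurable_iint.
- by move=> t _; rewrite iint_ge0E//; exact: integral_ge0.
Qed.

Lemma ge0_vol_scale l (f : VB -> \bar R) : 0 < l ->
  (forall x, 0 <= f x)%E -> measurable_fun setT f ->
  (\int[vol]_x f x = (l ^+ N)%:E * \int[vol]_x f (l *: (x : V))%R)%E.
Proof.
move=> l0 f0 mf; rewrite -!iint_ge0E//.
  by rewrite -iint_scale// scaler0.
apply: (measurableT_comp (f := f : VB -> _)) => //.
apply: measurable_coordP => i.
rewrite [X in measurable_fun _ X](_ : _ = (fun x : VB => l * (x : V) ord0 i)).
  by apply: measurable_funM; [exact: measurable_cst|exact: measurable_coord].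
by apply/funext => y; rewrite mxE.
Qed.

Definition shift (i : 'I_N) (s : R) (x : V) : V := x + s *: delta_mx ord0 i.

Lemma measurable_shift i s : measurable_fun setT (shift i s : VB -> VB).
Proof.
apply: measurable_coordP => j.
rewrite [X in measurable_fun _ X](_ : _ = (fun x : VB => (x : V) ord0 j + s * (j == i)%:R)).
  by apply: measurable_funD; [exact: measurable_coord|exact: measurable_cst].
by apply/funext => y; rewrite !mxE eqxx.
Qed.

(** Coordinate [i] is integrated out once [k] exceeds [i]; until then the shift still acts on the
    base point, hence the conditional. *)
Lemma iint_shift k i s (f : V -> \bar R) x :
  (forall x, 0 <= f x)%E -> measurable_fun setT (f : VB -> \bar R) ->
  iint k (fun y => f (shift i s y)) x = iint k f (if (i < k)%N then x else shift i s x).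
Proof.
move=> f0 mf; elim: k x => [//|k ih] x /=.
under eq_integral do rewrite ih.
have mup (y : V) : measurable_fun setT (fun t : measurableTypeR R => upd y k t : VB).
  exact: (measurableT_comp (measurable_upd k) (pair1_measurable (y : VB))).
have mi := @measurable_iint R N k f mf.
have i0 y : (0 <= iint k f y)%E by rewrite iint_ge0E//; exact: integral_ge0.
have [ik|ik|ik] := ltngtP i k.
- by rewrite ltnS (ltnW ik).
- rewrite ltnS leqNgt ik /=; apply: eq_integral => t _; congr iint.
  apply/rowP => j; rewrite !mxE eqxx /=; case: eqP => // jk.
  by rewrite (_ : (j == i) = false) ?mulr0 ?addr0//; apply/eqP => ji; rewrite -ji jk ltnn in ik.
- rewrite ltnS ik leqnn.
  rewrite [RHS](ge0_integral_affine s (@ltr01 R))//; last exact: (measurableT_comp mi (mup _)).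
  rewrite mul1e; apply: eq_integral => t _; congr iint.
  apply/rowP => j; rewrite !mxE eqxx /= mul1r -ik.
  have -> : (val j == val i) = (j == i) by [].
  by have [_|_] := eqVneq j i; rewrite ?mulr1 // mulr0 addr0.
Qed.

Lemma ge0_vol_shift i s (f : VB -> \bar R) :
  (forall x, 0 <= f x)%E -> measurable_fun setT f ->
  (\int[vol]_x f (shift i s x) = \int[vol]_x f x)%E.
Proof.
move=> f0 mf; rewrite -!iint_ge0E//; last first.
  exact: (measurableT_comp mf (measurable_shift i s)).
by rewrite iint_shift// ltn_ord.
Qed.

End volume.

Section density.
Context d (T : measurableType d) (R : realType).
Variables (mu : {measure set T -> \bar R}) (f : T -> R).
Hypotheses (f0 : forall x, 0 <= f x) (mf : measurable_fun setT f).

Definition dens of (forall x, 0 <= f x) & measurable_fun setT f : set T -> \bar R :=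
  fun A => (\int[mu]_(x in A) (f x)%:E)%E.

Let mfE : measurable_fun setT (fun x => (f x)%:E).
Proof. exact/measurable_EFinP. Qed.

Let dens0 : dens f0 mf set0 = 0%E.
Proof. exact: integral_set0. Qed.

Let dens_ge0 A : (0 <= dens f0 mf A)%E.
Proof. by apply: integral_ge0 => x _; rewrite lee_fin. Qed.

Let dens_sigma_additive : semi_sigma_additive (dens f0 mf).
Proof.
move=> /= F mF tF mUF; apply: cvg_toP.
  apply: ereal_nondecreasing_is_cvgn => m n mn.
  by apply: lee_sum_nneg_natr => // k _ _; exact: dens_ge0.
rewrite /dens ge0_integral_bigcup//=; last by move=> x _; rewrite lee_fin.
exact: measurable_funTS.
Qed.

HB.instance Definition _ := isMeasure.Build _ _ _ (dens f0 mf)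
  dens0 dens_ge0 dens_sigma_additive.

Definition mdens : {measure set T -> \bar R} := dens f0 mf.

Import HBNNSimple.

Let integral_dens_nnsfun (h : {nnsfun T >-> R}) :
  (\int[mdens]_x (h x)%:E = \int[mu]_x ((f x)%:E * (h x)%:E))%E.
Proof.
under [in LHS]eq_integral do rewrite fimfunE -fsumEFin//.
rewrite ge0_integral_fsum//; last 2 first.
  - by move=> r; exact/measurable_EFinP/measurableT_comp.
  - by move=> r z _; rewrite EFinM nnfun_muleindic_ge0.
have E x : ((f x)%:E * (h x)%:E = \sum_(r \in range h)
    (f x)%:E * (r * \1_(h @^-1` [set r]) x)%:E)%E.
  rewrite fimfunE -fsumEFin// ge0_mule_fsumr// => r.
  by rewrite EFinM nnfun_muleindic_ge0.
under [in RHS]eq_integral do rewrite E.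
rewrite ge0_integral_fsum//=; last 2 first.
  - move=> r; apply: emeasurable_funM => //; apply/measurable_EFinP.
    exact: measurableT_comp.
  - move=> r z _; apply: mule_ge0; first by rewrite lee_fin.
    by rewrite EFinM nnfun_muleindic_ge0.
apply: eq_fsbigr => r _.
rewrite (integralZl_indic _ (fun r => h @^-1` [set r]))//; last first.
  by move=> r0; rewrite preimage_nnfun0.
rewrite integral_indic// setIT.
have [r0|r0] := leP 0 r.
  under [in RHS]eq_integral do rewrite EFinM muleCA.
  have mi : measurable_fun setT (fun x => (f x)%:E * (\1_(h @^-1` [set r]) x)%:E)%E.
    by apply: emeasurable_funM => //; exact/measurable_EFinP.
  rewrite ge0_integralZl//; last by move=> x _; rewrite mule_ge0 ?lee_fin.
  congr (_ * _)%E.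
  transitivity (\int[mu]_(x in h @^-1` [set r]) (f x)%:E)%E; first by [].
  rewrite integral_mkcond.
  apply: eq_integral => x _; rewrite patchE indicE.
  by case: ifP => _; rewrite ?mule1 ?mule0.
rewrite preimage_nnfun0// measure0 mule0 integral0_eq// => x _.
by rewrite indic0 mulr0 mule0.
Qed.

Lemma ge0_integral_dens (g : T -> \bar R) : (forall x, 0 <= g x)%E ->
  measurable_fun setT g ->
  (\int[mdens]_x g x = \int[mu]_x ((f x)%:E * g x))%E.
Proof.
move=> g0 mg; pose g_ := nnsfun_approx measurableT mg.
transitivity (\int[mdens]_x (lim ((g_ n x)%:E @[n --> \oo])))%E.
  by apply/eq_integral => z _; apply/esym/cvg_lim => //=; exact: cvg_nnsfun_approx.
rewrite monotone_convergence//; last 3 first.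
  by move=> n; exact/measurable_EFinP.
  by move=> n z _; rewrite lee_fin.
  by move=> z _ a b ab; rewrite lee_fin; exact/lefP/nd_nnsfun_approx.
under eq_fun do rewrite integral_dens_nnsfun.
rewrite -monotone_convergence//; last 3 first.
  by move=> n; apply: emeasurable_funM => //; exact/measurable_EFinP.
  by move=> n z _; rewrite mule_ge0// lee_fin.
  move=> z _ a b ab; rewrite lee_wpmul2l ?lee_fin//; exact/lefP/nd_nnsfun_approx.
apply: eq_integral => z _; apply/cvg_lim => //=.
by apply: cvgeZl => //; exact: cvg_nnsfun_approx.
Qed.

End density.

(** * Integration of radial functions *)

Section enorm.
Variables (R : realType) (N : nat).
Notation V := 'rV[R]_N.
Implicit Type x : V.

Lemma enorm_ge0 x : 0 <= enorm x. Proof. exact: sqrtr_ge0. Qed.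

Lemma enorm_sqr x : enorm x ^+ 2 = \sum_(i < N) x ord0 i ^+ 2.
Proof. by rewrite sqr_sqrtr// sumr_ge0// => i _; exact: sqr_ge0. Qed.

Lemma ler_coord_enorm x i : `|x ord0 i| <= enorm x.
Proof.
rewrite -ler_sqr ?nnegrE ?enorm_ge0// enorm_sqr real_normK ?num_real//.
by rewrite (bigD1 i)//= lerDl sumr_ge0// => j _; exact: sqr_ge0.
Qed.

Lemma enorm_eq0 x : (enorm x == 0) = (x == 0).
Proof.
apply/eqP/eqP => [x0|->]; last first.
  by rewrite /enorm big1 ?sqrtr0// => i _; rewrite mxE expr0n.
apply/rowP => i; rewrite mxE; apply/eqP; rewrite -normr_le0.
by rewrite -x0 ler_coord_enorm.
Qed.

Lemma enorm_gt0 x : (0 < enorm x) = (x != 0).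
Proof. by rewrite lt_neqAle enorm_ge0 andbT eq_sym enorm_eq0. Qed.

Lemma enormZ l x : 0 <= l -> enorm (l *: x) = l * enorm x.
Proof.
move=> l0; rewrite /enorm; under eq_bigr do rewrite mxE exprMn.
by rewrite -mulr_sumr sqrtrM ?sqr_ge0// sqrtr_sqr ger0_norm.
Qed.

Lemma continuous_big_sum (T : topologicalType) (I : Type) (r : seq I) (F : I -> T -> R) :
  (forall i, continuous (F i)) -> continuous (fun y => \sum_(i <- r) F i y).
Proof.
move=> cF; elim: r => [|i r ih] y.
  by under eq_fun do rewrite big_nil; exact: cvg_cst.
by under eq_fun do rewrite big_cons; apply: cvgD; [exact: cF|exact: ih].
Qed.

Lemma continuous_sumsq : continuous (fun x : V => \sum_(i < N) x ord0 i ^+ 2).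
Proof.
apply: continuous_big_sum => i x.
apply: (@continuous_comp _ _ _ (fun x : V => x ord0 i) (fun t : R => t ^+ 2)).
  exact: coord_continuous.
exact: exprn_continuous.
Qed.

Lemma continuous_enorm : continuous (@enorm R N).
Proof.
move=> x; apply: (@continuous_comp _ _ _ (fun x : V => \sum_(i < N) x ord0 i ^+ 2)
  (@Num.sqrt R)); last exact: sqrt_continuous.
exact: continuous_sumsq.
Qed.

Lemma measurable_enorm : measurable_fun setT (@enorm R N : VB R N -> R).
Proof. by apply: continuous_measurable; exact: continuous_enorm. Qed.

Lemma measurable_lnenorm : measurable_fun setT (fun x : VB R N => ln (enorm x)).
Proof. exact: (measurableT_comp (@measurable_ln R) measurable_enorm). Qed.

End enorm.

Section radial.
Variable R : realType.
Notation leb := (@lebesgue_measure R).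

Section derivation_rules.
Implicit Types (f g : R -> R) (x c a b : R).

Lemma der_eq f x a b : is_derive x 1 f a -> a = b -> is_derive x 1 f b.
Proof. by move=> h <-. Qed.

Lemma derC c x : is_derive x 1 (fun _ : R => c) 0.
Proof. exact: is_derive_cst. Qed.

Lemma derI x : is_derive x 1 (fun t : R => t) 1.
Proof. exact: is_derive_id. Qed.

Lemma derD f g x a b : is_derive x 1 f a -> is_derive x 1 g b ->
  is_derive x 1 (fun t => f t + g t) (a + b).
Proof. exact: is_deriveD. Qed.

Lemma derZ f c x a : is_derive x 1 f a -> is_derive x 1 (fun t => c * f t) (c * a).
Proof. exact: (@is_deriveZ R R R f c x 1 a). Qed.

Lemma derB f g x a b : is_derive x 1 f a -> is_derive x 1 g b ->
  is_derive x 1 (fun t => f t - g t) (a - b).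
Proof. exact: is_deriveB. Qed.

Lemma derM f g x a b : is_derive x 1 f a -> is_derive x 1 g b ->
  is_derive x 1 (fun t => f t * g t) (a * g x + f x * b).
Proof.
by move=> h h'; apply: der_eq (is_deriveM h h') _; rewrite /GRing.scale /= addrC mulrC.
Qed.

Lemma der_comp f g x a b : is_derive (g x) 1 f a -> is_derive x 1 g b ->
  is_derive x 1 (fun t => f (g t)) (a * b).
Proof. exact: is_derive1_comp. Qed.

Lemma der_exp f x a : is_derive x 1 f a ->
  is_derive x 1 (fun t => expR (f t)) (a * expR (f x)).
Proof. by move=> h; rewrite mulrC; exact: der_comp (is_derive_expR _) h. Qed.

End derivation_rules.

Lemma is_derive_continuous (F f : R -> R) :
  (forall x : R, is_derive x 1 F (f x)) -> continuous F.
Proof.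
move=> dF x; apply: differentiable_continuous; apply/derivable1_diffP.
by have [] := dF x.
Qed.

Lemma FTC2 (F f : R -> R) a b : a < b ->
  (forall x : R, is_derive x 1 F (f x)) -> continuous f ->
  (\int[leb]_(x in `[a, b]) (f x)%:E = (F b)%:E - (F a)%:E)%E.
Proof.
move=> ab dF cf; have cF := is_derive_continuous dF.
apply: continuous_FTC2 => //.
- exact: continuous_subspaceT.
- split=> [x _| |]; first by have [] := dF x.
    by apply: cvg_at_right_filter; exact: cF.
  by apply: cvg_at_left_filter; exact: cF.
- by move=> x _; rewrite derive1E; exact: derive_val.
Qed.

Lemma is_derive_expR_scale (c x : R) : is_derive x 1 (fun t => expR (c * t)) (c * expR (c * x)).
Proof. by apply: der_exp; apply: der_eq (derZ c (derI x)) _; rewrite mulr1. Qed.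

Lemma continuous_expR_scale (c : R) : continuous (fun t => expR (c * t)).
Proof. by apply: is_derive_continuous => x; exact: is_derive_expR_scale. Qed.

Variable N : nat.
Notation V := 'rV[R]_N.
Notation VB := (VB R N).
Notation vol := (@vol R N).

Definition cball (r : R) : set VB := [set x | enorm (x : V) <= r].

Lemma measurable_cball r : measurable (cball r).
Proof.
have := @measurable_enorm R N measurableT `]-oo, r]%classic.
rewrite setTI => /(_ (measurable_itv _)).
by congr (measurable _); apply/seteqP; split=> x /=; rewrite in_itv.
Qed.

Lemma vol_cball1_lty : (vol (cball 1) < +oo)%E.
Proof.
have mB : measurable_fun setT (fun x : VB => (\1_(cball 1) x)%:E : \bar R).
  by apply/measurable_EFinP; apply: measurable_indic; exact: measurable_cball.
rewrite -[X in vol X]setIT -integral_indic//; last exact: measurable_cball.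
rewrite -intRN_ge0E//.
(* [g k] is the indicator of the cube in the coordinates not yet integrated; each integration over
   [[-1, 1]] costs a factor 2. *)
pose g k (x : V) : R := [forall i : 'I_N, (k <= i)%N ==> (`|x ord0 i| <= 1)]%:R.
suff H k x : (k <= N)%N -> (iint k (fun x => (\1_(cball 1) x)%:E) x <= (2 ^+ k * g k x)%:E)%E.
  by apply: le_lt_trans (H N 0 (leqnn _)) _; rewrite ltry.
elim: k x => [|k ih] x kN /=.
  rewrite lee_fin expr0 mul1r /g indicE; case: (boolP (x \in cball 1)) => [|_].
    rewrite inE /cball /= => x1; rewrite (_ : [forall i, _] = true) //.
    by apply/forallP => i; exact: (le_trans (ler_coord_enorm x i)) x1.
  by rewrite ler0n.
have g0 j y : 0 <= g j y by rewrite ler0n.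
apply: (@le_trans _ _ (\int[leb]_t ((2 ^+ k * g k.+1 x)%:E * (\1_(`[-1, 1]%classic) t)%:E))%E).
  apply: ge0_le_integral => //.
  - by move=> t _; rewrite iint_ge0E//; exact: integral_ge0.
  - apply: (measurableT_comp (f := iint k _ : VB -> _)); first exact: measurable_iint.
    exact: (measurableT_comp (measurable_upd k) (pair1_measurable (x : VB))).
  - by apply: measurable_funeM; apply/measurable_EFinP; exact: measurable_indic.
  - move=> t _; apply: le_trans (ih _ (ltnW kN)) _; rewrite -EFinM lee_fin -mulrA.
    rewrite ler_pM2l ?exprn_gt0// indicE mem_setE /= in_itv /= /g.
    case: (boolP [forall i, _]) => [/forallP H|_]; last by rewrite mulr_ge0 ?ler0n.
    rewrite (_ : [forall i, _] = true); last first.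
      apply/forallP => i; apply/implyP => ki; have /implyP/(_ (ltnW ki)) := H i.
      by rewrite mxE gtn_eqF.
    rewrite mul1r ler1n lt0b.
    have /implyP/(_ (leqnn _)) := H (Ordinal kN).
    by rewrite mxE eqxx ler_norml.
rewrite ge0_integralZl//; last 2 first.
  by apply/measurable_EFinP; exact: measurable_indic.
  by rewrite lee_fin mulr_ge0// exprn_ge0.
rewrite integral_indic// setIT [X in (_ * X)%E](lebesgue_measure_itv `[-1, 1]) /= lte_fin.
rewrite ifT; last by lra.
by rewrite -EFinD -EFinM lee_fin exprSr opprK -natr1; lra.
Qed.

Lemma vol_scale_set l (A : set VB) : 0 < l -> measurable A ->
  (vol A = (l ^+ N)%:E * vol [set x : VB | A (l *: (x : V))%R])%E.
Proof.
move=> l0 mA.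
have ml : measurable_fun setT (fun x : VB => (l *: (x : V))%R : VB).
  apply: measurable_coordP => i.
  rewrite [X in measurable_fun _ X](_ : _ = (fun x : VB => l * (x : V) ord0 i)).
    by apply: measurable_funM; [exact: measurable_cst|exact: measurable_coord].
  by apply/funext => y; rewrite mxE.
rewrite -[LHS]/(vol A) -[A in LHS]setIT -integral_indic//.
rewrite (ge0_vol_scale l0)//; last by apply/measurable_EFinP; exact: measurable_indic.
congr (_ * _)%E; rewrite -[X in vol X]setIT -integral_indic//.
by rewrite -[X in measurable X]setTI; exact: ml.
Qed.

Lemma vol_cball r : 0 < r -> (vol (cball r) = (r ^+ N)%:E * vol (cball 1))%E.
Proof.
move=> r0; rewrite (vol_scale_set r0); last exact: measurable_cball.
congr (_ * vol _)%E; apply/seteqP; split=> x;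
  by rewrite /cball /= enormZ ?(ltW r0)// ger_pMr.
Qed.

Hypothesis N0 : (0 < N)%N.

Lemma measurable_set1_0 : measurable [set 0 : VB].
Proof.
rewrite (_ : [set 0] = cball 0); first exact: measurable_cball.
apply/seteqP; split=> x /=; rewrite /cball /=.
  by move=> ->; rewrite (_ : enorm _ = 0)//; apply/eqP; rewrite enorm_eq0.
by move=> x0; apply/eqP; rewrite -enorm_eq0 eq_le x0 enorm_ge0.
Qed.

(** The origin is invariant under scaling by 2, so its volume [v] satisfies [v = 2^N v]; it is
    finite, being at most that of the unit ball. *)
Lemma vol_set1_0 : vol [set 0 : VB] = 0%E.
Proof.
have m0 := measurable_set1_0.
have := vol_scale_set (@ltr0n R 2) m0.
rewrite (_ : [set x : VB | _] = [set 0]); last first.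
  apply/seteqP; split=> x /=; last by move=> ->; rewrite scaler0.
  by move/eqP; rewrite scaler_eq0 (_ : _ == 0 = false) ?pnatr_eq0//= => /eqP.
have : (vol [set 0%R : VB] < +oo)%E.
  apply: le_lt_trans vol_cball1_lty; apply: le_measure; rewrite ?inE//.
    exact: measurable_cball.
  move=> x ->; rewrite /cball /= (_ : enorm _ = 0) ?ler01//.
  by apply/eqP; rewrite enorm_eq0.
have : (0 <= vol [set 0%R : VB])%E by exact: measure_ge0.
move: (vol [set 0]) => v v0 vy /eqP.
have /fineK <- : v \is a fin_num by rewrite ge0_fin_numE.
rewrite -EFinM eqe.
have h : 1 < 2 ^+ N :> R by rewrite exprn_egt1// ?ltr1n// -lt0n.
by move=> /eqP hv; congr EFin; have := fine_ge0 v0 => v0'; nra.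
Qed.

(* The area of the unit sphere. *)
Definition cvol : R := N%:R * fine (vol (cball 1)).

Lemma cvol_ge0 : 0 <= cvol.
Proof. by rewrite mulr_ge0// fine_ge0. Qed.

Lemma radial_measurable_exp : measurable_fun setT (fun t : measurableTypeR R => expR (N%:R * t)).
Proof.
by apply: continuous_measurable_fun; exact: continuous_expR_scale.
Qed.

Lemma vol_setD0 (A : set VB) : measurable A -> vol A = vol (A `\` [set 0]).
Proof.
move=> mA; have m0 := measurable_set1_0.
have -> : vol A = (vol (A `\` [set 0%R]) + vol (A `&` [set 0%R]))%E by exact: measureDI.
rewrite (_ : vol (A `&` [set 0]) = 0%E) ?adde0//.
apply/eqP; rewrite eq_le measure_ge0 andbT -vol_set1_0.
by apply: le_measure; rewrite ?inE//; exact: measurableI.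
Qed.

Lemma vol_cball_lty r : (vol (cball r) < +oo)%E.
Proof.
have [r0|r0] := ltP 0 r.
  rewrite vol_cball// lte_mul_pinfty// ?lee_fin ?exprn_ge0 ?ltW//.
  exact: vol_cball1_lty.
apply: le_lt_trans vol_cball1_lty; apply: le_measure; rewrite ?inE//;
  [exact: measurable_cball|exact: measurable_cball|].
by move=> x; rewrite /cball /= => /le_trans; apply; rewrite (le_trans r0).
Qed.

Lemma vol_shell a b : a < b ->
  vol [set x : VB | ln (enorm (x : V)) \in `]a, b]] =
  ((expR (N%:R * b) - expR (N%:R * a)) * fine (vol (cball 1)))%:E.
Proof.
move=> ab.
have mS : measurable [set x : VB | ln (enorm (x : V)) \in `]a, b]].
  have := @measurable_lnenorm R N measurableT `]a, b]%classic (measurable_itv _).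
  by rewrite setTI.
(* [ln] has a default value at 0, which may put the origin in the shell; it is removed as a null
   set. *)
rewrite vol_setD0//.
rewrite (_ : _ `\` _ = cball (expR b) `\` cball (expR a)); last first.
  apply/seteqP; split=> x; rewrite /cball /= in_itv /=.
    move=> [/andP[h1 h2]] /eqP; rewrite -enorm_gt0 => x0.
    rewrite -[X in X <= _](@lnK R) ?posrE// ler_expR; split=> //.
    by apply/negP; rewrite -ltNge -[ltRHS](@lnK R) ?posrE// ltr_expR.
  move=> [h1 /negP]; rewrite -ltNge => h2.
  have x0 : 0 < enorm (x : V) by apply: le_lt_trans h2; exact: expR_ge0.
  split; last by apply/eqP; rewrite -enorm_gt0.
  by rewrite -ltr_expR -[X in _ && X]ler_expR lnK ?posrE// h2.
have mc r := @measurable_cball r.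
have -> : vol (cball (expR b) `\` cball (expR a)) =
    (vol (cball (expR b)) - vol (cball (expR b) `&` cball (expR a)))%E.
  by apply: measureD => //; exact: vol_cball_lty.
rewrite (_ : _ `&` _ = cball (expR a)); last first.
  apply/seteqP; split=> x; rewrite /cball /=; first by case.
  by move=> h; split=> //; apply: le_trans h _; rewrite ler_expR ltW.
rewrite (vol_cball (expR_gt0 b)) (vol_cball (expR_gt0 a)) -!expRM_natl.
have /fineK <- : vol (cball 1) \is a fin_num by rewrite ge0_fin_numE// vol_cball1_lty.
by rewrite /= -!EFinM -EFinB mulrBl.
Qed.

(** Polar coordinates in [t = ln |x|]. The image of [vol] and the measure of density [cvol e^(N t)]
    agree on half-open intervals by [vol_shell], and these form a pi-system that generates the Borel
    sets. *)
Lemma ge0_radial_integral (G : measurableTypeR R -> \bar R) :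
  (forall t, 0 <= G t)%E -> measurable_fun setT G ->
  (\int[vol]_x G (ln (enorm x)) =
   cvol%:E * \int[leb]_t ((expR (N%:R * t))%:E * G t))%E.
Proof.
move=> G0 mG.
have ml : measurable_fun setT (fun x : VB => ln (enorm (x : V)) : measurableTypeR R).
  exact: measurable_lnenorm.
pose m := pfm vol ml.
pose nu : {measure set _ -> \bar R} := mscale (NngNum cvol_ge0)
  (mdens leb (fun t => expR_ge0 (N%:R * t)) radial_measurable_exp).
transitivity (\int[m]_t G t)%E; first by symmetry; apply: ge0_integral_pfm.
transitivity (\int[nu]_t G t)%E; last first.
  by rewrite ge0_integral_mscale// ge0_integral_dens.
have cover : \bigcup_k `](- k%:R), k%:R]%classic = [set: R].
  apply/seteqP; split=> // x _; exists (Num.trunc `|x|).+1 => //=; rewrite in_itv /=.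
  by have := truncnS_gt `|x|; rewrite ltr_norml => /andP[-> /ltW].
have E (A : set R) : ocitv A -> m A = nu A.
  move=> [[a b] _ <-]; rewrite [(a, b).1]/= [(a, b).2]/=; have [ab|ba] := ltP a b; last first.
    rewrite (_ : [set` _] = set0).
      by transitivity (0%E : \bar R); [exact: measure0|symmetry; exact: measure0].
    by apply/seteqP; split=> x //=; rewrite in_itv /= => /andP[/lt_le_trans h1 /h1 /lt_le_trans/(_ ba)]; rewrite ltxx.
  rewrite /m pfmE (_ : _ @^-1` _ = [set x : VB | ln (enorm (x : V)) \in `]a, b]]); last by [].
  rewrite vol_shell// /nu /mscale /=.
  transitivity (cvol%:E * \int[leb]_(t in `]a, b]) (expR (N%:R * t))%:E)%E; last by [].
  rewrite integral_itv_obnd_cbnd; last first.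
    by apply/measurable_EFinP; apply: measurable_funTS; exact: radial_measurable_exp.
  have Nn : N%:R != 0 :> R by rewrite pnatr_eq0 -lt0n.
  have dF (x : R) : is_derive x 1 (fun t => N%:R^-1 * expR (N%:R * t)) (expR (N%:R * x)).
    by rewrite -[X in is_derive _ _ _ X](mulKf Nn); exact/derZ/is_derive_expR_scale.
  rewrite (FTC2 ab dF (@continuous_expR_scale _)).
  by rewrite -EFinB -EFinM /cvol; congr EFin; field.
apply: eq_measure_integral => A mA _.
apply: (@measure_unique _ R (measurableTypeR R) (@ocitv R)
  (fun k : nat => `](- k%:R), k%:R]%classic) _ _ _ cover m nu E _ A mA) => //.
- exact: ocitvI.
- by move=> k; exact: is_ocitv.
- move=> k; apply: le_lt_trans (vol_cball_lty (expR k%:R)).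
  change (vol [set x : VB | ln (enorm (x : V)) \in `](- k%:R)%R, k%:R%R]] <=
    vol (cball (expR k%:R%R)))%E.
  apply: le_measure; rewrite ?inE//; [|exact: measurable_cball|].
    have := @measurable_lnenorm R N measurableT `](- k%:R), k%:R]%classic (measurable_itv _).
    by rewrite setTI.
  move=> x; rewrite /cball /= in_itv /= => /andP[_ h].
  have [->|] := eqVneq (x : V) 0; last first.
    by rewrite -enorm_gt0 => x0; rewrite -[X in X <= _](@lnK R) ?posrE// ler_expR.
  by rewrite (_ : enorm _ = 0) ?expR_ge0//; apply/eqP; rewrite enorm_eq0.
Qed.

End radial.

(** * Smooth functions of one variable *)

Section smooth1.
Variable R : realType.
Implicit Types f g : R -> R.

(* Smoothness as membership in a class of functions stable under differentiation. *)
Definition smooth1 f := exists S : set (R -> R), S f /\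
  forall g, S g -> exists2 g', S g' & forall x : R, is_derive x 1 g (g' x).

(** Closing the smooth functions under the operations gives a class stable under differentiation, so
    all closure properties of [smooth1] come from the single induction of [salg_derive]. *)
Inductive salg : (R -> R) -> Prop :=
| salg_base f of smooth1 f : salg f
| salg_cst c : salg (fun _ => c)
| salg_id : salg (fun t => t)
| salg_add f g of salg f & salg g : salg (fun t => f t + g t)
| salg_mul f g of salg f & salg g : salg (fun t => f t * g t)
| salg_comp f g of salg f & salg g : salg (fun t => f (g t)).

Lemma salg_derive f : salg f ->
  exists2 f', salg f' & forall x : R, is_derive x 1 f (f' x).
Proof.
elim=> {f} [f [S [Sf HS]]|c||f g _ [f' sf' df] _ [g' sg' dg]|
            f g sf [f' sf' df] sg [g' sg' dg]|f g sf [f' sf' df] sg [g' sg' dg]].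
- have [f' Sf' df] := HS f Sf; exists f' => //.
  by apply: salg_base; exists S.
- by exists (fun=> 0) => [|x]; [exact: salg_cst|exact: derC].
- by exists (fun=> 1) => [|x]; [exact: salg_cst|exact: derI].
- exists (fun t => f' t + g' t) => [|x]; first exact: salg_add.
  exact: derD.
- exists (fun t => f' t * g t + f t * g' t) => [|x]; last exact: derM.
  by apply: salg_add; apply: salg_mul.
- exists (fun t => f' (g t) * g' t) => [|x]; last exact: der_comp.
  by apply: salg_mul => //; apply: salg_comp.
Qed.

Lemma salg_smooth1 f : salg f -> smooth1 f.
Proof. by move=> sf; exists salg; split=> // g; exact: salg_derive. Qed.

Lemma smooth1_cst c : smooth1 (fun _ => c).
Proof. exact/salg_smooth1/salg_cst. Qed.

Lemma smooth1_id : smooth1 (fun t => t).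
Proof. exact/salg_smooth1/salg_id. Qed.

Lemma smooth1D f g : smooth1 f -> smooth1 g -> smooth1 (fun t => f t + g t).
Proof. by move=> sf sg; apply/salg_smooth1/salg_add; exact: salg_base. Qed.

Lemma smooth1M f g : smooth1 f -> smooth1 g -> smooth1 (fun t => f t * g t).
Proof. by move=> sf sg; apply/salg_smooth1/salg_mul; exact: salg_base. Qed.

Lemma smooth1_comp f g : smooth1 f -> smooth1 g -> smooth1 (fun t => f (g t)).
Proof. by move=> sf sg; apply/salg_smooth1/salg_comp; exact: salg_base. Qed.

Lemma smooth1Z c f : smooth1 f -> smooth1 (fun t => c * f t).
Proof. by move=> sf; apply: smooth1M => //; exact: smooth1_cst. Qed.

Lemma smooth1B f g : smooth1 f -> smooth1 g -> smooth1 (fun t => f t - g t).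
Proof.
move=> sf sg; have -> : (fun t => f t - g t) = (fun t => f t + -1 * g t).
  by apply/funext => t; rewrite mulN1r.
by apply: smooth1D => //; exact: smooth1Z.
Qed.

Lemma der_unique f (a b : R -> R) : (forall x : R, is_derive x 1 f (a x)) ->
  (forall x : R, is_derive x 1 f (b x)) -> a = b.
Proof.
by move=> da db; apply/funext => x; have [_ <-] := da x; have [_ <-] := db x.
Qed.

Lemma smooth1_derive f : smooth1 f ->
  exists2 f', smooth1 f' & forall x : R, is_derive x 1 f (f' x).
Proof. by move=> [S [Sf HS]]; have [f' Sf' df] := HS f Sf; exists f' => //; exists S. Qed.

Lemma smooth1_der f f' : smooth1 f -> (forall x : R, is_derive x 1 f (f' x)) ->
  smooth1 f'.
Proof. by move=> /smooth1_derive[g sg dg] df; rewrite (der_unique df dg). Qed.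

Lemma smooth1_continuous f : smooth1 f -> continuous f.
Proof. by move=> /smooth1_derive[g sg dg]; exact: is_derive_continuous dg. Qed.

Lemma smooth1_expR c : smooth1 (fun t => expR (c * t)).
Proof.
exists [set f | exists a, f = fun t => a * expR (c * t)]; split.
  by exists 1; apply/funext => t; rewrite mul1r.
move=> _ [a ->]; exists (fun t => a * c * expR (c * t)); first by exists (a * c).
by move=> x; rewrite -mulrA; exact/derZ/is_derive_expR_scale.
Qed.

Definition csupp f := exists r, forall t, r < `|t| -> f t = 0.
Definition test1 f := smooth1 f /\ csupp f.

Lemma der_near0 f (a x : R) : is_derive x 1 f a -> (\forall t \near x, f t = 0) -> a = 0.
Proof.
move=> [_ <-] h; have d0 : is_derive x 1 f 0.
  apply: (near_eq_is_derive _ (derC 0 x)).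
  by near=> t; symmetry; near: t.
by have [_ ->] := d0.
Unshelve. all: by end_near. Qed.

Lemma csupp_der f f' : csupp f -> (forall x : R, is_derive x 1 f (f' x)) -> csupp f'.
Proof.
move=> [r h] df; exists r => t rt; apply: der_near0 (df t) _.
have : \forall s \near t, r < `|s|.
  exact: (cvgr_gt `|t| (@norm_continuous _ _ t) r rt).
by apply: filterS => s; exact: h.
Qed.

Lemma test1_der f f' : test1 f -> (forall x : R, is_derive x 1 f (f' x)) -> test1 f'.
Proof. by move=> [sf cf] df; split; [exact: smooth1_der df|exact: csupp_der df]. Qed.

Lemma test1_derive f : test1 f -> exists2 f', test1 f' & forall x : R, is_derive x 1 f (f' x).
Proof.
by move=> tf; have [f' _ df] := smooth1_derive tf.1; exists f' => //; exact: test1_der df.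
Qed.

Lemma test1M f g : test1 f -> smooth1 g -> test1 (fun t => f t * g t).
Proof.
move=> [sf [r cf]] sg; split; first exact: smooth1M.
by exists r => t /cf ->; rewrite mul0r.
Qed.

Lemma test1D f g : test1 f -> test1 g -> test1 (fun t => f t + g t).
Proof.
move=> [sf [r cf]] [sg [s cg]]; split; first exact: smooth1D.
by exists (Num.max r s) => t; rewrite gt_max => /andP[/cf -> /cg ->]; rewrite addr0.
Qed.

Lemma test1Z c f : test1 f -> test1 (fun t => c * f t).
Proof.
move=> [sf [r cf]]; split; first exact: smooth1Z.
by exists r => t /cf ->; rewrite mulr0.
Qed.

Section bump.
Implicit Types s : R.

(* Up to linear combinations, this family is stable under differentiation. *)
Definition bump_ k s : R := if 0 < s then s ^- k * expR (- s^-1) else 0.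

Lemma expR_ge_pow n (x : R) : 0 <= x -> (x / n.+1%:R) ^+ n.+1 <= expR x.
Proof.
move=> x0; have -> : expR x = expR (x / n.+1%:R) ^+ n.+1.
  by rewrite -expRM_natl mulrC divfK.
rewrite lerXn2r ?nnegrE ?expR_ge0 ?divr_ge0//.
by apply: le_trans (expR_ge1Dx _); rewrite lerDr.
Qed.

(** The exponential beats the power [k + 2] of [s], which leaves [s^2]; a quadratic bound is what
    [is_derive0_sq] needs for a zero derivative at the origin. *)
Lemma bump_le_sq k s : `|bump_ k s| <= (k.+2%:R ^+ k.+2) * s ^+ 2.
Proof.
rewrite /bump_; case: ifP => [s0|_]; last by rewrite normr0 mulr_ge0 ?sqr_ge0 ?exprn_ge0.
rewrite ger0_norm; last by rewrite mulr_ge0 ?expR_ge0 ?invr_ge0 ?exprn_ge0 ?ltW.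
set n := k.+2; have n0 : 0 < n%:R :> R by rewrite ltr0n.
have h : (s^-1 / n%:R) ^+ n <= expR s^-1 by apply: expR_ge_pow; rewrite invr_ge0 ltW.
have h' : expR (- s^-1) <= n%:R ^+ n * s ^+ n.
  apply: (@le_trans _ _ ((s^-1 / n%:R) ^+ n)^-1).
    by rewrite expRN lef_pV2 ?posrE ?expR_gt0 ?exprn_gt0 ?divr_gt0 ?invr_gt0.
  by rewrite -exprVn invf_div invrK exprMn.
apply: (@le_trans _ _ (s ^- k * (n%:R ^+ n * s ^+ n))).
  by rewrite ler_pM2l// invr_gt0 exprn_gt0.
by rewrite mulrCA ler_pM2l ?exprn_gt0// /n -addn2 exprD mulKf// expf_neq0// gt_eqF.
Qed.

Lemma is_derive0_sq f C : f 0 = 0 -> (forall h, `|f h| <= C * h ^+ 2) ->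
  is_derive (0 : R) 1 f 0.
Proof.
move=> f0 fC; have C0 : 0 <= C by have := fC 1; rewrite expr1n mulr1; exact: le_trans.
have lim : h^-1 *: ((f \o +%R^~ 0) (h *: 1) - f 0) @[h --> (0 : R)^'] --> (0 : R).
  apply/cvgr0Pnorm_lt => e e0; near=> h.
  rewrite f0 subr0 /= addr0 /GRing.scale /= mulr1 normrM.
  have h0 : h != 0 by near: h; exact: nbhs_dnbhs_neq.
  apply: (@le_lt_trans _ _ (`|h^-1| * (C * h ^+ 2))); first by rewrite ler_wpM2l.
  rewrite -[h ^+ 2]real_normK ?num_real// normfV mulrCA expr2 mulKf ?normr_eq0//.
  have : `|h| < e / (C + 1).
    near: h; apply: dnbhs0_lt; rewrite divr_gt0//.
    by lra.
  rewrite ltr_pdivlMr; last by lra.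
  move=> he; apply: le_lt_trans he.
  by rewrite mulrC ler_wpM2l// lerDl.
apply: DeriveDef; first by apply/cvg_ex; exists 0.
exact: cvg_lim lim.
Unshelve. all: by end_near. Qed.

Lemma is_derive_bump k s :
  is_derive s 1 (bump_ k) (- k%:R * bump_ k.+1 s + bump_ k.+2 s).
Proof.
have [s0|s0|->] := ltgtP s 0.
- rewrite /bump_ !ifF ?mulr0 ?addr0; try by apply/negbTE; rewrite -leNgt ltW.
  apply: (near_eq_is_derive _ (derC 0 s)).
  have : \forall t \near s, t < 0 by apply: lt_nbhsl.
  by apply: filterS => t t0; rewrite ifF//; apply/negbTE; rewrite -leNgt ltW.
- rewrite (_ : - _ * _ + _ = - k%:R * (s ^- k.+1 * expR (- s^-1)) +
      s ^- k.+2 * expR (- s^-1)); last by rewrite /bump_ s0.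
  apply: (near_eq_is_derive (f := fun t : R => t ^- k * expR (- t^-1))).
    have : \forall t \near s, 0 < t by exact: lt_nbhsr.
    by apply: filterS => t t0; rewrite /bump_ t0.
  have sn : s != 0 by rewrite gt_eqF.
  have dV : is_derive s 1 (fun t : R => t^-1) (- s ^- 2).
    by apply: der_eq (is_deriveV sn (derI s)) _; rewrite /GRing.scale /= mulr1.
  have dk : is_derive s 1 (fun t : R => t ^- k) (- k%:R * s ^- k.+1).
    have hX : is_derive s 1 (fun t : R => (t^-1) ^+ k) ((k%:R * s^-1 ^+ k.-1) * - s ^- 2).
      by have := is_deriveX k dV; rewrite exprfctE.
    have -> : (fun t : R => t ^- k) = (fun t => t^-1 ^+ k).
      by apply/funext => t; rewrite exprVn.
    apply: der_eq hX _; case: (k) => [|j]; first by rewrite !mul0r oppr0 mul0r.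
    by rewrite /= exprVn !exprS expr0; field; rewrite sn expf_neq0.
  have dN : is_derive s 1 (fun t : R => - t^-1) (s ^- 2).
    by apply: der_eq (is_deriveN dV) _; rewrite opprK.
  apply: der_eq (derM dk (der_exp dN)) _.
  by rewrite !exprS expr0; field; rewrite sn expf_neq0.
- rewrite /bump_ !ltxx mulr0 addr0.
  apply: (@is_derive0_sq (bump_ k) _); first by rewrite /bump_ ltxx.
  exact: bump_le_sq.
Qed.

Definition bump := bump_ 0.

Lemma smooth1_bump : smooth1 bump.
Proof.
pose S := [set f | exists r : seq (R * nat), f = fun t => \sum_(x <- r) x.1 * bump_ x.2 t].
exists S; split.
  by exists [:: (1, 0%N)]; apply/funext => t; rewrite big_seq1 mul1r.
move=> _ [r ->].
exists (fun t => \sum_(x <- flatten [seq [:: (x.1 * - x.2%:R, x.2.+1); (x.1, x.2.+2)] | x <- r]) x.1 * bump_ x.2 t).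
  by eexists.
move=> x; elim: r => [|[c k] r ih].
  by under eq_fun do rewrite big_nil; rewrite /= big_nil; exact: derC.
under eq_fun do rewrite big_cons.
rewrite /= !big_cons addrA; apply: derD ih.
by apply: der_eq (derZ _ (is_derive_bump k x)) _; rewrite /= mulrDr mulrA.
Qed.

Lemma bump_ge0 s : 0 <= bump s.
Proof. by rewrite /bump /bump_; case: ifP => // _; rewrite expr0 invr1 mul1r expR_ge0. Qed.

Lemma bump_le1 s : bump s <= 1.
Proof.
rewrite /bump /bump_; case: ifP => // s0; rewrite expr0 invr1 mul1r.
by rewrite -expR0 ler_expR oppr_le0 invr_ge0 ltW.
Qed.

Lemma bump_le0 s : s <= 0 -> bump s = 0.
Proof. by move=> s0; rewrite /bump /bump_ ltNge s0. Qed.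

Lemma bump_gt0E s : 0 < s -> bump s = expR (- s^-1).
Proof. by move=> s0; rewrite /bump /bump_ s0 expr0 invr1 mul1r. Qed.

End bump.

End smooth1.

(** * Radial test functions *)

Section testND.
Variables (R : realType) (N : nat).
Notation V := 'rV[R]_N.
Implicit Types (x : V) (i : 'I_N).

Definition sumsq x : R := \sum_(i < N) x ord0 i ^+ 2.

Lemma upd_id x i : upd x i (x ord0 i) = x.
Proof. by apply/rowP => j; rewrite mxE; case: eqP => // /val_inj ->. Qed.

Lemma upd_coord x i t : upd x i t ord0 i = t.
Proof. by rewrite mxE eqxx. Qed.

Lemma upd_coord_neq x i j t : j != i -> upd x i t ord0 j = x ord0 j.
Proof. by move=> ji; rewrite mxE (negPf (_ : val j != val i)). Qed.

Lemma sumsq_upd x i t : sumsq (upd x i t) = sumsq x - x ord0 i ^+ 2 + t ^+ 2.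
Proof.
rewrite /sumsq (bigD1 i)//= [in RHS](bigD1 i)//= upd_coord.
under eq_bigr => j ji do rewrite (upd_coord_neq _ _ ji).
by ring.
Qed.

(** [pd] takes a default value where the derivative does not exist; [ispd] also records existence at
    every point. *)
Definition ispd i (f f' : V -> R) := forall x,
  is_derive (x ord0 i) 1 (fun t => f (upd x i t)) (f' x).

Lemma ispd_pd i f f' : ispd i f f' -> pd i f = f'.
Proof.
by move=> h; apply/funext => x; rewrite /pd derive1E; have [_ ->] := h x.
Qed.

Lemma ispdD i f f' g g' : ispd i f f' -> ispd i g g' ->
  ispd i (fun x => f x + g x) (fun x => f' x + g' x).
Proof. by move=> hf hg x; exact: derD. Qed.

Lemma ispdM i f f' g g' : ispd i f f' -> ispd i g g' ->
  ispd i (fun x => f x * g x) (fun x => f' x * g x + f x * g' x).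
Proof.
move=> hf hg x; have := derM (hf x) (hg x).
by rewrite upd_id.
Qed.

Lemma ispd_sumsq i (F F' : R -> R) : (forall t : R, is_derive t 1 F (F' t)) ->
  ispd i (fun x => F (sumsq x)) (fun x => 2 * x ord0 i * F' (sumsq x)).
Proof.
move=> dF x; have -> : (fun t => F (sumsq (upd x i t))) =
    (fun t => F (sumsq x - x ord0 i ^+ 2 + t * t)).
  by apply/funext => t; rewrite sumsq_upd expr2.
have h := derD (derC (sumsq x - x ord0 i ^+ 2) (x ord0 i))
  (derM (derI (x ord0 i)) (derI (x ord0 i))).
apply: der_eq (der_comp (dF _) h) _.
rewrite mulrC (_ : sumsq x - _ + _ = sumsq x); first by congr (_ * _); ring.
by ring.
Qed.

Lemma ispd_coord i j (F F' : R -> R) : (forall t : R, is_derive t 1 F (F' t)) ->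
  ispd i (fun x => F (x ord0 j)) (fun x => (j == i)%:R * F' (x ord0 j)).
Proof.
move=> dF x; have [->|ji] := eqVneq j i.
  rewrite mul1r (_ : (fun t => _) = F); first exact: dF.
  by apply/funext => t; rewrite upd_coord.
rewrite mul0r (_ : (fun t => _) = fun _ => F (x ord0 j)); first exact: derC.
by apply/funext => t; rewrite upd_coord_neq.
Qed.

(** Closed under partial derivatives, so that members are [smooth]. The generators use [|x|^2],
    which is smooth at the origin, instead of [|x|]. *)
Inductive cls : (V -> R) -> Prop :=
| cls_sumsq F of smooth1 F : cls (fun x => F (sumsq x))
| cls_coord F j of smooth1 F : cls (fun x => F (x ord0 j))
| cls_cst c : cls (fun=> c)
| clsD f g of cls f & cls g : cls (fun x => f x + g x)
| clsM f g of cls f & cls g : cls (fun x => f x * g x).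

Lemma cls_ispd i f : cls f -> exists2 f', cls f' & ispd i f f'.
Proof.
elim=> {f} [F sF|F j sF|c|f g _ [f' cf df] _ [g' cg dg]|f g cf0 [f' cf df] cg0 [g' cg dg]].
- have [F' sF' dF] := smooth1_derive sF.
  exists (fun x => 2 * x ord0 i * F' (sumsq x)); last exact: ispd_sumsq.
  apply: (clsM (f := fun x => 2 * x ord0 i)); last exact: cls_sumsq.
  by apply: (cls_coord (F := fun t => 2 * t)); apply: smooth1Z; exact: smooth1_id.
- have [F' sF' dF] := smooth1_derive sF.
  exists (fun x => (j == i)%:R * F' (x ord0 j)); last exact: ispd_coord.
  by apply: (cls_coord (F := fun t => (j == i)%:R * F' t)); exact: smooth1Z.
- by exists (fun=> 0) => [|x]; [exact: cls_cst|exact: derC].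
- by exists (fun x => f' x + g' x); [exact: clsD|exact: ispdD].
- exists (fun x => f' x * g x + f x * g' x); last exact: ispdM.
  by apply: clsD; exact: clsM.
Qed.

Lemma cls_pd i f : cls f -> cls (pd i f) /\ ispd i f (pd i f).
Proof. by move=> /(cls_ispd i)[f' cf' df]; rewrite (ispd_pd df). Qed.

Lemma cls_continuous f : cls f -> continuous f.
Proof.
elim=> {f} [F sF|F j sF|c|f g _ cf _ cg|f g _ cf _ cg] x.
- apply: (@continuous_comp _ _ _ sumsq F); first exact: continuous_sumsq.
  exact: (smooth1_continuous sF).
- apply: (@continuous_comp _ _ _ (fun x : V => x ord0 j) F); first exact: coord_continuous.
  exact: (smooth1_continuous sF).
- exact: cst_continuous.
- exact: (cvgD (cf x) (cg x)).
- exact: (cvgM (cf x) (cg x)).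
Qed.

Lemma cls_smooth f : cls f -> smooth f.
Proof.
move=> cf s x; have : cls (ipd s f) by elim: s => [//|i s /(cls_pd i)[]].
move=> cs; split; first exact: cls_continuous.
by move=> i; have [_ /(_ x)[]] := cls_pd i cs.
Qed.

Lemma cls_testfn f r : cls f -> (forall x, r < enorm x -> f x = 0) -> testfn f.
Proof. by move=> cf fr; split; [exact: cls_smooth|exists r]. Qed.

Lemma cls_prod (F : 'I_N -> R -> R) (r : seq 'I_N) : (forall i, smooth1 (F i)) ->
  cls (fun x => \prod_(i <- r) F i (x ord0 i)).
Proof.
move=> sF; elim: r => [|i r ih].
  by rewrite (_ : (fun x => _) = fun=> 1); [exact: cls_cst|apply/funext => x; rewrite big_nil].
rewrite (_ : (fun x => _) = fun x => F i (x ord0 i) * \prod_(i <- r) F i (x ord0 i)).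
  by apply: clsM => //; exact: cls_coord.
by apply/funext => x; rewrite big_cons.
Qed.

(* The value at the origin is set to [0], also when [psi] does not vanish near [-oo]. *)
Definition rad (psi : R -> R) (x : V) : R :=
  if x == 0 then 0 else psi (ln (enorm x)).

Lemma sumsq_enorm x : sumsq x = enorm x ^+ 2. Proof. by rewrite enorm_sqr. Qed.

(** [rad psi] as a function of [s = |x|^2], since [ln |x|] is half of [ln s]. *)
Definition profile (psi : R -> R) (s : R) : R := if 0 < s then psi (2^-1 * ln s) else 0.

Lemma rad_profile psi x : rad psi x = profile psi (sumsq x).
Proof.
rewrite /rad /profile sumsq_enorm; case: (eqVneq x 0) => [x0|x0].
  have /eqP -> : enorm x == 0 by rewrite enorm_eq0 x0.
  by rewrite expr0n /= ltxx.
have e0 : 0 < enorm x by rewrite enorm_gt0.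
by rewrite exprn_gt0// lnXn// -[ln _ *+ _]mulr_natr mulrCA mulVf ?mulr1// pnatr_eq0.
Qed.

Lemma is_derive_profile (psi psi' : R -> R) (s : R) : test1 psi ->
  (forall t : R, is_derive t 1 psi (psi' t)) ->
  is_derive s 1 (profile psi) (profile (fun t => 2^-1 * (expR (-2 * t) * psi' t)) s).
Proof.
move=> [_ [r hr]] dpsi; have [s0|s0] := ltP 0 s.
  apply: (near_eq_is_derive (f := fun t : R => psi (2^-1 * ln t))).
    have : \forall t \near s, 0 < t by exact: lt_nbhsr.
    by apply: filterS => t t0; rewrite /profile t0.
  apply: der_eq (der_comp (dpsi _) (derZ 2^-1 (is_derive1_ln s0))) _.
  rewrite /profile s0 mulrCA; congr (_ * _); rewrite mulrC; congr (_ * _).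
  by rewrite mulrA mulNr mulfV ?pnatr_eq0// mulN1r expRN lnK.
(* Below [e^(-2 (|r| + 1))] half the logarithm lies to the left of the support of [psi], so the
   profile vanishes near every [s <= 0]. *)
have h : \forall t \near s, profile psi t = 0.
  have : \forall t \near s, t < expR (- 2 * (`|r| + 1)).
    by apply: lt_nbhsl; apply: le_lt_trans s0 _; exact: expR_gt0.
  apply: filterS => t; rewrite /profile; case: ifP => // t0.
  rewrite -[ltLHS](@lnK R) ?posrE// ltr_expR => ht.
  apply: hr; rewrite ltr0_norm; have := ler_norm r; have := normr_ge0 r; lra.
rewrite /profile ltNge s0 /=.
by apply: (near_eq_is_derive _ (derC 0 s)); apply: filterS h => t ht; exact: esym ht.
Qed.

Lemma test1_profile (psi psi' : R -> R) : test1 psi -> (forall t : R, is_derive t 1 psi (psi' t)) ->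
  test1 (fun t => 2^-1 * (expR (-2 * t) * psi' t)).
Proof.
move=> tpsi dpsi; apply: test1Z.
have := test1M (test1_der tpsi dpsi) (smooth1_expR (-2)).
by congr test1; apply/funext => t; rewrite mulrC.
Qed.

Lemma smooth1_profile psi : test1 psi -> smooth1 (profile psi).
Proof.
move=> tpsi; exists [set f | exists2 p, test1 p & f = profile p]; split; first by exists psi.
move=> _ [p tp ->]; have [p' tp' dp] := test1_derive tp.
exists (profile (fun t => 2^-1 * (expR (-2 * t) * p' t))).
  by eexists; last reflexivity; exact: test1_profile dp.
by move=> x; exact: is_derive_profile.
Qed.

Lemma rad_profileE psi : rad psi = fun x => profile psi (sumsq x).
Proof. by apply/funext => x; exact: rad_profile. Qed.

Lemma cls_rad psi : test1 psi -> cls (rad psi).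
Proof. by move=> tpsi; rewrite rad_profileE; apply: cls_sumsq; exact: smooth1_profile. Qed.

Lemma cls_crad psi i : test1 psi -> cls (fun x => x ord0 i * rad psi x).
Proof.
move=> tpsi; apply: clsM; last exact: cls_rad.
exact: (cls_coord _ (smooth1_id R)).
Qed.

Lemma rad_supp psi : csupp psi -> exists r, forall x, r < enorm x -> rad psi x = 0.
Proof.
move=> [r hr]; exists (expR `|r|) => x xr; rewrite /rad; case: ifP => // _.
have x0 : 0 < enorm x by apply: lt_trans xr; exact: expR_gt0.
apply: hr; apply: le_lt_trans (ler_norm r) _; apply: lt_le_trans (ler_norm _).
by rewrite -ltr_expR lnK.
Qed.

Lemma testfn_rad psi : test1 psi -> testfn (rad psi).
Proof.
move=> tpsi; have [r hr] := rad_supp tpsi.2.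
exact: cls_testfn (cls_rad tpsi) hr.
Qed.

Lemma testfn_crad psi i : test1 psi -> testfn (fun x => x ord0 i * rad psi x).
Proof.
move=> tpsi; have [r hr] := rad_supp tpsi.2.
apply: (cls_testfn (cls_crad i tpsi) (r := r)) => x /hr ->.
by rewrite mulr0.
Qed.

Lemma ispd_rad (psi psi' : R -> R) i : test1 psi -> (forall t : R, is_derive t 1 psi (psi' t)) ->
  ispd i (rad psi) (fun x => x ord0 i * rad (fun t => expR (-2 * t) * psi' t) x).
Proof.
move=> tpsi dpsi; rewrite rad_profileE.
have := ispd_sumsq i (fun t => is_derive_profile t tpsi dpsi).
congr ispd; apply/funext => x; rewrite rad_profile mulrAC mulrC; congr (_ * _).
rewrite /profile; case: ifP => _; last by rewrite mulr0.
by rewrite mulrA mulfV ?mul1r.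
Qed.

Lemma pd_rad (psi psi' : R -> R) i : test1 psi -> (forall t : R, is_derive t 1 psi (psi' t)) ->
  pd i (rad psi) = (fun x => x ord0 i * rad (fun t => expR (-2 * t) * psi' t) x).
Proof. by move=> tpsi dpsi; exact/ispd_pd/ispd_rad. Qed.

(** By [pd_rad] every radial gradient is a field [x k(ln |x|)], so this divergence gives the
    Laplacian, and also the term [div (grad u / |x|^2)] of the equation. *)
Lemma div_crad (k k' : R -> R) x : test1 k -> (forall t : R, is_derive t 1 k (k' t)) ->
  \sum_(i < N) pd i (fun y => y ord0 i * rad k y) x = rad (fun t => N%:R * k t + k' t) x.
Proof.
move=> tk dk.
have -> : \sum_(i < N) pd i (fun y => y ord0 i * rad k y) x =
    \sum_(i < N) (rad k x + x ord0 i ^+ 2 * rad (fun t => expR (-2 * t) * k' t) x).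
  apply: eq_bigr => i _.
  have := ispdM (ispd_coord i i (fun t => derI t)) (ispd_rad i tk dk).
  move=> /ispd_pd ->; rewrite eqxx mulr1 mul1r mulrA -expr2.
  by [].
rewrite big_split /= sumr_const card_ord -mulr_suml -/(sumsq x) sumsq_enorm /rad.
case: eqP => [|/eqP x0]; first by rewrite mul0rn mulr0 addr0.
rewrite mulr_natl; congr (_ + _).
by rewrite mulrA mulNr expRN expRM_natl lnK ?posrE ?enorm_gt0// mulfV ?mul1r// expf_neq0// enorm_eq0.
Qed.

Lemma lap_rad (psi psi' psi'' : R -> R) x : test1 psi ->
  (forall t : R, is_derive t 1 psi (psi' t)) ->
  (forall t : R, is_derive t 1 psi' (psi'' t)) ->
  lap (rad psi) x = rad (fun t => expR (-2 * t) * (psi'' t + (N%:R - 2) * psi' t)) x.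
Proof.
move=> tpsi dpsi dpsi'.
have tk : test1 (fun t => expR (-2 * t) * psi' t).
  have := test1M (test1_der tpsi dpsi) (smooth1_expR (-2)).
  by congr test1; apply/funext => t; rewrite mulrC.
have dk (t : R) : is_derive t 1 (fun t => expR (-2 * t) * psi' t)
   (-2 * expR (-2 * t) * psi' t + expR (-2 * t) * psi'' t).
  by apply: derM => //; exact: is_derive_expR_scale.
rewrite /lap /ipd /=; under eq_bigr do rewrite (pd_rad _ tpsi dpsi).
rewrite (div_crad _ tk dk) /rad; case: ifP => // _; ring.
Qed.

End testND.

(** * Real-valued integrable functions *)

Section real_integral.
Context d (T : measurableType d) (R : realType) (mu : {measure set T -> \bar R}).
Implicit Types f g : T -> R.

Definition intg f := mu.-integrable setT (fun x => (f x)%:E).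
Definition rint f : R := fine (\int[mu]_x (f x)%:E)%E.

Lemma intg_meas f : intg f -> measurable_fun setT f.
Proof. by move=> /integrableP[/measurable_EFinP]. Qed.

Lemma intgP f : measurable_fun setT f -> (\int[mu]_x `|f x|%:E < +oo)%E -> intg f.
Proof. by move=> mf h; apply/integrableP; split=> //; exact/measurable_EFinP. Qed.

Lemma intg_lty f : intg f -> (\int[mu]_x `|f x|%:E < +oo)%E.
Proof. by move=> /integrableP[]. Qed.

Lemma rintE f : intg f -> (\int[mu]_x (f x)%:E)%E = (rint f)%:E.
Proof. by move=> h; rewrite /rint fineK//; exact: integrable_fin_num. Qed.

Lemma intg_le f g : measurable_fun setT f -> (forall x, `|f x| <= g x) -> intg g -> intg f.
Proof.
move=> mf fg; apply: le_integrable => //; first exact/measurable_EFinP.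
by move=> x _; rewrite lee_fin (le_trans (fg x))// ler_norm.
Qed.

Lemma intg0 : intg (fun=> 0).
Proof. exact: integrable0. Qed.

Lemma intgD f g : intg f -> intg g -> intg (fun x => f x + g x).
Proof. exact: integrableD. Qed.

Lemma intgZ c f : intg f -> intg (fun x => c * f x).
Proof. exact: integrableZl. Qed.

Lemma intgN f : intg f -> intg (fun x => - f x).
Proof. exact: integrableN. Qed.

Lemma intgB f g : intg f -> intg g -> intg (fun x => f x - g x).
Proof. by move=> hf hg; apply: intgD => //; exact: intgN. Qed.

Lemma intg_norm f : intg f -> intg (fun x => `|f x|).
Proof.
move=> h; apply: intgP; first by apply: measurableT_comp => //; exact: intg_meas.
by under eq_integral do rewrite normr_id; exact: intg_lty.
Qed.

Lemma rintD f g : intg f -> intg g -> rint (fun x => f x + g x) = rint f + rint g.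
Proof. exact: RintegralD. Qed.

Lemma rintB f g : intg f -> intg g -> rint (fun x => f x - g x) = rint f - rint g.
Proof. exact: RintegralB. Qed.

Lemma rintZ c f : intg f -> rint (fun x => c * f x) = c * rint f.
Proof. exact: RintegralZl. Qed.

Lemma rintN f : intg f -> rint (fun x => - f x) = - rint f.
Proof.
move=> hf; rewrite -mulN1r -rintZ//; congr rint.
by apply/funext => x; rewrite mulN1r.
Qed.

Lemma intg_sum (I : Type) (r : seq I) (F : I -> T -> R) : (forall i, intg (F i)) ->
  intg (fun x => \sum_(i <- r) F i x).
Proof.
move=> h; elim: r => [|i r ih].
  by under eq_fun do rewrite big_nil; exact: intg0.
by under eq_fun do rewrite big_cons; exact: intgD.
Qed.

Lemma rint_sum (I : Type) (r : seq I) (F : I -> T -> R) : (forall i, intg (F i)) ->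
  rint (fun x => \sum_(i <- r) F i x) = \sum_(i <- r) rint (F i).
Proof.
move=> h; elim: r => [|i r ih].
  by rewrite big_nil; under eq_fun do rewrite big_nil; rewrite /rint integral0.
rewrite big_cons -ih -rintD//; last exact: intg_sum.
by under eq_fun do rewrite big_cons.
Qed.

Lemma eq_rint f g : f =1 g -> rint f = rint g.
Proof. by move=> /funext ->. Qed.

Lemma ae_rint f g : measurable_fun setT f -> measurable_fun setT g ->
  {ae mu, forall x, f x = g x} -> rint f = rint g.
Proof.
move=> mf mg fg; congr fine; apply: ae_eq_integral => //;
  [exact/measurable_EFinP|exact/measurable_EFinP|].
by apply: filterS fg => x fgx _; rewrite fgx.
Qed.

Lemma ae_intg f g : measurable_fun setT g -> intg f ->
  {ae mu, forall x, f x = g x} -> intg g.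
Proof.
move=> mg hf fg; apply: intgP => //.
rewrite -(@ae_eq_integral _ _ _ mu _ _ (fun x => `|f x|%:E)) ?intg_lty//.
- by apply/measurable_EFinP; apply: measurableT_comp => //; exact: intg_meas.
- by apply/measurable_EFinP; apply: measurableT_comp.
- by apply: filterS fg => x fgx _; rewrite fgx.
Qed.

Lemma rint_ge0 f : (forall x, 0 <= f x) -> 0 <= rint f.
Proof. by move=> f0; apply: fine_ge0; apply: integral_ge0 => x _; rewrite lee_fin. Qed.

Lemma le_rint f g : intg f -> intg g -> (forall x, f x <= g x) -> rint f <= rint g.
Proof. by move=> hf hg fg; apply: le_Rintegral. Qed.

Lemma dct (f_ : nat -> T -> R) f g : (forall n, measurable_fun setT (f_ n)) ->
  measurable_fun setT f -> (forall x, f_ n x @[n --> \oo] --> f x) ->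
  intg g -> (forall n x, `|f_ n x| <= g x) ->
  intg f /\ rint (f_ n) @[n --> \oo] --> rint f.
Proof.
move=> mf_ mf cf ig fg.
have [|||||iF _ cI] := @dominated_convergence _ T R mu setT measurableT
   (fun n x => (f_ n x)%:E) (fun x => (f x)%:E) (fun x => (g x)%:E).
- by move=> n; exact/measurable_EFinP.
- exact/measurable_EFinP.
- by apply: aeW => x _; apply/fine_cvgP; split; [exact: nearW|exact: cf].
- exact: ig.
- by apply: aeW => x n _; rewrite lee_fin.
split=> //; move: cI; rewrite (rintE iF) => /fine_cvg.
exact.
Qed.

Lemma intg_sq f g : measurable_fun setT f -> measurable_fun setT g ->
  intg (fun x => f x ^+ 2) -> intg (fun x => g x ^+ 2) -> intg (fun x => f x * g x).
Proof.
move=> mf mg hf hg; apply: intg_le (intgD hf hg); first exact: measurable_funM.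
move=> x; rewrite normrM -[f x ^+ 2]real_normK ?num_real// -[g x ^+ 2]real_normK ?num_real//.
have := sqr_ge0 (`|f x| - `|g x|); have := normr_ge0 (f x); have := normr_ge0 (g x).
by nra.
Qed.

End real_integral.

(** * Green's formulas *)

Section greenND.
Variables (R : realType) (N : nat).
Notation V := 'rV[R]_N.
Notation VB := (VB R N).
Notation vol := (@vol R N).
Implicit Types (x : V) (i : 'I_N) (u f g phi : V -> R).

Lemma measRNP u : measRN u <-> measurable_fun setT (u : VB -> R).
Proof.
split=> [mu _ B mB|mu B mB]; first by rewrite setTI; exact: mu.
by have := mu measurableT B mB; rewrite setTI.
Qed.

Lemma intRN_rint f : intg vol f -> intRN (fun x => (f x)%:E) = (rint vol f)%:E.
Proof. by move=> h; rewrite intRNE// rintE. Qed.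

Lemma intRN_lty f : measurable_fun setT (f : VB -> R) -> (forall x, 0 <= f x) ->
  (intRN (fun x => (f x)%:E) < +oo)%E -> intg vol f.
Proof.
move=> mf f0; rewrite intRN_ge0E//; last exact/measurable_EFinP.
move=> h; apply: intgP => //; apply: le_lt_trans h.
by apply: ge0_le_integral => //; rewrite ?lee_fin//;
  [apply/measurable_EFinP; exact: measurableT_comp|exact/measurable_EFinP|move=> x _; rewrite ger0_norm].
Qed.

Lemma lty_intRN f : (forall x, 0 <= f x) -> intg vol f ->
  (intRN (fun x => (f x)%:E) < +oo)%E.
Proof. by move=> f0 h; rewrite intRN_rint// ltry. Qed.

Lemma intg_cball r : intg vol (fun x => \1_(cball r) x).
Proof.
have m := @measurable_cball R N r.
apply: intgP; first exact: measurable_indic.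
under eq_integral do rewrite ger0_norm//.
by rewrite integral_indic// setIT vol_cball_lty.
Qed.

Lemma intg_bdd_supp f M r : measurable_fun setT (f : VB -> R) ->
  (forall x, `|f x| <= M) -> (forall x, r < enorm x -> f x = 0) -> intg vol f.
Proof.
move=> mf fM fr; apply: intg_le (intgZ M (intg_cball r)) => // x.
rewrite indicE; case: (boolP (x \in _)) => [_|]; first by rewrite mulr1.
by rewrite notin_setE /cball /= => /negP; rewrite -ltNge mulr0 => /fr ->; rewrite normr0.
Qed.

Lemma cball_compact r : compact [set x : V | enorm x <= r].
Proof.
apply: bounded_closed_compact.
  exists r; split; first exact: num_real.
  move=> M rM x /= xr; rewrite [`|x|]mx_normrE; apply/bigmax_leP; split.
    by apply: ltW; apply: le_lt_trans rM; apply: le_trans xr; exact: enorm_ge0.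
  by move=> [j i] _ /=; rewrite (ord1 j) (le_trans (ler_coord_enorm _ _))// (le_trans xr)// ltW.
apply: (@closed_comp _ _ (@enorm R N) [set t | t <= r]).
  by move=> x _; exact: continuous_enorm.
exact: closed_le.
Qed.

Lemma continuous_supp_bounded f r : continuous f -> (forall x, r < enorm x -> f x = 0) ->
  exists M, forall x, `|f x| <= M.
Proof.
move=> cf fr.
have : compact (f @` [set x : V | enorm x <= r]).
  apply: continuous_compact; last exact: cball_compact.
  exact: continuous_subspaceT.
move=> /compact_bounded[M [_ hM]]; exists (`|M| + 1) => x.
have [xr|xr] := leP (enorm x) r; last by rewrite fr// normr0 addr_ge0.
apply: hM; last by exists x.
by apply: le_lt_trans (ler_norm M) _; rewrite ltrDl.
Qed.

Lemma ipd_pd s i f : ipd s (pd i f) = ipd (rcons s i) f.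
Proof. by rewrite /ipd foldr_rcons. Qed.

Lemma testfn_continuous phi : testfn phi -> continuous phi.
Proof. by move=> [sp _] x; have [] := sp [::] x. Qed.

Lemma testfn_ispd i phi : testfn phi -> ispd i phi (pd i phi).
Proof.
move=> [sp _] x; have [_ /(_ i) h] := sp [::] x.
by rewrite /pd derive1E; apply: DeriveDef.
Qed.

Lemma enorm_upd_near x i r : r < enorm x ->
  \forall t \near x ord0 i, r < enorm (upd x i t).
Proof.
move=> rx.
have c : {for x ord0 i, continuous (fun t => enorm (upd x i t))}.
  apply: (@continuous_comp _ _ _ (fun t => sumsq (upd x i t)) (@Num.sqrt R)); last exact: sqrt_continuous.
  rewrite (_ : (fun t => _) = (fun t => sumsq x - x ord0 i ^+ 2 + t ^+ 2)).
    by apply: cvgD; [exact: cvg_cst|exact: exprn_continuous].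
  by apply/funext => t; rewrite sumsq_upd.
have := cvgr_gt _ c r; rewrite upd_id; exact.
Qed.

Lemma testfn_pd i phi : testfn phi -> testfn (pd i phi).
Proof.
move=> tp; have [sp [r hr]] := tp; split.
  by move=> s x; rewrite ipd_pd; exact: sp.
exists r => x rx; apply: der_near0 (testfn_ispd i tp x) _.
by apply: filterS (enorm_upd_near i rx) => t; exact: hr.
Qed.

Lemma testfn_bounded phi : testfn phi -> exists M, forall x, `|phi x| <= M.
Proof.
move=> tp; have [_ [r hr]] := tp.
exact: continuous_supp_bounded (testfn_continuous tp) hr.
Qed.

Lemma testfn_meas phi : testfn phi -> measurable_fun setT (phi : VB -> R).
Proof. by move=> tp; apply: continuous_measurable; exact: testfn_continuous. Qed.

Lemma intg_testfn phi : testfn phi -> intg vol phi.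
Proof.
move=> tp; have [_ [r hr]] := tp; have [M hM] := testfn_bounded tp.
exact: intg_bdd_supp (testfn_meas tp) hM hr.
Qed.

Lemma intg_locint u phi : locint u -> testfn phi -> intg vol (fun x => u x * phi x).
Proof.
move=> [/measRNP mu hu] tp; have [_ [r hr]] := tp; have [M hM] := testfn_bounded tp.
have ir : intg vol (fun x => `|u x| * \1_(cball r) x).
  apply: intRN_lty (hu r); last by move=> x; rewrite mulr_ge0.
  by apply: measurable_funM; [exact: measurableT_comp|apply: measurable_indic; exact: measurable_cball].
apply: intg_le (intgZ M ir); first by apply: measurable_funM => //; exact: testfn_meas.
move=> x; rewrite normrM indicE; case: (boolP (x \in _)) => [_|].
  by rewrite mulr1 mulrC ler_wpM2r.
by rewrite notin_setE /cball /= => /negP; rewrite -ltNge => /hr ->; rewrite normr0 !mulr0.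
Qed.

Lemma locint_testfn phi : testfn phi -> locint phi.
Proof.
move=> tp; split; first by apply/measRNP; exact: testfn_meas.
move=> r; apply: lty_intRN; first by move=> x; rewrite mulr_ge0.
have m1 : measurable_fun setT (\1_(cball r) : VB -> R).
  by apply: measurable_indic; exact: measurable_cball.
apply: intg_le (intg_norm (intg_testfn tp)).
  by apply: measurable_funM => //; apply: measurableT_comp => //; exact: testfn_meas.
by move=> x; rewrite normrM normr_id ler_piMr// ger0_norm// indicE lern1; case: (_ \in _).
Qed.

Lemma rint_shift i s f : intg vol f -> rint vol (fun x => f (shift i s x)) = rint vol f.
Proof.
move=> hf; rewrite /rint; congr fine; rewrite [LHS]integralE [RHS]integralE.
have mf : measurable_fun setT (fun x : VB => (f x)%:E) by apply/measurable_EFinP; exact: intg_meas hf.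
congr (_ - _)%E.
  rewrite -[RHS](ge0_vol_shift i s)//; last exact: measurable_funepos.
  by apply: eq_integral => x _; rewrite !funeposE.
rewrite -[RHS](ge0_vol_shift i s)//; last exact: measurable_funeneg.
by apply: eq_integral => x _; rewrite !funenegE.
Qed.

Lemma shift_upd i s x : shift i s x = upd x i (x ord0 i + s).
Proof.
apply/rowP => j; rewrite !mxE eqxx /=; have [->|ji] := eqVneq j i; first by rewrite eqxx mulr1.
by rewrite (negPf (_ : val j != val i))// mulr0 addr0.
Qed.

Lemma upd_upd x i t t' : upd (upd x i t) i t' = upd x i t'.
Proof. by apply/rowP => j; rewrite !mxE; case: (val j == i). Qed.

Lemma upd_shift x i t : upd x i t = shift i (t - x ord0 i) x.
Proof. by rewrite shift_upd addrC subrK. Qed.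

Lemma continuous_upd x i : continuous (fun t => upd x i t).
Proof.
move=> t; rewrite (_ : (fun t => _) = (fun t => x + (t - x ord0 i) *: delta_mx ord0 i)); last first.
  by apply/funext => t'; rewrite upd_shift.
apply: cvgD; first exact: cvg_cst.
by apply: cvgZr_tmp; apply: cvgB; [exact: cvg_id|exact: cvg_cst].
Qed.

Lemma ispd_derive_upd i f f' : ispd i f f' -> forall x (t : R),
  is_derive t 1 (fun t => f (upd x i t)) (f' (upd x i t)).
Proof.
move=> tf x t; have := tf (upd x i t); rewrite upd_coord.
by congr is_derive; apply/funext => t'; rewrite upd_upd.
Qed.

Lemma intg_shift i s f : intg vol f -> intg vol (fun x => f (shift i s x)).
Proof.
move=> hf; have mf := intg_meas hf; apply: intgP.
  exact: (measurableT_comp mf (measurable_shift i s)).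
rewrite (ge0_vol_shift i s (f := fun x => `|f x|%:E))//; first exact: intg_lty.
by apply/measurable_EFinP; exact: measurableT_comp.
Qed.

(* Differentiate the translation invariance of the integral. *)
Lemma rint_pd i f f' r : continuous f -> continuous f' -> ispd i f f' ->
  (forall x, r < enorm x -> f x = 0) -> (forall x, r < enorm x -> f' x = 0) ->
  rint vol f' = 0.
Proof.
move=> cf cf' df hr hr'; have [M hM] := continuous_supp_bounded cf' hr'.
have dfu := ispd_derive_upd df.
have mf := continuous_measurable cf; have mf' := continuous_measurable cf'.
have h1 : intg vol f.
  by have [M' hM'] := continuous_supp_bounded cf hr; exact: intg_bdd_supp hM' hr.
pose s n : R := n.+1%:R^-1.
have s0 n : 0 < s n by rewrite invr_gt0.
pose q n x := (s n)^-1 * (f (shift i (s n) x) - f x).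
have msh n : measurable_fun setT (fun x : VB => f (shift i (s n) x)).
  exact: (measurableT_comp mf (measurable_shift i (s n))).
have qE n x : exists t, q n x = f' (upd x i t) /\ x ord0 i <= t <= x ord0 i + s n.
  have lt : x ord0 i < x ord0 i + s n by rewrite ltrDl.
  have [|t ht e] := MVT lt (fun t _ => dfu x t).
    by apply: continuous_subspaceT; exact: is_derive_continuous (dfu x).
  exists t; split.
    rewrite upd_id -shift_upd in e.
    by rewrite /q e addrAC subrr add0r mulrCA mulVf ?mulr1// gt_eqF.
  by move: ht; rewrite in_itv /= => /andP[t1 t2]; rewrite !ltW.
have r0 : 0 <= `|r| by [].
(* Shifts have length at most 1, so a point of norm above [|r| + 1] is not moved into the support.
   The difference quotients thus have a common integrable bound. *)
have qM n x : `|q n x| <= M * \1_(cball (`|r| + 1)) x.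
  have [t [-> /andP[t1 t2]]] := qE n x.
  rewrite indicE; case: (boolP (x \in _)) => [_|]; first by rewrite mulr1; exact: hM.
  rewrite notin_setE /cball /= => /negP; rewrite -ltNge mulr0 => xr.
  have [yr|yr] := ltP r (enorm (upd x i t)); first by rewrite hr' ?normr0.
  have hs : s n <= 1 by rewrite invf_le1 ?ler1n.
  have y1 : enorm (upd x i t) <= `|r| by apply: le_trans yr (ler_norm r).
  have y2 := le_trans (ler_coord_enorm (upd x i t) i) y1.
  rewrite upd_coord ler_norml in y2; have /andP[y3 y4] := y2.
  have := sumsq_upd x i t; rewrite !sumsq_enorm => e.
  have : enorm (upd x i t) ^+ 2 <= `|r| ^+ 2 by rewrite lerXn2r ?nnegrE ?enorm_ge0.
  have : (`|r| + 1) ^+ 2 < enorm x ^+ 2 by rewrite ltrXn2r ?nnegrE ?addr_ge0 ?enorm_ge0.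
  by move=> k1 k2; exfalso; nra.
have iM : intg vol (fun x => M * \1_(cball (`|r| + 1)) x) by apply: intgZ; exact: intg_cball.
have [|||_ c] := dct (mu := vol) (f_ := q) (f := f') _ _ _ iM qM.
- by move=> n; apply: measurable_funM => //; exact: measurable_funB.
- exact: mf'.
- move=> x; apply/cvgrPdist_lt => e e0.
  have cx : {for x ord0 i, continuous (fun t => f' (upd x i t))}.
    by apply: (@continuous_comp _ _ _ (fun t => upd x i t) f'); [exact: continuous_upd|exact: cf'].
  move/cvgrPdist_lt : cx => /(_ e e0); rewrite upd_id => /nbhs_ballP[de /= de0 hde].
  have := near_infty_natSinv_lt (PosNum de0); apply: filterS => n /= sn.
  have [t [-> /andP[t1 t2]]] := qE n x.
  have {}sn : s n < de := sn.
  by apply: hde; rewrite /ball /= ltr_norml; apply/andP; split; move: sn t1 t2; move: (s n) => ?; lra.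
have e n : rint vol (q n) = 0.
  have h2 := intg_shift i (s n) h1.
  by rewrite rintZ ?rintB ?rint_shift ?subrr ?mulr0//; exact: intgB.
rewrite (_ : (fun n => rint vol (q n)) = fun=> 0) in c; last exact/funext.
exact: (cvg_unique (@Rhausdorff R) c (cvg_cst _)).
Qed.

Lemma intg_testfnM f g : testfn f -> testfn g -> intg vol (fun x => f x * g x).
Proof. by move=> /locint_testfn; exact: intg_locint. Qed.

Lemma green i f g : testfn f -> testfn g ->
  rint vol (fun x => f x * pd i g x) = - rint vol (fun x => pd i f x * g x).
Proof.
move=> tf tg; have tf' := testfn_pd i tf; have tg' := testfn_pd i tg.
have [[_ [r hr]] [_ [r' hr']]] := (tf, tf').
apply/eqP; rewrite -addr_eq0 addrC -rintD; [|exact: intg_testfnM..].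
have cM (h k : V -> R) : testfn h -> testfn k -> continuous (fun x => h x * k x).
  by move=> th tk x; exact: (cvgM (@testfn_continuous h th x) (@testfn_continuous k tk x)).
apply/eqP; apply: (@rint_pd i (fun x => f x * g x) _ (Num.max r r')).
- exact: cM.
- by move=> x; apply: (cvgD (cM _ _ tf' tg x) (cM _ _ tf tg' x)).
- by apply: ispdM; exact: testfn_ispd.
- by move=> x; rewrite gt_max => /andP[/hr -> _]; rewrite mul0r.
- by move=> x; rewrite gt_max => /andP[/hr -> /hr' ->]; rewrite !mul0r addr0.
Qed.

Lemma green_lap f g : testfn f -> testfn g ->
  rint vol (fun x => f x * lap g x) = rint vol (fun x => lap f x * g x).
Proof.
move=> tf tg; rewrite /lap /ipd /=.
rewrite (eq_rint vol (g := fun x => \sum_(i < N) f x * pd i (pd i g) x)); last first.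
  by move=> x; rewrite mulr_sumr.
rewrite [RHS](eq_rint vol (g := fun x => \sum_(i < N) pd i (pd i f) x * g x)); last first.
  by move=> x; rewrite mulr_suml.
rewrite !rint_sum; [|by move=> i; apply: intg_testfnM => //; do 2 apply: testfn_pd..].
apply: eq_bigr => i _; rewrite green//; last exact: testfn_pd.
by rewrite green ?opprK//; exact: testfn_pd.
Qed.

Lemma wgrad_testfn f : testfn f -> wgrad f (fun i => pd i f).
Proof.
move=> tf; split; first exact: locint_testfn.
split=> [i|phi tp i]; first by apply: locint_testfn; exact: testfn_pd.
by rewrite !intRN_rint ?green//; apply: intg_testfnM => //; exact: testfn_pd.
Qed.

Lemma wlap_testfn f : testfn f -> testfn (lap f) -> wlap f (lap f).
Proof.
move=> tf tlf; split; first exact: locint_testfn.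
split=> [|phi tp]; first exact: locint_testfn.
have e : intg vol (fun x => f x * lap phi x).
  rewrite (_ : (fun x => _) = fun x => \sum_(i < N) f x * pd i (pd i phi) x); last first.
    by apply/funext => x; rewrite mulr_sumr.
  by apply: intg_sum => i; apply: intg_testfnM => //; do 2 apply: testfn_pd.
by rewrite !intRN_rint ?green_lap//; exact: intg_testfnM.
Qed.

End greenND.

Lemma ae_mp d (T : measurableType d) (R : realType) (mu : {measure set T -> \bar R})
  (P Q : T -> Prop) : {ae mu, forall x, P x} -> (forall x, P x -> Q x) ->
  {ae mu, forall x, Q x}.
Proof. by move=> aP PQ; apply: filterS aP. Qed.

Lemma ae_and d (T : measurableType d) (R : realType) (mu : {measure set T -> \bar R})
  (P Q : T -> Prop) : {ae mu, forall x, P x} -> {ae mu, forall x, Q x} ->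
  {ae mu, forall x, P x /\ Q x}.
Proof. by move=> aP aQ; apply: filterS2 aP aQ. Qed.

(** * The du Bois-Reymond lemma *)

Section pi_system.
Context d (T : measurableType d) (R : realType) (mu : {measure set T -> \bar R}).
Variables (G : set (set T)) (g : (set T)^nat).
Hypotheses (mG : measurable = <<s G >>) (IG : setI_closed G)
  (Gg : forall i, G (g i)) (gT : \bigcup_k g k = setT).

(** The positive and negative parts of [f] are densities of two measures that agree on the
    pi-system, hence on all measurable sets. On the set where one part is positive the other
    vanishes, so both have integral 0. *)
Lemma pi_system_ae0 (f : T -> R) : measurable_fun setT f ->
  (forall A, G A -> intg mu (fun x => f x * \1_A x) /\ rint mu (fun x => f x * \1_A x) = 0) ->
  {ae mu, forall x, f x = 0}.
Proof.
move=> mf H.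
pose fp x := Num.max (f x) 0; pose fn x := Num.max (- f x) 0.
have fp0 x : 0 <= fp x by rewrite le_max lexx orbT.
have fn0 x : 0 <= fn x by rewrite le_max lexx orbT.
have mfp : measurable_fun setT fp by apply: measurable_maxr => //; exact: measurable_cst.
have mfn : measurable_fun setT fn.
  by apply: measurable_maxr; [exact: measurableT_comp|exact: measurable_cst].
have GM A : G A -> measurable A by move=> GA; rewrite mG; exact: sub_sigma_algebra.
have densE (h : T -> R) A : measurable_fun setT h -> G A -> (forall x, 0 <= h x) ->
    (forall x, h x <= `|f x|) -> intg mu (fun x => h x * \1_A x) /\
    (\int[mu]_(x in A) (h x)%:E)%E = (rint mu (fun x => h x * \1_A x))%:E.
  move=> mh GA h0 hf; have mA := GM _ GA.
  have i : intg mu (fun x => h x * \1_A x).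
    apply: intg_le (intg_norm (H A GA).1); first exact/measurable_funM/measurable_indic.
    by move=> x; rewrite !normrM ler_wpM2r// ger0_norm.
  split=> //; rewrite -rintE// integral_mkcond; apply: eq_integral => x _.
  by rewrite patchE indicE; case: (_ \in _); rewrite ?mulr1 ?mulr0.
have fpf x : fp x <= `|f x| by rewrite ge_max ler_norm normr_ge0.
have fnf x : fn x <= `|f x| by rewrite ge_max -normrN ler_norm normr_ge0.
have E A : measurable A -> mdens mu fp0 mfp A = mdens mu fn0 mfn A.
  apply: (measure_unique G g) => //.
  - move=> B GB; change (\int[mu]_(x in B) (fp x)%:E = \int[mu]_(x in B) (fn x)%:E)%E.
    have [ip ->] := densE fp B mfp GB fp0 fpf; have [iN ->] := densE fn B mfn GB fn0 fnf.
    congr EFin; apply/eqP; rewrite -subr_eq0 -rintB//; apply/eqP.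
    rewrite -(H B GB).2; apply: eq_rint => x; rewrite -mulrBl; congr (_ * _).
    rewrite /fp /fn; have [h|h] := leP (f x) 0; have [k|k] := leP (- f x) 0; lra.
  - move=> k; change (\int[mu]_(x in g k) (fp x)%:E < +oo)%E.
    by have [_ ->] := densE fp _ mfp (Gg k) fp0 fpf; rewrite ltry.
have P (h k : T -> R) (mh : measurable_fun setT h) (mk : measurable_fun setT k)
    (h0 : forall x, 0 <= h x) (k0 : forall x, 0 <= k x) :
    (forall x, 0 < h x -> k x = 0) ->
    (forall A, measurable A -> mdens mu h0 mh A = mdens mu k0 mk A) ->
    (\int[mu]_x (h x)%:E = 0)%E.
  move=> hk EA; have mP : measurable [set x | 0 < h x].
    have := mh measurableT `]0, +oo[%classic (measurable_itv _); rewrite setTI.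
    by congr measurable; apply/seteqP; split=> x /=; rewrite in_itv /= andbT.
  have := EA _ mP.
  change (\int[mu]_(x in [set x | (0 < h x)%R]) (h x)%:E =
    \int[mu]_(x in [set x | (0 < h x)%R]) (k x)%:E -> \int[mu]_x (h x)%:E = 0)%E.
  rewrite [X in _ = X -> _]integral0_eq => [<-|x /= /hk -> //].
  rewrite [RHS]integral_mkcond; apply: eq_integral => x _; rewrite patchE.
  case: ifPn => //; rewrite notin_setE /= => /negP; rewrite -leNgt => h1.
  by congr EFin; apply/eqP; rewrite eq_le h1 h0.
have zp : (\int[mu]_x (fp x)%:E = 0)%E.
  apply: (P fp fn mfp mfn fp0 fn0) => // x; rewrite /fp /fn lt_max ltxx orbF => h.
  by apply/max_idPr; rewrite oppr_le0 ltW.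
have zn : (\int[mu]_x (fn x)%:E = 0)%E.
  apply: (P fn fp mfn mfp fn0 fp0) => [x|A mA]; last by rewrite E.
  rewrite /fp /fn lt_max ltxx orbF oppr_gt0 => h; by apply/max_idPr; rewrite ltW.
have : (\int[mu]_x `|(f x)%:E| = 0)%E.
  rewrite -[RHS](adde0 0%E) -{1}zp -zn -ge0_integralD//; last 4 first.
  - by move=> x _; rewrite lee_fin.
  - exact/measurable_EFinP.
  - by move=> x _; rewrite lee_fin.
  - exact/measurable_EFinP.
  apply: eq_integral => x _; rewrite -EFinD; congr EFin.
  rewrite /fp /fn; have [h|h] := leP (f x) 0; have [k|k] := leP (- f x) 0.
  - have -> : f x = 0 by lra.
    by rewrite normr0 addr0.
  - by rewrite ler0_norm// add0r.
  - by rewrite gtr0_norm// addr0.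
  - lra.
have mfE : measurable_fun setT (fun x => (f x)%:E) by exact/measurable_EFinP.
move=> /(ae_eq_integral_abs mu measurableT mfE).
by apply: filterS => x /(_ I) [].
Qed.

End pi_system.

Section bump_interval.
Variable R : realType.

(** The argument of [bump] is positive exactly on []a, b[] and tends to infinity there with [n], so
    these functions tend to the indicator of the interval. *)
Definition ibump (a b : R) (n : nat) (t : R) : R := bump (n%:R * ((t - a) * (b - t))).

Lemma smooth1_ibump a b n : smooth1 (ibump a b n).
Proof.
apply: (smooth1_comp (g := fun t => n%:R * ((t - a) * (b - t)))); first exact: smooth1_bump.
apply: smooth1Z; apply: (smooth1M (f := fun t => t - a)).
  by apply: smooth1B; [exact: smooth1_id|exact: smooth1_cst].
by apply: smooth1B; [exact: smooth1_cst|exact: smooth1_id].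
Qed.

Lemma ibump_out a b n t : a < b -> ~~ (a < t < b) -> ibump a b n t = 0.
Proof.
move=> ab h; apply: bump_le0; rewrite mulr_ge0_le0//.
by move: h; rewrite negb_and -!leNgt => /orP[h|h]; nra.
Qed.

Lemma ibump_ge0 a b n t : 0 <= ibump a b n t. Proof. exact: bump_ge0. Qed.
Lemma ibump_le1 a b n t : ibump a b n t <= 1. Proof. exact: bump_le1. Qed.

Lemma ibump_cvg a b t : a < b ->
  ibump a b n t @[n --> \oo] --> (if (a < t < b)%R then 1 else 0 : R).
Proof.
move=> ab; case: (boolP (a < t < b)) => h; last first.
  by rewrite (_ : (fun n => _) = fun=> 0); [exact: cvg_cst|apply/funext => n; exact: ibump_out].
have c0 : 0 < (t - a) * (b - t) by case/andP: h => h1 h2; rewrite mulr_gt0 ?subr_gt0.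
rewrite -cvg_shiftS /=.
rewrite (_ : (fun n => _) = fun n => expR (- (n.+1%:R^-1 * ((t - a) * (b - t))^-1))); last first.
  by apply/funext => n; rewrite -invfM /ibump bump_gt0E// mulr_gt0.
have L : - (n.+1%:R^-1 * ((t - a) * (b - t))^-1) @[n --> \oo] --> (0 : R).
  rewrite -oppr0 -(mul0r ((t - a) * (b - t))^-1).
  apply: cvgN; apply: cvgM; last exact: cvg_cst.
  exact: cvg_harmonic.
have := cvg_comp _ _ L (@continuous_expR R 0).
by rewrite expR0.
Qed.

End bump_interval.

Section dbr1.
Variable R : realType.
Notation leb := (@lebesgue_measure R).

(** Dominated convergence along [ibump] passes from test functions to indicators of open intervals,
    which form a generating pi-system. *)
Lemma dbr1 (f : R -> R) : measurable_fun setT f ->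
  (forall a b : R, intg leb (fun t => f t * \1_(`]a, b[%classic) t)) ->
  (forall chi, test1 chi -> rint leb (fun t => f t * chi t) = 0) ->
  {ae leb, forall t, f t = 0}.
Proof.
move=> mf loc H.
apply: (@pi_system_ae0 _ (measurableTypeR R) R leb (@RGenOpens.G R)
   (fun k : nat => `](- k%:R), k%:R[%classic)) => //.
- exact: RGenOpens.measurableE.
- move=> _ _ [a [b ->]] [c [e ->]]; exists (Num.max a c), (Num.min b e).
  apply/seteqP; split=> x /=; rewrite !in_itv /= gt_max lt_min.
    by move=> [/andP[-> ->] /andP[-> ->]].
  by move=> /andP[/andP[-> ->] /andP[-> ->]].
- by move=> k; exists (- k%:R), k%:R.
- apply/seteqP; split=> // x _; exists (Num.trunc `|x|).+1 => //=; rewrite in_itv /=.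
  by have := truncnS_gt `|x|; rewrite ltr_norml.
- move=> _ [a [b ->]]; split; first exact: loc.
  have [ab|ba] := ltP a b; last first.
    rewrite (eq_rint leb (g := fun=> 0)); first by rewrite /rint integral0.
    move=> x; rewrite indicE mem_setE in_itv /= (_ : _ && _ = false) ?mulr0//.
    by apply/negP => /andP[h1 h2]; have := lt_trans h1 h2; rewrite ltNge ba.
  have m1 : measurable_fun setT (\1_(`]a, b[%classic) : R -> R) by exact: measurable_indic.
  have mi n : measurable_fun setT (ibump a b n).
    by apply: continuous_measurable_fun; exact/smooth1_continuous/smooth1_ibump.
  have [||||_ c] := dct (mu := leb) (f_ := fun n t => f t * ibump a b n t)
    (f := fun t => f t * \1_(`]a, b[%classic) t) _ _ _ (intg_norm (loc a b)).
  + by move=> n; apply: measurable_funM; [exact: mf|exact: mi].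
  + by apply: measurable_funM; [exact: mf|exact: m1].
  + move=> t; apply: cvgM; first exact: cvg_cst.
    have := @ibump_cvg _ a b t ab; rewrite indicE mem_setE in_itv /=.
    by case: (a < t < b).
  + move=> n t; rewrite !normrM ler_wpM2l// indicE mem_setE in_itv /=.
    case: (boolP (a < t < b)) => h; last by rewrite ibump_out.
    by rewrite normr1 ger0_norm ?ibump_ge0 ?ibump_le1.
  + have z n : rint leb (fun t => f t * ibump a b n t) = 0.
      apply: H; split; first exact: smooth1_ibump.
      exists (Num.max `|a| `|b|) => t ht; apply: ibump_out => //.
      apply/negP => /andP[h1 h2]; move: ht; rewrite gt_max => /andP[ha hb].
      have [t0|t0] := leP 0 t.
        move: hb; rewrite (ger0_norm t0) => hb; have := ler_norm b; lra.
      move: ha; rewrite (ltr0_norm t0) => ha; have := ler_norm (- a); rewrite normrN; lra.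
    rewrite (_ : (fun n => rint _ _) = fun=> 0) in c; last exact/funext.
    exact: (cvg_unique (@Rhausdorff R) c (cvg_cst _)).
Qed.

End dbr1.

Section dbrN.
Variables (R : realType) (N : nat).
Notation V := 'rV[R]_N.
Notation VB := (VB R N).
Notation vol := (@vol R N).

Lemma measurable_box (a b : V) : measurable (box a b : set VB).
Proof.
rewrite (_ : box a b = \bigcap_(i in [set: 'I_N])
   ((fun x : VB => (x : V) ord0 i) @^-1` `]a ord0 i, b ord0 i[)).
  apply: fin_bigcap_measurable; first exact: finite_finset.
  move=> i _; rewrite -[X in measurable X]setTI.
  by apply: measurable_coord => //; exact: measurable_itv.
apply/seteqP; split=> x /= H; first by move=> i _ /=; rewrite in_itv /=; exact: H.
by move=> i; have := H i I; rewrite /= in_itv.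
Qed.

Lemma measurable_boxE : @measurable _ VB = <<s [set A | exists a b : V, A = box a b] >>.
Proof.
apply/seteqP; split.
  apply: smallest_sub; first exact: smallest_sigma_algebra.
  move=> U oU; rewrite (open_box_cover oU) bigcup_mkcond.
  apply: (@countable_bigcupT_measurable _ (g_sigma_algebraType [set A | exists a b : V, A = box a b])) => //.
  move=> q; case: ifP => // _; apply: sub_sigma_algebra => /=.
  by eexists; eexists; reflexivity.
apply: smallest_sub; first exact: sigma_algebra_measurable.
by move=> _ [a [b ->]]; exact: measurable_box.
Qed.

Definition bradius (a b : V) : R := enorm (\row_i (`|a ord0 i| + `|b ord0 i|)).

Lemma box_cball (a b x : V) : box a b x -> enorm x <= bradius a b.
Proof.
move=> h; rewrite -ler_sqr ?nnegrE ?enorm_ge0// !enorm_sqr.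
apply: ler_sum => i _; rewrite mxE -[x ord0 i ^+ 2]real_normK ?num_real//.
rewrite lerXn2r ?nnegrE ?addr_ge0//.
have /andP[h1 h2] := h i; rewrite ler_norml.
have := ler_norm (b ord0 i); have := ler_norm (- a ord0 i); rewrite normrN.
have := normr_ge0 (b ord0 i); have := normr_ge0 (a ord0 i).
by move=> *; apply/andP; split; lra.
Qed.

Definition boxbump (a b : V) n (x : V) : R :=
  \prod_(i < N) ibump (a ord0 i) (b ord0 i) n (x ord0 i).

Lemma boxbump_ge0 a b n x : 0 <= boxbump a b n x.
Proof. by apply: prodr_ge0 => i _; exact: ibump_ge0. Qed.

Lemma boxbump_le1 a b n x : boxbump a b n x <= 1.
Proof. by apply: prodr_ile1 => i _; rewrite ibump_ge0 ibump_le1. Qed.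

Lemma boxbump_out (a b : V) n (x : V) : (forall i, a ord0 i < b ord0 i) -> ~ box a b x ->
  boxbump a b n x = 0.
Proof.
move=> ab nb; have [i hi] : exists i, ~~ (a ord0 i < x ord0 i < b ord0 i).
  by apply: contrapT => h; apply: nb => i; apply: contrapT => /negP hi; apply: h; exists i.
by rewrite /boxbump (bigD1 i)//= ibump_out ?mul0r.
Qed.

Lemma testfn_boxbump (a b : V) n : (forall i, a ord0 i < b ord0 i) -> testfn (boxbump a b n).
Proof.
move=> ab; apply: (@cls_testfn _ _ _ (bradius a b)).
  exact: (cls_prod (index_enum _) (fun i => smooth1_ibump (a ord0 i) (b ord0 i) n)).
move=> x hx; apply: boxbump_out => // /box_cball; by rewrite leNgt hx.
Qed.

Lemma boxbump_cvg (a b x : V) : (forall i, a ord0 i < b ord0 i) ->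
  boxbump a b n x @[n --> \oo] --> (\1_(box a b) x : R).
Proof.
move=> ab; rewrite indicE; case: (boolP (x \in _)); last first.
  rewrite notin_setE => nb.
  by rewrite (_ : (fun n => _) = fun=> 0); [exact: cvg_cst|apply/funext => n; exact: boxbump_out].
rewrite inE => bx; rewrite /boxbump (_ : true%:R = \prod_(i < N) (1 : R)); last by rewrite big1.
elim: (index_enum _) => [|i r ih].
  under eq_fun do rewrite big_nil; rewrite big_nil; exact: cvg_cst.
under eq_fun do rewrite big_cons; rewrite big_cons; apply: cvgM ih.
by have := @ibump_cvg _ _ _ (x ord0 i) (ab i); rewrite (bx i).
Qed.

Lemma dbrN (f : V -> R) : measurable_fun setT (f : VB -> R) ->
  (forall r, intg vol (fun x => f x * \1_(cball r) x)) ->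
  (forall phi, testfn phi -> rint vol (fun x => f x * phi x) = 0) ->
  {ae vol, forall x, f x = 0}.
Proof.
move=> mf loc H.
have loc' a b : intg vol (fun x => f x * \1_(box a b) x).
  apply: intg_le (intg_norm (loc (bradius a b))).
    by apply: measurable_funM => //; apply: measurable_indic; exact: measurable_box.
  move=> x; rewrite !normrM ler_wpM2l// !indicE.
  case: (boolP (x \in box a b)) => [|_]; last by rewrite normr0.
  by rewrite inE => /box_cball h; rewrite (_ : x \in cball _ = true) ?normr1//; apply/mem_set.
apply: (@pi_system_ae0 _ VB R vol [set A | exists a b : V, A = box a b]
   (fun k : nat => box (const_mx (- k%:R)) (const_mx k%:R))) => //.
- exact: measurable_boxE.
- move=> _ _ [a [b ->]] [c [e ->]].
  exists (\row_i Num.max (a ord0 i) (c ord0 i)), (\row_i Num.min (b ord0 i) (e ord0 i)).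
  apply/seteqP; split=> x /=.
    by move=> [h1 h2] i; have := h1 i; have := h2 i; rewrite !mxE gt_max lt_min => /andP[-> ->] /andP[-> ->].
  by move=> h; split=> i; have := h i; rewrite !mxE gt_max lt_min => /andP[/andP[h1 h2] /andP[h3 h4]]; apply/andP.
- by move=> k; eexists; eexists; reflexivity.
- apply/seteqP; split=> // x _; exists (Num.trunc (enorm (x : V))).+1 => // i; rewrite !mxE.
  rewrite -ltr_norml; apply: le_lt_trans (ler_coord_enorm _ _) _; exact: truncnS_gt.
- move=> _ [a [b ->]]; split; first exact: loc'.
  have [ab|/existsNP[i /negP]] := pselect (forall i, a ord0 i < b ord0 i); last first.
    rewrite -leNgt => ba.
    rewrite (eq_rint vol (g := fun=> 0)); first by rewrite /rint integral0.
    move=> x; rewrite indicE (_ : x \in _ = false) ?mulr0//.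
    apply/negP; rewrite inE => /(_ i) /andP[h1 h2]; have := lt_trans h1 h2.
    by rewrite ltNge ba.
  have m1 : measurable_fun setT (\1_(box a b) : VB -> R).
    by apply: measurable_indic; exact: measurable_box.
  have tb n := testfn_boxbump n ab.
  have [||||_ c] := dct (mu := vol) (f_ := fun n x => f x * boxbump a b n x)
    (f := fun x => f x * \1_(box a b) x) _ _ _ (intg_norm (loc' a b)).
  + by move=> n; apply: measurable_funM => //; exact: testfn_meas.
  + exact: measurable_funM.
  + by move=> x; apply: cvgM; [exact: cvg_cst|exact: boxbump_cvg].
  + move=> n x; rewrite !normrM ler_wpM2l// indicE.
    case: (boolP (x \in _)) => h.
      by rewrite normr1 ger0_norm ?boxbump_ge0 ?boxbump_le1.
    by rewrite boxbump_out//; move: h; rewrite notin_setE.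
  + rewrite (_ : (fun n => rint _ _) = fun=> 0) in c; last by apply/funext => n; exact: H.
    exact: (cvg_unique (@Rhausdorff R) c (cvg_cst _)).
Qed.

Lemma locint_cball u r : locint u -> intg vol (fun x => u x * \1_(cball r) x).
Proof.
move=> [/measRNP mu hu].
have m1 : measurable_fun setT (\1_(cball r) : VB -> R).
  by apply: measurable_indic; exact: measurable_cball.
have ir : intg vol (fun x => `|u x| * \1_(cball r) x).
  apply: intRN_lty (hu r); last by move=> x; rewrite mulr_ge0.
  by apply: measurable_funM => //; exact: measurableT_comp.
apply: intg_le ir; first exact: measurable_funM.
by move=> x; rewrite normrM [X in _ * X]ger0_norm.
Qed.

(** It makes weak Laplacians and weak gradients unique almost everywhere, as is needed because
    [weak_sol] quantifies over all of them. *)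
Lemma dbr_eq (f g : V -> R) : locint f -> locint g ->
  (forall phi, testfn phi -> intRN (fun x => (f x * phi x)%:E) = intRN (fun x => (g x * phi x)%:E)) ->
  {ae vol, forall x, f x = g x}.
Proof.
move=> lf lg H; have /measRNP mf := lf.1; have /measRNP mg := lg.1.
have : {ae vol, forall x, f x - g x = 0}.
  apply: dbrN; first exact: measurable_funB.
    move=> r; have := intgB (locint_cball r lf) (locint_cball r lg).
    by congr intg; apply/funext => x; rewrite -mulrBl.
  move=> phi tp.
  rewrite (eq_rint vol (g := fun x => f x * phi x - g x * phi x)); last by move=> x; rewrite mulrBl.
  have [i1 i2] := (intg_locint lf tp, intg_locint lg tp).
  by rewrite rintB//; have := H phi tp; rewrite !intRN_rint// => -[->]; rewrite subrr.
by move=> /ae_mp; apply=> x /eqP; rewrite subr_eq0 => /eqP.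
Qed.

End dbrN.

(** * Real integrals of radial functions *)

Section radial_real.
Variables (R : realType) (N : nat).
Hypothesis N0 : (0 < N)%N.
Notation V := 'rV[R]_N.
Notation VB := (VB R N).
Notation vol := (@vol R N).
Notation leb := (@lebesgue_measure R).
Notation rad := (@rad R N).
Notation cvol := (cvol R N).
Implicit Types G : R -> R.

Lemma measurable_rad G : measurable_fun setT G -> measurable_fun setT (rad G : VB -> R).
Proof.
move=> mG; rewrite (_ : rad G = fun x => \1_(~` [set 0 : VB]) x * G (ln (enorm x))).
  apply: measurable_funM.
    by apply: measurable_indic; apply: measurableC; exact: measurable_set1_0.
  exact: (measurableT_comp mG (@measurable_lnenorm R N)).
apply/funext => x; rewrite /rad indicE; case: eqP => [->|x0].
  by rewrite memNset ?mul0r//= => /(_ erefl).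
by rewrite mem_set ?mul1r.
Qed.

Lemma vol_ae_neq0 : {ae vol, forall x : VB, x != 0 :> V}.
Proof.
exists [set 0 : VB]; split; [exact: measurable_set1_0|exact: vol_set1_0|].
by move=> x /= /negP; rewrite negbK => /eqP.
Qed.

Lemma ae_rad G : {ae vol, forall x, rad G x = G (ln (enorm x))}.
Proof. by apply: ae_mp vol_ae_neq0 _ => x /negPf h; rewrite /rad h. Qed.

Lemma ge0_int_rad G : (forall t, 0 <= G t) -> measurable_fun setT G ->
  (\int[vol]_x (rad G x)%:E = cvol%:E * \int[leb]_t (expR (N%:R * t) * G t)%:E)%E.
Proof.
move=> G0 mG.
have mG' : measurable_fun setT (fun t => (G t)%:E) by exact/measurable_EFinP.
rewrite (@ae_eq_integral _ _ _ vol setT (fun x => (G (ln (enorm x)))%:E))//.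
- rewrite (ge0_radial_integral N0 (G := fun t => (G t)%:E))//.
- by apply/measurable_EFinP; exact: measurable_rad.
- apply/measurable_EFinP; exact: (measurableT_comp mG (@measurable_lnenorm R N)).
- by apply: ae_mp (ae_rad G) _ => x e _; rewrite e.
Qed.

Lemma measurable_expRN (c : R) : measurable_fun setT (fun t : R => expR (c * t)).
Proof. by apply: continuous_measurable_fun; exact: continuous_expR_scale. Qed.

Lemma rad_norm G x : `|rad G x| = rad (fun t => `|G t|) x.
Proof. by rewrite /rad; case: ifP => //; rewrite normr0. Qed.

Lemma int_norm_expR G : (\int[leb]_t (expR (N%:R * t) * `|G t|)%:E =
  \int[leb]_t `|expR (N%:R * t) * G t|%:E)%E.
Proof. by apply: eq_integral => t _; rewrite normrM (ger0_norm (expR_ge0 _)). Qed.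

Lemma intg_rad G : measurable_fun setT G ->
  intg leb (fun t => expR (N%:R * t) * G t) -> intg vol (rad G).
Proof.
move=> mG iG; apply: intgP; first exact: measurable_rad.
under eq_integral do rewrite rad_norm.
rewrite ge0_int_rad//; last exact: measurableT_comp.
apply: lte_mul_pinfty; rewrite ?lee_fin ?cvol_ge0//.
by rewrite int_norm_expR; exact: intg_lty.
Qed.

(** Finiteness of the product in the polar formula passes to its second factor because [cvol] is
    positive. *)
Lemma intg_rad_inv G : 0 < cvol -> measurable_fun setT G -> intg vol (rad G) ->
  intg leb (fun t => expR (N%:R * t) * G t).
Proof.
move=> c0 mG iG; apply: intgP.
  by apply: measurable_funM => //; exact: measurable_expRN.
have := intg_lty iG; under eq_integral do rewrite rad_norm.
rewrite ge0_int_rad//; last exact: measurableT_comp.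
rewrite int_norm_expR; set X := (\int[_]_x _)%E => h.
have : (0 <= X)%E by apply: integral_ge0 => t _; rewrite lee_fin.
by move: h; case: X => [r| |] //=; [rewrite !ltry|rewrite gt0_muley ?lte_fin].
Qed.

Lemma rint_rad_ge0 G : (forall t, 0 <= G t) -> measurable_fun setT G ->
  intg leb (fun t => expR (N%:R * t) * G t) ->
  rint vol (rad G) = cvol * rint leb (fun t => expR (N%:R * t) * G t).
Proof.
move=> G0 mG iG; apply: EFin_inj; rewrite EFinM -!rintE ?ge0_int_rad//.
exact: intg_rad.
Qed.

Lemma rint_rad G : measurable_fun setT G ->
  intg leb (fun t => expR (N%:R * t) * G t) ->
  rint vol (rad G) = cvol * rint leb (fun t => expR (N%:R * t) * G t).
Proof.
move=> mG iG.
pose P t := Num.max (G t) 0; pose M t := Num.max (- G t) 0.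
have P0 t : 0 <= P t by rewrite le_max lexx orbT.
have M0 t : 0 <= M t by rewrite le_max lexx orbT.
have mP : measurable_fun setT P by apply: measurable_maxr => //; exact: measurable_cst.
have mM : measurable_fun setT M.
  by apply: measurable_maxr; [exact: measurableT_comp|exact: measurable_cst].
have GE t : G t = P t - M t.
  rewrite /P /M; have [h|h] := leP (G t) 0; have [k|k] := leP (- G t) 0; lra.
have le t h : 0 <= h <= `|G t| -> `|expR (N%:R * t) * h| <= `|expR (N%:R * t) * G t|.
  by move=> /andP[h0 hG]; rewrite !normrM ler_wpM2l// ger0_norm.
have iP : intg leb (fun t => expR (N%:R * t) * P t).
  apply: intg_le (intg_norm iG); first by apply: measurable_funM => //; exact: measurable_expRN.
  by move=> t; apply: le; rewrite P0 ge_max ler_norm normr_ge0.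
have iM : intg leb (fun t => expR (N%:R * t) * M t).
  apply: intg_le (intg_norm iG); first by apply: measurable_funM => //; exact: measurable_expRN.
  by move=> t; apply: le; rewrite M0 ge_max -normrN ler_norm normr_ge0.
rewrite (eq_rint vol (g := fun x => rad P x - rad M x)); last first.
  by move=> x; rewrite /rad; case: ifP => _; rewrite ?subrr ?GE.
rewrite [in RHS](eq_rint leb (g := fun t => expR (N%:R * t) * P t - expR (N%:R * t) * M t)); last first.
  by move=> t; rewrite -mulrBr -GE.
by rewrite !rintB ?rint_rad_ge0 ?mulrBr//; exact: intg_rad.
Qed.

End radial_real.

(** * Cutoffs in the logarithmic variable *)

Section cutoff.
Variable R : realType.
(** [expR 1] normalises the value at 0 to 1. The function is not constant near 0: what is used of
    [cut n] is that it tends to 1 pointwise, with derivatives tending to 0. *)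
Definition cut0 (t : R) : R := expR 1 * bump (1 - t * t).
Definition cut (n : nat) (t : R) : R := cut0 (n.+1%:R^-1 * t).

Lemma smooth1_cut0 : smooth1 cut0.
Proof.
apply: smooth1Z; apply: (smooth1_comp (g := fun t => 1 - t * t)); first exact: smooth1_bump.
apply: smooth1B; first exact: smooth1_cst.
by apply: smooth1M; exact: smooth1_id.
Qed.

Lemma test1_cut0 : test1 cut0.
Proof.
split; first exact: smooth1_cut0.
exists 1 => t t1; rewrite /cut0 bump_le0 ?mulr0//.
have := normr_ge0 t; rewrite -expr2 -[t ^+ 2]real_normK ?num_real//; nra.
Qed.

Lemma cut00 : cut0 0 = 1.
Proof. by rewrite /cut0 mulr0 subr0 bump_gt0E// invr1 -expRD subrr expR0. Qed.

Lemma test1_bounded (f : R -> R) : test1 f -> exists2 M, 0 <= M & forall t, `|f t| <= M.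
Proof.
move=> [sf [r hr]].
have : compact (f @` `[(- `|r|), `|r|]%classic).
  apply: continuous_compact; last exact: segment_compact.
  by apply: continuous_subspaceT; exact: smooth1_continuous.
move=> /compact_bounded[M [_ hM]]; exists (`|M| + 1); first by rewrite addr_ge0.
move=> t; have [tr|tr] := leP `|t| `|r|; last first.
  by rewrite hr ?normr0 ?addr_ge0//; apply: le_lt_trans tr; exact: ler_norm.
apply: hM; first by apply: le_lt_trans (ler_norm M) _; rewrite ltrDl.
by exists t => //=; rewrite in_itv /= -ler_norml.
Qed.

(* The derivatives of the n-th cutoff are O(1/n). *)
Lemma cutP : exists (c1 c2 : nat -> R -> R) (M : R), [/\ 0 <= M,
  forall n, test1 (cut n),
  forall n (t : R), is_derive t 1 (cut n) (c1 n t),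
  forall n (t : R), is_derive t 1 (c1 n) (c2 n t) &
  [/\ forall n t, `|cut n t| <= M, forall n t, `|c1 n t| <= n.+1%:R^-1 * M,
   forall n t, `|c2 n t| <= n.+1%:R^-1 * M & forall t, cut n t @[n --> \oo] --> (1 : R)]].
Proof.
have [d1 td1 D1] := test1_derive test1_cut0.
have [d2 td2 D2] := test1_derive td1.
have [M0 M00 hM0] := test1_bounded test1_cut0.
have [M1 M10 hM1] := test1_bounded td1.
have [M2 M20 hM2] := test1_bounded td2.
pose e n : R := n.+1%:R^-1.
have e0 n : 0 < e n by rewrite invr_gt0.
have e1 n : e n <= 1 by rewrite invf_le1 ?ler1n.
have De n (t : R) : is_derive t 1 (fun t => e n * t) (e n).
  by apply: der_eq (derZ (e n) (derI t)) _; rewrite mulr1.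
exists (fun n t => e n * d1 (e n * t)), (fun n t => e n * (e n * d2 (e n * t))), (M0 + M1 + M2).
split.
- by rewrite !addr_ge0.
- move=> n; split.
    apply: (smooth1_comp (g := fun t => e n * t)); first exact: smooth1_cut0.
    by apply: smooth1Z; exact: smooth1_id.
  have [_ [r hr]] := test1_cut0; exists ((e n)^-1 * r) => t ht; apply: hr.
  by rewrite normrM (gtr0_norm (e0 n)) mulrC -ltr_pdivrMr// mulrC.
- by move=> n t; rewrite mulrC; exact: der_comp (D1 _) (De n t).
- by move=> n t; apply: derZ; rewrite mulrC; exact: der_comp (D2 _) (De n t).
split.
- by move=> n t; apply: le_trans (hM0 _) _; rewrite -addrA lerDl addr_ge0.
- move=> n t; rewrite normrM (gtr0_norm (e0 n)) ler_pM2l//.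
  by apply: le_trans (hM1 _) _; lra.
- move=> n t; rewrite normrM (gtr0_norm (e0 n)) ler_pM2l// normrM (gtr0_norm (e0 n)).
  apply: (@le_trans _ _ (1 * M2)); last by lra.
  by apply: ler_pM => //; exact: ltW.
- move=> t; rewrite -cut00.
  have L : n.+1%:R^-1 * t @[n --> \oo] --> (0 : R).
    by rewrite -(mul0r t); apply: cvgM; [exact: cvg_harmonic|exact: cvg_cst].
  exact: (cvg_comp _ _ L (@smooth1_continuous _ _ smooth1_cut0 0)).
Qed.

End cutoff.

(** * Logarithmic coordinates *)

Section constants.
Variables (R : realType) (N : nat) (mu : R).
Hypotheses (N5 : (5 <= N)%N) (mu0 : 0 < mu) (muN : mu < N%:R - 4).

(* [aa] and [bb] are the roots of the characteristic polynomial of the equation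
   satisfied by [e^(kap t) u], and [pp] is its exponent. *)
Definition kap : R := (N%:R - 4) / 2.
Definition al : R := 1 - mu / (N%:R - 4).
Definition aa : R := al * kap.
Definition bb : R := al * (kap + 2).
Definition pp : R := crit_exp R N - 1.

Lemma NE : N%:R = 2 * kap + 4. Proof. by rewrite /kap; field. Qed.

Lemma kap_gt0 : 0 < kap. Proof. by rewrite /kap; move: mu0 muN; lra. Qed.

Lemma al_gt0 : 0 < al.
Proof. by rewrite /al subr_gt0 ltr_pdivrMr ?mul1r//; move: mu0 muN; lra. Qed.

Lemma muE : mu = 2 * kap * (1 - al).
Proof.
have := kap_gt0; rewrite /al NE => k0; field.
by apply/eqP; lra.
Qed.

Lemma aa_gt0 : 0 < aa. Proof. by rewrite mulr_gt0 ?al_gt0 ?kap_gt0. Qed.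

Lemma aa_lt_bb : aa < bb.
Proof. by rewrite /aa /bb ltr_pM2l ?al_gt0// ltrDl. Qed.

(** With [u = e^(-kap t) w], the bilaplacian becomes [(D^2 - kap^2) (D^2 - (kap + 2)^2)] and
    [div (grad u / |x|^2)] becomes [D^2 - kap^2], up to a power of [|x|]. Comparing coefficients
    with [(D^2 - aa^2) (D^2 - bb^2)] gives this identity for [D^2] and [Cmu2E] for the constant
    term. *)
Lemma Cmu1E : Cmu1 N mu = kap ^+ 2 + (kap + 2) ^+ 2 - (aa ^+ 2 + bb ^+ 2).
Proof.
have := kap_gt0; rewrite /Cmu1 /aa /bb NE muE => k0; field.
by apply/eqP; lra.
Qed.

Lemma Cmu2E : Cmu2 N mu = aa ^+ 2 * bb ^+ 2 - kap ^+ 2 * (kap + 2) ^+ 2 + Cmu1 N mu * kap ^+ 2.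
Proof.
have := kap_gt0; rewrite /Cmu1 /Cmu2 /aa /bb NE muE => k0; field.
by apply/eqP; lra.
Qed.

Lemma critE : kap * crit_exp R N = N%:R.
Proof. by have := kap_gt0; rewrite /crit_exp NE => k0; field; apply/eqP; lra. Qed.

(** The power [u^pp] carries the same factor [e^(-(kap + 4) t)] as the fourth-order operator, so the
    equation for [w] is autonomous. *)
Lemma ppE : kap * pp = kap + 4.
Proof. by have := kap_gt0; rewrite /pp mulrBr critE NE mulr1; lra. Qed.

Lemma pp_gt1 : 1 < pp.
Proof.
have k0 := kap_gt0; rewrite -(ltr_pM2l k0) ppE mulr1; lra.
Qed.

Lemma der_expM (c : R) (f : R -> R) (a t : R) : is_derive t 1 f a ->
  is_derive t 1 (fun t => expR (c * t) * f t) (expR (c * t) * (a + c * f t)).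
Proof.
move=> df; apply: der_eq (derM (is_derive_expR_scale c t) df) _.
by ring.
Qed.

End constants.

(** * Radial functions dominated by a power of [|x|] times a weight *)

Section domination.
Variables (R : realType) (N : nat).
Hypothesis N0 : (0 < N)%N.
Notation V := 'rV[R]_N.
Notation VB := (VB R N).
Notation vol := (@vol R N).
Notation leb := (@lebesgue_measure R).
Notation rad := (@rad R N).

Lemma le_rad (f g : R -> R) x : (forall t, f t <= g t) -> rad f x <= rad g x.
Proof. by rewrite /rad; case: ifP. Qed.

Lemma rad_ge0 (f : R -> R) x : (forall t, 0 <= f t) -> 0 <= rad f x.
Proof. by rewrite /rad; case: ifP. Qed.

Lemma radM (f g : R -> R) x : rad f x * rad g x = rad (fun t => f t * g t) x.
Proof. by rewrite /rad; case: ifP; rewrite ?mulr0. Qed.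

Lemma radZ c (f : R -> R) x : c * rad f x = rad (fun t => c * f t) x.
Proof. by rewrite /rad; case: ifP; rewrite ?mulr0. Qed.

Lemma rad_div (f : R -> R) k (x : V) :
  rad f x / enorm x ^+ k = rad (fun t => expR (- k%:R * t) * f t) x.
Proof.
rewrite /rad; case: eqP => [_|/eqP x0]; first by rewrite mul0r.
by rewrite mulNr expRN expRM_natl lnK ?posrE ?enorm_gt0// mulrC.
Qed.

Lemma sum_crad (f g : R -> R) (x : V) :
  \sum_(i < N) (x ord0 i * rad f x) * (x ord0 i * rad g x) =
  rad (fun t => expR (2 * t) * (f t * g t)) x.
Proof.
under eq_bigr do rewrite mulrACA -expr2.
rewrite -mulr_suml -enorm_sqr radM /rad; case: eqP => [_|/eqP x0]; first by rewrite mulr0.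
by rewrite expRM_natl lnK ?posrE ?enorm_gt0.
Qed.

Variable y : R -> R.
Hypotheses (y0 : forall t, 0 <= y t) (my : measurable_fun setT y) (iy : intg leb y)
  (iy2 : intg leb (fun t => y t ^+ 2)).

(** In terms of [x] this is [|x|^g y(ln |x|)]: a homogeneity [g] and a fixed integrable and square
    integrable weight [y]. *)
Definition ey (g : R) (t : R) : R := expR (g * t) * y t.

Lemma ey_ge0 g t : 0 <= ey g t. Proof. by rewrite mulr_ge0 ?expR_ge0. Qed.

Lemma measurable_ey g : measurable_fun setT (ey g).
Proof. by apply: measurable_funM => //; exact: measurable_expRN. Qed.

Lemma cutoff_limit (g C : R) (G_ : nat -> R -> R) (G : R -> R) (phi : V -> R) :
  (forall n, measurable_fun setT (G_ n)) -> measurable_fun setT G ->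
  (forall n t, `|G_ n t| <= C * ey g t) -> (forall t, G_ n t @[n --> \oo] --> G t) ->
  measurable_fun setT (phi : VB -> R) ->
  intg vol (fun x => rad (ey g) x * `|phi x|) ->
  intg vol (fun x => rad G x * phi x) /\
  rint vol (fun x => rad (G_ n) x * phi x) @[n --> \oo] --> rint vol (fun x => rad G x * phi x).
Proof.
move=> mG_ mG GC cG mphi iphi; 
apply: (@dct _ VB R vol (fun n x => rad (G_ n) x * phi x) (fun x => rad G x * phi x)
  (fun x => C * (rad (ey g) x * `|phi x|))).
- by move=> n; apply: measurable_funM => //; exact: measurable_rad.
- by apply: measurable_funM => //; exact: measurable_rad.
- move=> x; apply: cvgM; last exact: cvg_cst.
  rewrite /rad; case: ifP => _; [exact: cvg_cst|exact: cG].
- exact: intgZ.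
- move=> n x; rewrite normrM mulrA ler_wpM2r// rad_norm radZ; apply: le_rad => t.
  exact: GC.
Qed.

(** For [t <= T] the factor [e^((N + g) t)] is at most its value at [T], because [N + g >= 0]; the
    integrable [y] remains. *)
Lemma intg_rad_cball g r : 0 <= N%:R + g -> intg vol (fun x => rad (ey g) x * \1_(cball r) x).
Proof.
move=> g0; pose T := ln (Num.max r 1).
have r1 : 0 < Num.max r 1 by rewrite lt_max ltr01 orbT.
pose F t := ey g t * \1_(`]-oo, T]%classic) t.
have mF : measurable_fun setT F.
  by apply: measurable_funM; [exact: measurable_ey|exact: measurable_indic].
have iF : intg vol (rad F).
  apply: intg_rad => //; apply: intg_le (intgZ (expR ((N%:R + g) * T)) iy).
    by apply: measurable_funM => //; exact: measurable_expRN.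
  move=> t; rewrite /F /ey indicE mem_setE in_itv /=; case: (leP t T) => h.
    rewrite mulr1 mulrA -expRD -mulrDl ger0_norm ?mulr_ge0 ?expR_ge0//.
    by rewrite ler_wpM2r// ler_expR ler_wpM2l.
  by rewrite !mulr0 normr0 mulr_ge0 ?expR_ge0.
apply: intg_le iF.
  apply: measurable_funM; first by apply: measurable_rad => //; exact: measurable_ey.
  by apply: measurable_indic; exact: measurable_cball.
move=> x; rewrite indicE; case: (boolP (x \in _)) => [|_]; last first.
  by rewrite mulr0 normr0 rad_ge0// => t; rewrite /F mulr_ge0 ?ey_ge0.
rewrite inE /cball /= mulr1 => xr; rewrite ger0_norm; last by apply: rad_ge0 => t; exact: ey_ge0.
rewrite /rad; case: eqP => // /eqP x0; rewrite /F indicE mem_setE in_itv /=.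
rewrite (_ : _ <= T) ?mulr1// /T ler_ln ?posrE ?enorm_gt0//.
by rewrite le_max xr.
Qed.

Lemma intg_rad_supp g (phi : V -> R) M r : 0 <= N%:R + g ->
  measurable_fun setT (phi : VB -> R) -> (forall x, `|phi x| <= M) ->
  (forall x, r < enorm x -> phi x = 0) -> intg vol (fun x => rad (ey g) x * `|phi x|).
Proof.
move=> g0 mphi hM hr; apply: intg_le (intgZ M (intg_rad_cball r g0)).
  apply: measurable_funM; first by apply: measurable_rad => //; exact: measurable_ey.
  exact: measurableT_comp.
move=> x; have e0 : 0 <= rad (ey g) x by apply: rad_ge0 => t; exact: ey_ge0.
rewrite ger0_norm ?mulr_ge0// indicE; case: (boolP (x \in _)) => [_|].
  by rewrite mulr1 mulrC ler_wpM2r.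
by rewrite notin_setE /cball /= => /negP; rewrite -ltNge => /hr ->; rewrite normr0 !mulr0.
Qed.

Lemma locint_rad g C (G : R -> R) : 0 <= N%:R + g -> measurable_fun setT G ->
  (forall t, `|G t| <= C * ey g t) -> locint (rad G).
Proof.
move=> g0 mG GC; have mr := measurable_rad mG.
split; first exact/measRNP.
move=> r; apply: lty_intRN; first by move=> x; rewrite mulr_ge0.
apply: intg_le (intgZ C (intg_rad_cball r g0)).
  by apply: measurable_funM; [exact: measurableT_comp|apply: measurable_indic; exact: measurable_cball].
move=> x; rewrite normrM normr_id (ger0_norm (_ : 0 <= \1_(cball r) x))// mulrA ler_wpM2r//.
by rewrite rad_norm radZ; apply: le_rad.
Qed.

Lemma locint_crad g C (G : R -> R) i : 0 <= N%:R + (g + 1) -> measurable_fun setT G ->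
  (forall t, `|G t| <= C * ey g t) -> locint (fun x => x ord0 i * rad G x).
Proof.
move=> g0 mG GC; have mr := measurable_rad mG.
have mc : measurable_fun setT (fun x : VB => (x : V) ord0 i * rad G x).
  by apply: measurable_funM => //; exact: measurable_coord.
split; first exact/measRNP.
move=> r; apply: lty_intRN; first by move=> x; rewrite mulr_ge0.
apply: intg_le (intgZ C (intg_rad_cball r g0)).
  by apply: measurable_funM; [exact: measurableT_comp|apply: measurable_indic; exact: measurable_cball].
move=> x; rewrite normrM normr_id (ger0_norm (_ : 0 <= \1_(cball r) x))// mulrA ler_wpM2r//.
rewrite normrM; apply: (@le_trans _ _ (enorm x * `|rad G x|)).
  by rewrite ler_wpM2r// ler_coord_enorm.
rewrite /rad; case: eqP => [_|/eqP x0]; first by rewrite normr0 !mulr0.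
rewrite -{1}[enorm x](@lnK R) ?posrE ?enorm_gt0// /ey mulrDl mul1r addrC expRD -mulrA.
by rewrite mulrCA ler_wpM2l ?expR_ge0.
Qed.

(** At this homogeneity the Jacobian [e^(N t)] cancels the square of [e^(g t)], leaving [y^2]. It is
    attained at [g = -(kap + 2)], the exponent of the Laplacian of [uw]. *)
Lemma intg_rad_sq g C (G : R -> R) : 2 * g + N%:R = 0 -> measurable_fun setT G ->
  (forall t, `|G t| <= C * ey g t) -> intg vol (fun x => rad G x ^+ 2).
Proof.
move=> gN mG GC; rewrite (_ : (fun x => _) = rad (fun t => G t ^+ 2)); last first.
  by apply/funext => x; rewrite expr2 radM.
apply: intg_rad => //; first exact: measurable_funX.
apply: intg_le (intgZ (C ^+ 2) iy2).
  by apply: measurable_funM; [exact: measurable_expRN|exact: measurable_funX].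
move=> t; rewrite ger0_norm; last by apply: mulr_ge0; [exact: expR_ge0|exact: sqr_ge0].
have : `|G t| ^+ 2 <= (C * ey g t) ^+ 2 by rewrite lerXn2r ?nnegrE// (le_trans _ (GC t)).
rewrite real_normK ?num_real// /ey !exprMn -expRM_natl => h.
apply: (@le_trans _ _ (expR (N%:R * t) * (C ^+ 2 * (expR (2 * (g * t)) * y t ^+ 2)))).
  by rewrite ler_wpM2l ?expR_ge0.
have e : expR (N%:R * t) * (expR (2 * (g * t)) * y t ^+ 2) = y t ^+ 2; last by rewrite mulrCA e.
rewrite mulrA -expRD.
have -> : N%:R * t + 2 * (g * t) = (2 * g + N%:R) * t by ring.
by rewrite gN mul0r expR0 mul1r.
Qed.

End domination.

Section cutoff_convergence.
Variables (R : realType) (N : nat).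
Hypothesis N0 : (0 < N)%N.
Notation V := 'rV[R]_N.
Notation VB := (VB R N).
Notation vol := (@vol R N).
Notation leb := (@lebesgue_measure R).
Notation rad := (@rad R N).
Variable y : R -> R.
Hypotheses (y0 : forall t, 0 <= y t) (my : measurable_fun setT y).

Definition domy (f : R -> R) := continuous f /\ exists2 D, 0 <= D & forall t, `|f t| <= D * y t.

Lemma domyD f g : domy f -> domy g -> domy (fun t => f t + g t).
Proof.
move=> [cf [D D0 hD]] [cg [D' D'0 hD']]; split.
  by move=> t; exact: (cvgD (cf t) (cg t)).
exists (D + D'); first exact: addr_ge0.
by move=> t; rewrite mulrDl (le_trans (ler_normD _ _))// lerD.
Qed.

Lemma domyZ c f : domy f -> domy (fun t => c * f t).
Proof.
move=> [cf [D D0 hD]]; split.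
  by move=> t; apply: cvgM; [exact: cvg_cst|exact: cf].
exists (`|c| * D); first exact: mulr_ge0.
by move=> t; rewrite normrM -mulrA ler_wpM2l.
Qed.

Variables (c1 c2 : nat -> R -> R) (M : R).
Hypotheses (M0 : 0 <= M) (tcut : forall n, test1 (@cut R n))
  (dcut : forall n (t : R), is_derive t 1 (cut n) (c1 n t))
  (dc1 : forall n (t : R), is_derive t 1 (c1 n) (c2 n t))
  (bcut : forall n (t : R), `|cut n t| <= M)
  (bc1 : forall n t, `|c1 n t| <= n.+1%:R^-1 * M)
  (bc2 : forall n t, `|c2 n t| <= n.+1%:R^-1 * M)
  (cvgcut : forall t, cut n t @[n --> \oo] --> (1 : R)).

Let tc1 n : test1 (c1 n). Proof. exact: test1_der (tcut n) (dcut n). Qed.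
Let tc2 n : test1 (c2 n). Proof. exact: test1_der (tc1 n) (dc1 n). Qed.
Let bc1' n t : `|c1 n t| <= M.
Proof.
by apply: le_trans (bc1 n t) _; rewrite ler_piMl// invf_le1 ?ler1n.
Qed.
Let bc2' n t : `|c2 n t| <= M.
Proof.
by apply: le_trans (bc2 n t) _; rewrite ler_piMl// invf_le1 ?ler1n.
Qed.
Let harm (c : nat -> R -> R) t : (forall n t, `|c n t| <= n.+1%:R^-1 * M) ->
  c n t @[n --> \oo] --> (0 : R).
Proof.
move=> h; apply/norm_cvg0P.
apply: (@squeeze_cvgr _ _ _ _ (fun=> 0) (fun n => n.+1%:R^-1 * M)).
- by apply: nearW => n; rewrite normr_ge0 h.
- exact: cvg_cst.
- by rewrite -(mul0r M); apply: cvgM; [exact: cvg_harmonic|exact: cvg_cst].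
Qed.

(** What the product rule leaves after at most two derivatives. [f] collects the terms with an
    undifferentiated cutoff and alone survives in the limit; [f1] and [f2] go with its two
    derivatives. *)
Definition cutG (g : R) (f f1 f2 : R -> R) n t : R :=
  expR (g * t) * (f t * cut n t + f1 t * c1 n t + f2 t * c2 n t).

Lemma cut_conv g (f f1 f2 : R -> R) (phi : V -> R) : domy f -> domy f1 -> domy f2 ->
  measurable_fun setT (phi : VB -> R) ->
  intg vol (fun x => rad (ey y g) x * `|phi x|) ->
  intg vol (fun x => rad (fun t => expR (g * t) * f t) x * phi x) /\
  rint vol (fun x => rad (cutG g f f1 f2 n) x * phi x) @[n --> \oo] -->
  rint vol (fun x => rad (fun t => expR (g * t) * f t) x * phi x).
Proof.
move=> [cf [D D0 hD]] [cf1 [D1 D10 hD1]] [cf2 [D2 D20 hD2]] mphi iphi.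
have mc f' : continuous f' -> measurable_fun setT (f' : R -> R) by exact: continuous_measurable_fun.
have mt n c : (forall n, test1 (c n)) -> measurable_fun setT (c n : R -> R).
  by move=> tc; apply: mc; apply: smooth1_continuous; exact: (tc n).1.
apply: (cutoff_limit (y := y) (g := g) (C := (D + D1 + D2) * M)) => //.
- move=> n; apply: measurable_funM; first exact: measurable_expRN.
  apply: measurable_funD; first apply: measurable_funD.
  + by apply: measurable_funM; [exact: mc|exact: mt].
  + by apply: measurable_funM; [exact: mc|exact: mt].
  + by apply: measurable_funM; [exact: mc|exact: mt].
- by apply: measurable_funM; [exact: measurable_expRN|exact: mc].
- move=> n t; rewrite /cutG /ey normrM (ger0_norm (expR_ge0 _)) [leRHS]mulrCA ler_wpM2l ?expR_ge0//.
  have yt := y0 t.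
  have P (h c D' : R) : 0 <= D' -> `|h| <= D' * y t -> `|c| <= M -> `|h * c| <= D' * M * y t.
    move=> D'0 hh hc; rewrite normrM mulrAC; apply: ler_pM => //.
  have e1 := P _ _ _ D0 (hD t) (bcut n t).
  have e2 := P _ _ _ D10 (hD1 t) (bc1' n t).
  have e3 := P _ _ _ D20 (hD2 t) (bc2' n t).
  apply: le_trans (ler_normD _ _) _; apply: le_trans (lerD (ler_normD _ _) (lexx _)) _.
  rewrite !mulrDl; exact: lerD (lerD e1 e2) e3.
- move=> t; rewrite /cutG; apply: cvgM; first exact: cvg_cst.
  have L : f t * cut n t + f1 t * c1 n t + f2 t * c2 n t @[n --> \oo] -->
      f t * 1 + f1 t * 0 + f2 t * 0.
    apply: cvgD; first apply: cvgD.
    + by apply: cvgM; [exact: cvg_cst|exact: cvgcut].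
    + by apply: cvgM; [exact: cvg_cst|exact: harm bc1].
    + by apply: cvgM; [exact: cvg_cst|exact: harm bc2].
  by move: L; rewrite mulr1 !mulr0 !addr0.
Qed.

Lemma test1_cutM g (f : R -> R) n : smooth1 f -> test1 (fun t => expR (g * t) * (f t * cut n t)).
Proof.
move=> sf; have := test1M (tcut n) (smooth1M (smooth1_expR g) sf).
by congr test1; apply/funext => t; ring.
Qed.

Lemma der_cut g (f f' : R -> R) n (t : R) : (forall t : R, is_derive t 1 f (f' t)) ->
  is_derive t 1 (fun t => expR (g * t) * (f t * cut n t))
   (expR (g * t) * ((f' t + g * f t) * cut n t + f t * c1 n t)).
Proof.
move=> df; apply: der_eq (der_expM g (derM (df t) (dcut n t))) _.
by ring.
Qed.

Lemma der_cut2 g (f f' f'' : R -> R) n (t : R) : (forall t : R, is_derive t 1 f (f' t)) ->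
  (forall t : R, is_derive t 1 f' (f'' t)) ->
  is_derive t 1 (fun t => expR (g * t) * ((f' t + g * f t) * cut n t + f t * c1 n t))
   (expR (g * t) * ((f'' t + 2 * g * f' t + g ^+ 2 * f t) * cut n t
     + (2 * f' t + 2 * g * f t) * c1 n t + f t * c2 n t)).
Proof.
move=> df df'.
apply: der_eq (der_expM g (derD (derM (derD (df' t) (derZ g (df t))) (dcut n t))
  (derM (df t) (dc1 n t)))) _.
by ring.
Qed.

Lemma lap_cut g (f f' f'' : R -> R) n : smooth1 f ->
  (forall t : R, is_derive t 1 f (f' t)) -> (forall t : R, is_derive t 1 f' (f'' t)) ->
  lap (rad (fun t => expR (g * t) * (f t * cut n t))) =
  rad (cutG (g - 2) (fun t => f'' t + (2 * g + N%:R - 2) * f' t + g * (g + N%:R - 2) * f t)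
    (fun t => 2 * f' t + (2 * g + N%:R - 2) * f t) f n).
Proof.
move=> sf df df'; apply/funext => x.
rewrite (lap_rad x (test1_cutM g n sf) (fun t => der_cut g n t df) (fun t => der_cut2 g n t df df')).
congr rad; apply/funext => t; rewrite /cutG (_ : expR ((g - 2) * t) = expR (-2 * t) * expR (g * t));
  last (by rewrite -expRD; congr expR; ring); ring.
Qed.

Lemma div_cut g (f f' : R -> R) n x : smooth1 f ->
  (forall t : R, is_derive t 1 f (f' t)) ->
  \sum_(i < N) pd i (fun z : V => z ord0 i * rad (fun t => expR (g * t) * (f t * cut n t)) z) x =
  rad (cutG g (fun t => f' t + (g + N%:R) * f t) f (fun=> 0) n) x.
Proof.
move=> sf df.
rewrite (div_crad x (test1_cutM g n sf) (fun t => der_cut g n t df)).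
congr rad; apply/funext => t; rewrite /cutG; ring.
Qed.

Lemma pd_cut g (f f' : R -> R) n i : smooth1 f ->
  (forall t : R, is_derive t 1 f (f' t)) ->
  pd i (rad (fun t => expR (g * t) * (f t * cut n t))) =
  (fun x => rad (cutG (g - 2) (fun t => f' t + g * f t) f (fun=> 0) n) x * x ord0 i).
Proof.
move=> sf df; rewrite (pd_rad i (test1_cutM g n sf) (fun t => der_cut g n t df)).
apply/funext => x; rewrite mulrC; congr (rad _ x * _); apply/funext => t.
rewrite /cutG (_ : expR ((g - 2) * t) = expR (-2 * t) * expR (g * t));
  last (by rewrite -expRD; congr expR; ring); ring.
Qed.

Lemma cutG0 g f n : (fun t => expR (g * t) * (f t * cut n t)) = cutG g f (fun=> 0) (fun=> 0) n.
Proof. by apply/funext => t; rewrite /cutG !mul0r !addr0. Qed.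

Lemma domy0 : domy (fun=> 0).
Proof.
split; first exact: cst_continuous.
by exists 0 => // t; rewrite normr0 mul0r.
Qed.

End cutoff_convergence.

(** * From the ODE to weak solutions *)

Section weak_solution.
Variables (R : realType) (N : nat) (mu : R).
Hypotheses (N5 : (5 <= N)%N) (mu0 : 0 < mu) (muN : mu < N%:R - 4).
Notation V := 'rV[R]_N.
Notation VB := (VB R N).
Notation vol := (@vol R N).
Notation leb := (@lebesgue_measure R).
Notation rad := (@rad R N).
Notation kap := (kap R N).
Notation aa := (aa N mu).
Notation bb := (bb N mu).
Notation pp := (pp R N).
Variables (y w w1 w2 w3 w4 : R -> R).
Hypotheses (y0 : forall t, 0 <= y t) (my : measurable_fun setT y)
  (iy : intg leb y) (iy2 : intg leb (fun t => y t ^+ 2)).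
Hypotheses (sw : smooth1 w)
  (d0 : forall t : R, is_derive t 1 w (w1 t)) (d1 : forall t : R, is_derive t 1 w1 (w2 t))
  (d2 : forall t : R, is_derive t 1 w2 (w3 t)) (d3 : forall t : R, is_derive t 1 w3 (w4 t)).
Hypotheses (b0 : domy y w) (b1 : domy y w1) (b2 : domy y w2) (b3 : domy y w3) (b4 : domy y w4).
Hypotheses (w_gt0 : forall t, 0 < w t)
  (ode : forall t, w4 t - (aa ^+ 2 + bb ^+ 2) * w2 t + aa ^+ 2 * bb ^+ 2 * w t = w t `^ pp).

Let N0 : (0 < N)%N. Proof. exact: leq_trans N5. Qed.
Let kp : 0 < kap := kap_gt0 mu0 muN.
Let NK : N%:R = 2 * kap + 4 := NE R N.

(** [gw = (D - kap) w] and [hw = (D - kap) (D + kap + 2) w] are the gradient and the Laplacian of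
    [uw], up to the powers of [|x|] written in [gW] and [hW]. *)
Let gw t := w1 t - kap * w t.
Let hw t := w2 t + 2 * w1 t - kap * (kap + 2) * w t.
Let gw' t := w2 t - kap * w1 t.
Let hw' t := w3 t + 2 * w2 t - kap * (kap + 2) * w1 t.
Let hw'' t := w4 t + 2 * w3 t - kap * (kap + 2) * w2 t.

Let sw1 : smooth1 w1. Proof. exact: smooth1_der sw d0. Qed.
Let sw2 : smooth1 w2. Proof. exact: smooth1_der sw1 d1. Qed.
Let sgw : smooth1 gw. Proof. by apply: smooth1B => //; exact: smooth1Z. Qed.
Let shw : smooth1 hw.
Proof. by apply: smooth1B; [apply: smooth1D => //; exact: smooth1Z|exact: smooth1Z]. Qed.
Let dgw (t : R) : is_derive t 1 gw (gw' t).
Proof. by apply: derB => //; exact: derZ. Qed.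
Let dhw (t : R) : is_derive t 1 hw (hw' t).
Proof. exact: (derB (derD (d2 t) (derZ 2 (d1 t))) (derZ (kap * (kap + 2)) (d0 t))). Qed.
Let dhw' (t : R) : is_derive t 1 hw' (hw'' t).
Proof. exact: (derB (derD (d3 t) (derZ 2 (d2 t))) (derZ (kap * (kap + 2)) (d1 t))). Qed.

Let domyB f g : domy y f -> domy y g -> domy y (fun t => f t - g t).
Proof.
move=> hf hg; have := domyD hf (domyZ (-1) hg).
by congr domy; apply/funext => t; rewrite mulN1r.
Qed.
Let bgw : domy y gw. Proof. by apply: domyB => //; exact: domyZ. Qed.
Let bhw : domy y hw.
Proof. by apply: domyB; [apply: domyD => //; exact: domyZ|exact: domyZ]. Qed.
Let bhw' : domy y hw'.
Proof. by apply: domyB; [apply: domyD => //; exact: domyZ|exact: domyZ]. Qed.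
Let wp t := w t `^ pp.
(** The ODE expresses [w^pp] through derivatives that are already dominated. *)
Let bwp : domy y wp.
Proof.
have -> : wp = fun t => w4 t - (aa ^+ 2 + bb ^+ 2) * w2 t + aa ^+ 2 * bb ^+ 2 * w t.
  by apply/funext => t; rewrite ode.
by apply: domyD; [apply: domyB => //; exact: domyZ|exact: domyZ].
Qed.

Definition expw (g : R) (f : R -> R) (t : R) : R := expR (g * t) * f t.
Definition uw : V -> R := rad (expw (- kap) w).
Definition hW : V -> R := rad (expw (- (kap + 2)) hw).
Definition gW (i : 'I_N) (x : V) : R := rad (expw (- (kap + 2)) gw) x * x ord0 i.

Let mexpw g f : domy y f -> measurable_fun setT (expw g f).
Proof.
move=> [cf _]; apply: measurable_funM; first exact: measurable_expRN.
exact: continuous_measurable_fun.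
Qed.

Let expw_ey g f : domy y f -> exists C, forall t, `|expw g f t| <= C * ey y g t.
Proof.
move=> [_ [D D0 hD]]; exists D => t; rewrite /expw /ey normrM (ger0_norm (expR_ge0 _)).
by rewrite mulrCA ler_wpM2l ?expR_ge0.
Qed.

Let locint_expw g f : 0 <= N%:R + g -> domy y f -> locint (rad (expw g f)).
Proof.
move=> g0 df; have [C hC] := expw_ey g df.
exact: (locint_rad N0 y0 my iy g0 (mexpw g df) hC).
Qed.

Let intg_test g (phi : V -> R) : 0 <= N%:R + g -> testfn phi ->
  intg vol (fun x => rad (ey y g) x * `|phi x|).
Proof.
move=> g0 tp; have [M hM] := testfn_bounded tp; have [_ [r hr]] := tp.
exact: (intg_rad_supp N0 y0 my iy g0 (testfn_meas tp) hM hr).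
Qed.

Let intg_lap g (phi : V -> R) : 0 <= N%:R + g -> testfn phi ->
  measurable_fun setT (lap phi : VB -> R) /\
  intg vol (fun x => rad (ey y g) x * `|lap phi x|).
Proof.
move=> g0 tp.
have tpp i : testfn (pd i (pd i phi)) by do 2 apply: testfn_pd.
have ml : measurable_fun setT (lap phi : VB -> R).
  apply: continuous_measurable; apply: continuous_big_sum => i.
  exact: (testfn_continuous (tpp i)).
split=> //.
apply: (@intg_le _ VB R vol _ (fun x => \sum_(i < N) rad (ey y g) x * `|pd i (pd i phi) x|)).
- apply: measurable_funM; last exact: measurableT_comp.
  by apply: measurable_rad; exact: measurable_ey.
- move=> x; have e0 : 0 <= rad (ey y g) x by apply: rad_ge0 => t; exact: ey_ge0.
  rewrite ger0_norm ?mulr_ge0// -mulr_sumr ler_wpM2l//; exact: ler_norm_sum.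
- by apply: intg_sum => i; exact: intg_test.
Qed.

Let intRN_eq_lim (f1 f2 : V -> R) (F1 F2 : nat -> V -> R) (s : R) :
  intg vol f1 -> intg vol f2 ->
  rint vol (F1 n) @[n --> \oo] --> rint vol f1 ->
  rint vol (F2 n) @[n --> \oo] --> rint vol f2 ->
  (forall n, rint vol (F1 n) = s * rint vol (F2 n)) -> rint vol f1 = s * rint vol f2.
Proof.
move=> _ _ c1 c2 e.
have c3 : s * rint vol (F2 n) @[n --> \oo] --> s * rint vol f2.
  by apply: cvgM; [exact: cvg_cst|exact: c2].
rewrite (_ : (fun n => rint vol (F1 n)) = fun n => s * rint vol (F2 n)) in c1; last exact/funext.
exact: (cvg_unique (@Rhausdorff R) c1 c3).
Qed.

(** A cutoff in [t] removes the origin as well as infinity, so that the truncated function is a test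
    function and Green's formula applies to it. The exponents [-kap] and [-(kap + 2)] keep both
    limits integrable near the origin. *)
Lemma wlap_uw : wlap uw hW.
Proof.
have g1 : 0 <= N%:R + - kap by have := kp; rewrite NK; lra.
have g2 : 0 <= N%:R + - (kap + 2) by have := kp; rewrite NK; lra.
have [c1 [c2 [M [M0 tc dc dc1 [bc bc1 bc2 cc]]]]] := cutP R.
split; first exact: locint_expw.
split=> [|phi tp]; first exact: locint_expw.
have [ml il] := intg_lap g1 tp.
have [i1 L1] := cut_conv y0 M0 tc dc dc1 bc bc1 bc2 cc b0 (domy0 y) (domy0 y) ml il.
have B1 : domy y (fun t => 2 * w1 t + (2 * - kap + N%:R - 2) * w t) by apply: domyD; exact: domyZ.
have E : hw = fun t => w2 t + (2 * - kap + N%:R - 2) * w1 t + - kap * (- kap + N%:R - 2) * w t.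
  by apply/funext => t; rewrite /hw NK; ring.
have [i2 L2] := cut_conv y0 M0 tc dc dc1 bc bc1 bc2 cc bhw B1 b0 (testfn_meas tp) (intg_test g2 tp).
rewrite !intRN_rint//; congr EFin; rewrite -[RHS]mul1r.
apply: (intRN_eq_lim i1 i2 L1 L2) => n; rewrite mul1r -cutG0 green_lap//; last first.
  by apply: testfn_rad; exact: test1_cutM.
by rewrite (lap_cut N tc dc dc1 (- kap) n sw d0 d1) E (_ : - (kap + 2) = - kap - 2)//; ring.
Qed.

Lemma wgrad_uw : wgrad uw gW.
Proof.
have g1 : 0 <= N%:R + - kap by have := kp; rewrite NK; lra.
have g2 : 0 <= N%:R + - (kap + 2) by have := kp; rewrite NK; lra.
have g3 : 0 <= N%:R + (- (kap + 2) + 1) by have := kp; rewrite NK; lra.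
have [c1 [c2 [M [M0 tc dc dc1 [bc bc1 bc2 cc]]]]] := cutP R.
split; first exact: locint_expw.
split=> [i|phi tp i].
  have [C hC] := expw_ey (- (kap + 2)) bgw.
  have := locint_crad N0 y0 my iy i g3 (mexpw _ bgw) hC.
  by congr locint; apply/funext => x; rewrite /gW mulrC.
have tp' := testfn_pd i tp.
have [i1 L1] := cut_conv y0 M0 tc dc dc1 bc bc1 bc2 cc b0 (domy0 y) (domy0 y)
  (testfn_meas tp') (intg_test g1 tp').
have mx : measurable_fun setT (fun x : VB => (x : V) ord0 i * phi x).
  by apply: measurable_funM; [exact: measurable_coord|exact: testfn_meas].
have ix : intg vol (fun x => rad (ey y (- (kap + 2))) x * `|x ord0 i * phi x|).
  have [M' hM'] := testfn_bounded tp; have [_ [r hr]] := tp.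
  apply: (intg_rad_supp N0 y0 my iy g2 mx (M := `|r| * M') (r := `|r|)) => x.
    have [xr|xr] := leP (enorm x) `|r|.
      by rewrite normrM ler_pM// (le_trans (ler_coord_enorm _ _)).
    rewrite hr ?mulr0 ?normr0; last by apply: le_lt_trans xr; exact: ler_norm.
    by rewrite mulr_ge0// (le_trans _ (hM' 0)).
  by move=> xr; rewrite hr ?mulr0//; apply: le_lt_trans xr; exact: ler_norm.
have [i2 L2] := cut_conv y0 M0 tc dc dc1 bc bc1 bc2 cc bgw b0 (domy0 y) mx ix.
have E : (fun x => gW i x * phi x) =
    (fun x => rad (fun t => expR (- (kap + 2) * t) * gw t) x * (x ord0 i * phi x)).
  by apply/funext => x; rewrite /gW mulrA.
have i2' : intg vol (fun x => gW i x * phi x) by rewrite E.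
rewrite !intRN_rint// -EFinN; congr EFin; rewrite E -mulN1r.
apply: (intRN_eq_lim i1 i2 L1 L2) => n; rewrite -cutG0 green//; last first.
  by apply: testfn_rad; exact: test1_cutM.
rewrite mulN1r; congr (- _).
have Eg : gw = fun t => w1 t + - kap * w t by apply/funext => t; rewrite /gw mulNr.
rewrite (pd_cut c2 tc dc (- kap) n i sw d0) Eg (_ : - (kap + 2) = - kap - 2); last by ring.
by apply: eq_rint => x; rewrite mulrA.
Qed.

Lemma uw_gt0 : positive uw.
Proof. by move=> x x0; rewrite /uw /rad (negPf x0) mulr_gt0 ?expR_gt0. Qed.

Lemma uw_ge0 x : 0 <= uw x.
Proof. by apply: rad_ge0 => t; rewrite mulr_ge0 ?expR_ge0 ?ltW. Qed.

Lemma expw_powR t r : expw (- kap) w t `^ r = expw (- (kap * r)) (fun t => w t `^ r) t.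
Proof.
rewrite /expw powRM ?expR_ge0 ?ltW//; congr (_ * _).
by rewrite -expRM; congr expR; ring.
Qed.

Lemma uw_powR : (fun x => uw x `^ pp) = rad (expw (- (kap + 4)) wp).
Proof.
apply/funext => x; rewrite /uw /rad; case: ifP => _.
  by rewrite powR0// gt_eqF// (lt_trans ltr01)// (pp_gt1 mu0 muN).
by rewrite expw_powR (ppE mu0 muN).
Qed.

(** By [critE] the Jacobian cancels the power of [|x|]; what remains is [w^pp w], at most a multiple
    of [y^2]. *)
Lemma inLp_uw : inLp (crit_exp R N) uw.
Proof.
have mu' : measurable_fun setT (uw : VB -> R) by apply: measurable_rad; exact: mexpw.
split; first exact/measRNP.
apply: lty_intRN; first by move=> x; exact: powR_ge0.
have E : (fun x => `|uw x| `^ crit_exp R N) = rad (expw (- N%:R) (fun t => wp t * w t)).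
  apply/funext => x; rewrite (ger0_norm (uw_ge0 x)) /uw /rad; case: ifP => _.
    rewrite powR0//; apply/eqP => h; have := critE mu0 muN; rewrite h mulr0 => h'.
    by move/eqP : h'; rewrite eq_sym pnatr_eq0 => /eqP h'; move: (N0); rewrite h'.
  rewrite expw_powR (critE mu0 muN); congr (_ * _).
  rewrite (_ : crit_exp R N = pp + 1); last by rewrite /pp subrK.
  by rewrite powRD ?powRr1 ?ltW// (gt_eqF (w_gt0 _)) implybT.
rewrite E.
have mm : measurable_fun setT (fun t => wp t * w t).
  by apply: measurable_funM; apply: continuous_measurable_fun; [exact: bwp.1|exact: b0.1].
apply: intg_rad => //; first by apply: measurable_funM => //; exact: measurable_expRN.
have [_ [D D0 hD]] := bwp; have [_ [D' D'0 hD']] := b0.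
apply: intg_le (intgZ (D * D') iy2).
  by apply: measurable_funM; [exact: measurable_expRN|apply: measurable_funM => //; exact: measurable_expRN].
move=> t; rewrite /expw mulrA -expRD mulNr subrr expR0 mul1r normrM expr2 mulrACA.
exact: ler_pM.
Qed.

Let gN : 2 * - (kap + 2) + N%:R = 0. Proof. by rewrite NK; ring. Qed.

Let intg_sq_expw f : domy y f -> intg vol (fun x => rad (expw (- (kap + 2)) f) x ^+ 2).
Proof.
move=> df; have [C hC] := expw_ey (- (kap + 2)) df.
exact: (intg_rad_sq N0 iy2 gN (mexpw _ df) hC).
Qed.

Let intg_sq_ey : intg vol (fun x => rad (ey y (- (kap + 2))) x ^+ 2).
Proof.
apply: (intg_rad_sq N0 iy2 (C := 1) gN (measurable_ey my _)).
by move=> t; rewrite mul1r ger0_norm// ey_ge0.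
Qed.

Lemma inLp2P (h : V -> R) : inLp 2 h -> intg vol (fun x => h x ^+ 2).
Proof.
move=> [/measRNP mh hh].
have E : (fun x => (`|h x| `^ 2)%:E) = (fun x => (h x ^+ 2)%:E).
  by apply/funext => x; rewrite powR_mulrn// real_normK ?num_real.
apply: intRN_lty; [exact: measurable_funX|by move=> x; exact: sqr_ge0|].
by move: hh; rewrite E.
Qed.

Lemma P2inLp (h : V -> R) : measurable_fun setT (h : VB -> R) ->
  intg vol (fun x => h x ^+ 2) -> inLp 2 h.
Proof.
move=> mh ih; split; first exact/measRNP.
have -> : (fun x => (`|h x| `^ 2)%:E) = (fun x => (h x ^+ 2)%:E).
  by apply/funext => x; rewrite powR_mulrn// real_normK ?num_real.
by apply: lty_intRN => // x; exact: sqr_ge0.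
Qed.

Lemma Emu_uw : Emu uw.
Proof.
split.
  split; first exact: inLp_uw.
  exists hW; split; first exact: wlap_uw.
  by apply: P2inLp; [apply: measurable_rad; exact: mexpw|exact: intg_sq_expw].
exists gW; split; first exact: wgrad_uw; split.
  have -> : (fun x => (gradsq gW x / enorm x ^+ 2)%:E) =
      (fun x => (rad (expw (- (kap + 2)) gw) x ^+ 2)%:E).
    apply/funext => x; congr EFin; rewrite /gradsq /gW.
    under eq_bigr do rewrite exprMn.
    rewrite -mulr_sumr -enorm_sqr; have [->|x0] := eqVneq x 0.
      by rewrite /rad eqxx expr0n /= !mul0r.
    by rewrite mulfK// expf_neq0// enorm_eq0.
  by apply: lty_intRN; [move=> x; exact: sqr_ge0|exact: intg_sq_expw].
have -> : (fun x => (uw x ^+ 2 / enorm x ^+ 4)%:E) =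
    (fun x => (rad (expw (- (kap + 2)) w) x ^+ 2)%:E).
  apply/funext => x; congr EFin; rewrite /uw !expr2 !radM rad_div; congr rad.
  apply/funext => t; rewrite /expw.
  have -> : expR (- (kap + 2) * t) = expR (-2 * t) * expR (- kap * t).
    by rewrite -expRD; congr expR; ring.
  have -> : expR (- 4%:R * t) = expR (-2 * t) * expR (-2 * t).
    by rewrite -expRD; congr expR; ring.
  ring.
by apply: lty_intRN; [move=> x; exact: sqr_ge0|exact: intg_sq_expw].
Qed.

Lemma intRN_ae (f f0 : V -> R) : measurable_fun setT (f : VB -> R) -> intg vol f0 ->
  {ae vol, forall x, f x = f0 x} -> intRN (fun x => (f x)%:E) = (rint vol f0)%:E.
Proof.
move=> mf if0 e.
have e' : {ae vol, forall x, f0 x = f x} by apply: ae_mp e _ => x ->.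
by rewrite intRN_rint ?(ae_rint (intg_meas if0) mf e')//; exact: ae_intg e'.
Qed.

Lemma wlap_unique (u h h' : V -> R) : wlap u h -> wlap u h' -> {ae vol, forall x, h x = h' x}.
Proof.
move=> [_ [lh H]] [_ [lh' H']]; apply: dbr_eq => // phi tp.
by rewrite -H// H'.
Qed.

Lemma wgrad_unique (u : V -> R) g g' i : wgrad u g -> wgrad u g' ->
  {ae vol, forall x, g i x = g' i x}.
Proof.
move=> [_ [lg H]] [_ [lg' H']]; apply: dbr_eq => // phi tp.
by apply: oppe_inj; rewrite -H// H'.
Qed.

Lemma ae_all (P : 'I_N -> V -> Prop) : (forall i, {ae vol, forall x, P i x}) ->
  {ae vol, forall x, forall i, P i x}.
Proof.
move=> H.
suff : {ae vol, forall x, forall i, i \in enum 'I_N -> P i x}.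
  by move=> h; apply: ae_mp h _ => x h i; apply: h; rewrite mem_enum.
elim: (enum 'I_N) => [|j r ih].
  by apply: ae_mp (vol_ae_neq0 R N0) _ => x _ i.
by apply: ae_mp (ae_and (H j) ih) _ => x [hj hr] i; rewrite in_cons => /orP[/eqP ->|/hr].
Qed.

Lemma enorm2_rad_ey (x : V) :
  rad (ey y (- (kap + 4))) x * enorm x ^+ 2 = rad (ey y (- (kap + 2))) x.
Proof.
rewrite /rad; case: eqP => [|/eqP x0]; first by rewrite mul0r.
rewrite -{2}[enorm x](@lnK R) ?posrE ?enorm_gt0// /ey mulrAC -expRM_natl -expRD.
by congr (expR _ * _); ring.
Qed.

Lemma testfn_lap_rad psi : test1 psi -> testfn (lap (rad psi)).
Proof.
move=> tp; have [p1 tp1 dp] := test1_derive tp; have [p2 tp2 dp1] := test1_derive tp1.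
have -> : lap (rad psi) = rad (fun t => expR (-2 * t) * (p2 t + (N%:R - 2) * p1 t)).
  by apply/funext => x; rewrite (lap_rad x tp dp dp1).
apply: testfn_rad.
have := test1M (test1D tp2 (test1Z (N%:R - 2) tp1)) (smooth1_expR (-2)).
by congr test1; apply/funext => t; rewrite mulrC.
Qed.

Lemma cvg_big_sum (I : Type) (r : seq I) (F : I -> nat -> R) (l : I -> R) :
  (forall i, F i n @[n --> \oo] --> l i) ->
  \sum_(i <- r) F i n @[n --> \oo] --> \sum_(i <- r) l i.
Proof.
move=> H; elim: r => [|i r ih].
  by rewrite big_nil; under eq_fun do rewrite big_nil; exact: cvg_cst.
by rewrite big_cons; under eq_fun do rewrite big_cons; exact: cvgD.
Qed.

Lemma cvg_lin3 (u v z : nat -> R) (a b c C1 C2 : R) :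
  u n @[n --> \oo] --> a -> v n @[n --> \oo] --> b -> z n @[n --> \oo] --> c ->
  u n - C1 * v n + C2 * z n @[n --> \oo] --> a - C1 * b + C2 * c.
Proof.
move=> cu cv cz; apply: cvgD; first apply: cvgB => //.
  by apply: cvgM => //; exact: cvg_cst.
by apply: cvgM => //; exact: cvg_cst.
Qed.

Lemma lim_eq (u v : nat -> R) (a b : R) : (forall n, u n = v n) ->
  u n @[n --> \oo] --> a -> v n @[n --> \oo] --> b -> a = b.
Proof.
by move=> /funext -> ca cb; exact: (cvg_unique (@Rhausdorff R) ca cb).
Qed.

(** The function [phi] has only weak derivatives, so the cutoff is put on the explicit factors [hw],
    [gw] and [w]. These become test functions, onto which the definitions of the weak Laplacian and
    gradient of [phi] move the derivatives; the ODE then holds pointwise under the integral. *)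
Theorem weak_sol_uw : weak_sol N mu uw.
Proof.
split; first exact: Emu_uw.
move=> phi h g h' g' [[[/measRNP mphi _] [h0 [wh0 L2h0]]] [g0 [wg0 [Lg0 Lphi]]]] wh wg wh' wg'.
have ae1 := wlap_unique wh wlap_uw.
have ae2 := ae_all (fun i => wgrad_unique i wg wgrad_uw).
have ae3 := wlap_unique wh' wh0.
have ae4 := ae_all (fun i => wgrad_unique i wg' wg0).
have [c1 [c2 [M [M0 tc dc dc1 [bc bc1 bc2 cc]]]]] := cutP R.
have /measRNP mh := wh.2.1.1; have /measRNP mh' := wh'.2.1.1; have /measRNP mh0 := wh0.2.1.1.
have mg i : measurable_fun setT (g i : VB -> R) by apply/measRNP; exact: (wg.2.1 i).1.
have mg' i : measurable_fun setT (g' i : VB -> R) by apply/measRNP; exact: (wg'.2.1 i).1.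
have mg0 i : measurable_fun setT (g0 i : VB -> R) by apply/measRNP; exact: (wg0.2.1 i).1.
have mc i := @measurable_coord R N i.
have mV k : measurable_fun setT (fun x : VB => (enorm (x : V) ^+ k.+1)^-1).
  rewrite (_ : (fun x => _) = rad (fun t => expR (- k.+1%:R * t))).
    by apply: measurable_rad; exact: measurable_expRN.
  apply/funext => x; rewrite /rad; case: eqP => [->|/eqP x0].
    by rewrite (_ : enorm 0 = 0) ?expr0n ?invr0//; apply/eqP; rewrite enorm_eq0.
  by rewrite mulNr expRN expRM_natl lnK// posrE enorm_gt0.
have mey c := measurable_ey my c.
have mre c : measurable_fun setT (rad (ey y c) : VB -> R) by exact: measurable_rad.
have e0 c (x : V) : 0 <= rad (ey y c) x by apply: rad_ge0 => t; exact: ey_ge0.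
(* [Emu] puts [h0], [g0 / |x|] and [phi / |x|^2] in L^2. Paired with [ey] at the exponent
   [-(kap + 2)], also in L^2, they give the integrable majorants of the three terms. *)
have ih0 := inLp2P L2h0.
have iphi2 : intg vol (fun x => (phi x / enorm x ^+ 2) ^+ 2).
  apply: intRN_lty.
  - by apply: measurable_funX; exact: measurable_funM.
  - by move=> x; exact: sqr_ge0.
  move: Lphi; congr (intRN _ < _)%E; apply/funext => x.
  by rewrite expr_div_n -exprM.
have ig0 i : intg vol (fun x => (g0 i x / enorm x) ^+ 2).
  have mge : measurable_fun setT (fun x : VB => (g0 i x / enorm (x : V)) ^+ 2).
    by apply: measurable_funX; apply: measurable_funM => //; have := mV 0%N.
  have iG : intg vol (fun x => gradsq g0 x / enorm x ^+ 2).
    apply: intRN_lty Lg0 => //.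
      apply: measurable_funM => //; rewrite /gradsq; apply: measurable_sum => j.
      exact: measurable_funX.
    by move=> x; rewrite divr_ge0 ?sqr_ge0// sumr_ge0// => j _; exact: sqr_ge0.
  apply: intg_le iG => // x; rewrite ger0_norm ?sqr_ge0// expr_div_n ler_wpM2r ?invr_ge0 ?sqr_ge0//.
  by rewrite /gradsq (bigD1 i)//= lerDl sumr_ge0// => j _; exact: sqr_ge0.
have i1 : intg vol (fun x => rad (ey y (- (kap + 2))) x * `|h0 x|).
  apply: intg_sq => //; first exact: measurableT_comp.
  by move: ih0; congr intg; apply/funext => x; rewrite real_normK ?num_real.
have i2 i : intg vol (fun x => rad (ey y (- (kap + 4))) x * `|x ord0 i * g0 i x|).
  have mgn : measurable_fun setT (fun x : VB => `|g0 i x / enorm (x : V)|).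
    by apply: measurableT_comp => //; apply: measurable_funM => //; have := mV 0%N.
  have I : intg vol (fun x => rad (ey y (- (kap + 2))) x * `|g0 i x / enorm x|).
    apply: intg_sq => //.
    by move: (ig0 i); congr intg; apply/funext => x; rewrite real_normK ?num_real.
  apply: intg_le I.
    by apply: measurable_funM => //; apply: measurableT_comp => //; exact: measurable_funM.
  move=> x; rewrite ger0_norm ?mulr_ge0//; have [->|x0] := eqVneq x 0.
    by rewrite /rad eqxx !mul0r.
  rewrite -enorm2_rad_ey -mulrA ler_wpM2l// !normrM normfV (ger0_norm (enorm_ge0 x)).
  have xn : enorm x != 0 by rewrite enorm_eq0.
  have -> : enorm x ^+ 2 * (`|g0 i x| / enorm x) = enorm x * `|g0 i x| by field.
  by rewrite ler_wpM2r// ler_coord_enorm.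
have i3 : intg vol (fun x => rad (ey y (- (kap + 4))) x * `|phi x|).
  have I : intg vol (fun x => rad (ey y (- (kap + 2))) x * `|phi x / enorm x ^+ 2|).
    apply: intg_sq => //.
      by apply: measurableT_comp => //; exact: measurable_funM.
    by move: iphi2; congr intg; apply/funext => x; rewrite real_normK ?num_real.
  move: I; congr intg; apply/funext => x; have [->|x0] := eqVneq x 0.
    by rewrite /rad eqxx !mul0r.
  rewrite -enorm2_rad_ey -mulrA normrM (ger0_norm (_ : 0 <= (enorm x ^+ 2)^-1)) ?invr_ge0 ?sqr_ge0//.
  have xn : enorm x != 0 by rewrite enorm_eq0.
  by congr (_ * _); field.
have [iA LA] := cut_conv y0 M0 tc dc dc1 bc bc1 bc2 cc bhw (domy0 y) (domy0 y) mh0 i1.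
have mx i : measurable_fun setT (fun x : VB => (x : V) ord0 i * g0 i x) by exact: measurable_funM.
have B i := cut_conv y0 M0 tc dc dc1 bc bc1 bc2 cc bgw (domy0 y) (domy0 y) (mx i) (i2 i).
have [iC LC] := cut_conv y0 M0 tc dc dc1 bc bc1 bc2 cc b0 (domy0 y) (domy0 y) mphi i3.
(* The coefficient of the first derivative of the cutoff that the Laplacian and the divergence
   produce together. With it the two sides are equal for each [n], before the limit. *)
have B1 : domy y (fun t => 2 * hw' t - 2 * hw t + Cmu1 N mu * gw t).
  by apply: domyD; [apply: domyB; exact: domyZ|exact: domyZ].
have [iD LD] := cut_conv y0 M0 tc dc dc1 bc bc1 bc2 cc bwp B1 bhw mphi i3.
pose G4 := fun t => expR (- (kap + 4) * t) * gw t.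
have EA : intRN (fun x => (h x * h' x)%:E) =
    (rint vol (fun x => rad (fun t => expR (- (kap + 2) * t) * hw t) x * h0 x))%:E.
  apply: intRN_ae => //; first exact: measurable_funM.
  by apply: ae_mp (ae_and ae1 ae3) _ => x [-> ->].
have iB : intg vol (fun x => \sum_(i < N) rad G4 x * (x ord0 i * g0 i x)).
  by apply: intg_sum => i; exact: (B i).1.
have EB : intRN (fun x => (gradprod g g' x / enorm x ^+ 2)%:E) =
    (rint vol (fun x => \sum_(i < N) rad G4 x * (x ord0 i * g0 i x)))%:E.
  apply: intRN_ae => //.
    by apply: measurable_funM => //; apply: measurable_sum => i; exact: measurable_funM.
  apply: ae_mp (ae_and ae2 ae4) _ => x [e2 e4].
  rewrite /gradprod mulr_suml; apply: eq_bigr => i _; rewrite e2 e4 /gW.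
  have -> : rad G4 x = rad (expw (- (kap + 2)) gw) x / enorm x ^+ 2.
    rewrite rad_div; congr rad; apply/funext => t; rewrite /G4 /expw mulrA -expRD.
    by congr (expR _ * _); ring.
  by ring.
have EC : intRN (fun x => (uw x * phi x / enorm x ^+ 4)%:E) =
    (rint vol (fun x => rad (fun t => expR (- (kap + 4) * t) * w t) x * phi x))%:E.
  rewrite -intRN_rint//; congr intRN; apply/funext => x; congr EFin.
  have -> : rad (fun t => expR (- (kap + 4) * t) * w t) x = uw x / enorm x ^+ 4.
    rewrite /uw rad_div; congr rad; apply/funext => t; rewrite /expw mulrA -expRD.
    by congr (expR _ * _); ring.
  by ring.
have ED : intRN (fun x => (uw x `^ (crit_exp R N - 1) * phi x)%:E) =
    (rint vol (fun x => rad (fun t => expR (- (kap + 4) * t) * wp t) x * phi x))%:E.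
  have E := uw_powR; rewrite -intRN_rint//; congr intRN; apply/funext => x.
  by rewrite -[in RHS](congr1 (fun f => f x) E).
rewrite EA EB EC ED -!EFinM -EFinB -EFinD; congr EFin.
rewrite rint_sum; last by move=> i; exact: (B i).1.
have LB := @cvg_big_sum _ (index_enum 'I_N) _ _ (fun i => (B i).2).
have L := @cvg_lin3 _ _ _ _ _ _ (Cmu1 N mu) (Cmu2 N mu) LA LB LC.
apply: (@lim_eq _ _ _ _ _ L LD) => n.
have tA := test1_cutM tc (- (kap + 2)) n shw.
have tB := test1_cutM tc (- (kap + 4)) n sgw.
have lphi : locint phi := wh0.1.
have tlA : testfn (lap (rad (fun t => expR (- (kap + 2) * t) * (hw t * cut n t)))).
  exact: testfn_lap_rad.
have trA := testfn_rad N tA.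
have e1 : rint vol (fun x => rad (cutG c1 c2 (- (kap + 2)) hw (fun=> 0) (fun=> 0) n) x * h0 x) =
    rint vol (fun x => phi x * lap (rad (fun t => expR (- (kap + 2) * t) * (hw t * cut n t))) x).
  have := wh0.2.2 _ trA; rewrite !intRN_rint; [|exact: intg_locint wh0.2.1 trA|exact: intg_locint lphi tlA].
  by case=> ->; apply: eq_rint => x; rewrite -cutG0 mulrC.
have tcB (i : 'I_N) : testfn (fun x : V => x ord0 i *
    rad (fun t => expR (- (kap + 4) * t) * (gw t * cut n t)) x) by exact: testfn_crad.
have e2 : \sum_(i < N) rint vol (fun x => rad (cutG c1 c2 (- (kap + 4)) gw (fun=> 0) (fun=> 0) n) x
      * (x ord0 i * g0 i x)) =
    - rint vol (fun x => phi x * rad (cutG c1 c2 (- (kap + 4))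
       (fun t => gw' t + (- (kap + 4) + N%:R) * gw t) gw (fun=> 0) n) x).
  rewrite [in RHS](eq_rint vol (g := fun x => \sum_(i < N) phi x * pd i (fun z : V =>
      z ord0 i * rad (fun t => expR (- (kap + 4) * t) * (gw t * cut n t)) z) x)); last first.
    by move=> x; rewrite -mulr_sumr (div_cut c2 tc dc (- (kap + 4)) n x sgw dgw).
  rewrite rint_sum -?sumrN; last by move=> i; apply: intg_locint => //; exact: testfn_pd.
  apply: eq_bigr => i _; have := wg0.2.2 _ (tcB i) i.
  rewrite !intRN_rint; [|exact: intg_locint (wg0.2.1 i) (tcB i)|].
    by case=> ->; rewrite opprK; apply: eq_rint => x; rewrite -cutG0; ring.
  by apply: intg_locint => //; exact: testfn_pd.
rewrite e1 e2 (lap_cut N tc dc dc1 (- (kap + 2)) n shw dhw dhw') -!cutG0.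
have tC := testfn_rad N (test1_cutM tc (- (kap + 4)) n sw).
have j1 : intg vol (fun x => phi x * rad (cutG c1 c2 (- (kap + 2) - 2)
    (fun t => hw'' t + (2 * - (kap + 2) + N%:R - 2) * hw' t + - (kap + 2) * (- (kap + 2) + N%:R - 2) * hw t)
    (fun t => 2 * hw' t + (2 * - (kap + 2) + N%:R - 2) * hw t) hw n) x).
  by rewrite -(lap_cut N tc dc dc1 (- (kap + 2)) n shw dhw dhw'); exact: intg_locint.
have j2 : intg vol (fun x => phi x * rad (cutG c1 c2 (- (kap + 4))
       (fun t => gw' t + (- (kap + 4) + N%:R) * gw t) gw (fun=> 0) n) x).
  have : intg vol (fun x => \sum_(i < N) phi x * pd i (fun z : V =>
      z ord0 i * rad (fun t => expR (- (kap + 4) * t) * (gw t * cut n t)) z) x).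
    by apply: intg_sum => i; apply: intg_locint => //; exact: testfn_pd.
  congr intg; apply/funext => x.
  by rewrite -mulr_sumr (div_cut c2 tc dc (- (kap + 4)) n x sgw dgw).
have j3 := intg_locint lphi tC.
rewrite [Cmu1 N mu * - _]mulrN opprK (eq_rint vol (f := fun x => rad _ x * phi x)
  (g := fun x => phi x * rad (fun t => expR (- (kap + 4) * t) * (w t * cut n t)) x)); last first.
  by move=> x; rewrite mulrC.
rewrite -!rintZ// -rintD//; last exact: intgZ.
rewrite -rintD//; [|by apply: intgD => //; exact: intgZ|exact: intgZ].
apply: eq_rint => x; rewrite /rad; case: ifP => _; first by rewrite !mulr0 !addr0 mul0r.
set t := ln _; rewrite /cutG.
have -> : expR ((- (kap + 2) - 2) * t) = expR (- (kap + 4) * t) by congr expR; ring.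
rewrite /wp -ode NK (Cmu2E mu0 muN) /hw'' /hw' /hw /gw' /gw (Cmu1E mu0 muN).
by ring.
Qed.

End weak_solution.

(** * The explicit profile *)

Section exp_abs.
Variable R : realType.
Notation leb := (@lebesgue_measure R).

Lemma intg_exp_abs (c : R) : 0 < c -> intg leb (fun t => expR (- (c * `|t|))).
Proof.
move=> c0.
have cn : continuous (fun t : R => - (c * `|t|)).
  by move=> t; apply: cvgN; apply: cvgM; [exact: cvg_cst|exact: norm_continuous].
have ce : continuous (fun t : R => expR (- (c * `|t|))).
  by move=> t; apply: (@continuous_comp _ _ _ (fun t : R => - (c * `|t|)) expR); [exact: cn|exact: continuous_expR].
apply: intgP; first exact: continuous_measurable_fun.
under eq_integral do rewrite (ger0_norm (expR_ge0 _)).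
rewrite ge0_symfun_integralT//; last by move=> t /=; rewrite normrN.
rewrite -set_itvcy.
have -> : (\int[leb]_(x in `[0%R, +oo[) (expR (- (c * `|x|)))%:E = \int[leb]_(x in `[0%R, +oo[) (expR (- c * x))%:E)%E.
  apply: eq_integral => t; rewrite inE /= in_itv /= andbT => t0.
  by rewrite ger0_norm// mulNr.
have dF (x : R) : is_derive x 1 (fun t => - c^-1 * expR (- c * t)) (expR (- c * x)).
  apply: der_eq (derZ (- c^-1) (is_derive_expR_scale (- c) x)) _.
  by field; rewrite gt_eqF.
rewrite (@ge0_continuous_FTC2y _ _ (fun t => - c^-1 * expR (- c * t)) 0 0).
- by rewrite -EFinB -EFinM ltry.
- by move=> x _; exact: expR_ge0.
- by apply: continuous_subspaceT; exact: continuous_expR_scale.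
- rewrite -(mulr0 (- c^-1)); apply: cvgM; first exact: cvg_cst.
  under eq_fun do rewrite mulNr.
  apply: (@cvg_comp _ _ _ (fun x => c * x) (fun x => expR (- x)) _ (pinfty_nbhs R)); last exact: cvgr_expR.
  under eq_fun do rewrite mulrC.
  exact: (gt0_cvgMly (f := fun x : R => x) c0 cvg_id).
- by move=> x _; have [] := dF x.
- by apply: cvg_at_right_filter; exact: (is_derive_continuous dF).
- by move=> x _; rewrite derive1E; have [_ ->] := dF x.
Qed.

End exp_abs.

Section sech_profile.
Variables (R : realType) (a : R).
Hypothesis a0 : 0 < a.
Notation leb := (@lebesgue_measure R).

(** [ch] and [sh] are [2 cosh (a t)] and [2 sinh (a t)], so [Y q] is [(2 cosh (a t))^(-q)]; the form
    through [expR] and [ln] makes exponents add. *)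
Definition ch t : R := expR (a * t) + expR (- a * t).
Definition sh t : R := expR (a * t) - expR (- a * t).
Definition Y q t : R := expR (- q * ln (ch t)).
Definition D1 q t : R := - q * a * sh t * Y (q + 1) t.
(** Only [Y q] and [Y (q + 2)] occur, because [sh^2 = ch^2 - 4]. Hence [D^2 - (a q)^2] sends [Y q]
    to a multiple of [Y (q + 2)]. *)
Definition D2 q t : R := a ^+ 2 * q ^+ 2 * Y q t - 4 * q * (q + 1) * a ^+ 2 * Y (q + 2) t.

Lemma ch_gt0 t : 0 < ch t. Proof. by rewrite addr_gt0 ?expR_gt0. Qed.

Lemma ch_sh t : sh t ^+ 2 = ch t ^+ 2 - 4.
Proof.
have e : expR (a * t) * expR (- a * t) = 1 by rewrite -expRD mulNr subrr expR0.
transitivity (ch t ^+ 2 - 4 * (expR (a * t) * expR (- a * t))); last by rewrite e mulr1.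
rewrite /ch /sh; ring.
Qed.

Lemma ch_ge1 t : 1 <= ch t.
Proof.
have [h|h] := leP 0 t.
  apply: (@le_trans _ _ (expR (a * t))); last by rewrite lerDl expR_ge0.
  by rewrite -expR0 ler_expR; apply: mulr_ge0 => //; exact: ltW.
apply: (@le_trans _ _ (expR (- a * t))); last by rewrite lerDr expR_ge0.
rewrite -expR0 ler_expR mulNr -mulrN; apply: mulr_ge0; first exact: ltW.
by rewrite oppr_ge0 ltW.
Qed.

Lemma sh_le_ch t : `|sh t| <= ch t.
Proof.
rewrite /sh /ch (le_trans (ler_normB _ _))// !ger0_norm ?expR_ge0//.
Qed.

Lemma YS q t : Y q t = ch t * Y (q + 1) t.
Proof.
have chE : ch t = expR (ln (ch t)) by rewrite lnK// posrE ch_gt0.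
rewrite {1}/Y [X in _ = X * _]chE -expRD; congr expR; ring.
Qed.

Lemma Y_gt0 q t : 0 < Y q t. Proof. exact: expR_gt0. Qed.

Lemma is_derive_ch (t : R) : is_derive t 1 ch (a * sh t).
Proof.
apply: der_eq (derD (is_derive_expR_scale a t) (is_derive_expR_scale (- a) t)) _.
by rewrite /sh; ring.
Qed.

Lemma is_derive_sh (t : R) : is_derive t 1 sh (a * ch t).
Proof.
apply: der_eq (derB (is_derive_expR_scale a t) (is_derive_expR_scale (- a) t)) _.
by rewrite /ch; ring.
Qed.

Lemma is_derive_Y q (t : R) : is_derive t 1 (Y q) (D1 q t).
Proof.
have h := der_exp (derZ (- q) (der_comp (is_derive1_ln (ch_gt0 t)) (is_derive_ch t))).
apply: der_eq h _; rewrite -/(Y q t) YS /D1; field.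
by rewrite gt_eqF// ch_gt0.
Qed.

Lemma is_derive_D1 q (t : R) : is_derive t 1 (D1 q) (D2 q t).
Proof.
have h := derZ (- q * a) (derM (is_derive_sh t) (is_derive_Y (q + 1) t)).
have -> : D1 q = fun t => - q * a * (sh t * Y (q + 1) t) by apply/funext => s; rewrite /D1 mulrA.
apply: der_eq h _; rewrite /D1 /D2.
have e1 : Y q t = ch t ^+ 2 * Y (q + 2) t.
  by rewrite YS YS mulrA -expr2 -addrA.
have e2 : Y (q + 1) t = ch t * Y (q + 2) t by rewrite YS -addrA.
rewrite -addrA (_ : 1 + 1 = 2) // e1 e2.
have e3 := ch_sh t.
have -> : ch t ^+ 2 = sh t ^+ 2 + 4 by rewrite e3; ring.
have e4 : ch t * (ch t * Y (q + 2) t) = (sh t ^+ 2 + 4) * Y (q + 2) t by rewrite mulrA -expr2 e3; ring.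
transitivity (- q * a * (a * (ch t * (ch t * Y (q + 2) t)) +
  sh t * (- (q + 1) * a * sh t * Y (q + 2) t))); first by ring.
by rewrite e4; ring.
Qed.

Lemma smooth1_Y q : smooth1 (Y q).
Proof.
pose S := [set f : R -> R | exists r : seq (R * R * R),
   f = fun t => \sum_(z <- r) z.1.1 * (Y z.1.2 t * expR (z.2 * t))].
exists S; split.
  by exists [:: (1, q, 0)]; apply/funext => t; rewrite big_seq1 mul1r mul0r expR0 mulr1.
move=> _ [r ->].
(* The three summands of the derivative of [c * Y q * e^(m t)]: one from the exponential, and two
   from [Y q], whose factor [sh] is a difference of exponentials. *)
pose T (z : R * R * R) : seq (R * R * R) := [:: (z.1.1 * z.2, z.1.2, z.2);
   (- (z.1.1 * z.1.2 * a), z.1.2 + 1, z.2 + a); (z.1.1 * z.1.2 * a, z.1.2 + 1, z.2 - a)].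
exists (fun t => \sum_(z <- flatten [seq T z | z <- r]) z.1.1 * (Y z.1.2 t * expR (z.2 * t))).
  by eexists.
move=> x; elim: r => [|[[c k] m] r ih].
  by under eq_fun do rewrite big_nil; rewrite /= big_nil; exact: derC.
under eq_fun do rewrite big_cons.
rewrite /= !big_cons !addrA; apply: derD ih.
apply: der_eq (derZ _ (derM (is_derive_Y k x) (is_derive_expR_scale m x))) _.
rewrite /= !mulrDl !expRD /D1 /sh; ring.
Qed.

Lemma Y_le q q' t : q <= q' -> Y q' t <= Y q t.
Proof.
move=> qq; rewrite ler_expR !mulNr lerN2 ler_wpM2r//.
by apply: ln_ge0; exact: ch_ge1.
Qed.

Lemma D1_le q t : 0 <= q -> `|D1 q t| <= q * a * Y q t.
Proof.
move=> q0; rewrite /D1 !normrM normrN (ger0_norm q0) (gtr0_norm a0) (gtr0_norm (Y_gt0 _ _)).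
rewrite [leRHS](_ : _ = q * a * ch t * Y (q + 1) t); last by rewrite (YS q) mulrA.
apply: ler_wpM2r; first exact: expR_ge0.
by apply: ler_wpM2l; [apply: mulr_ge0 => //; exact: ltW|exact: sh_le_ch].
Qed.

Lemma Y_le1 q t : 0 <= q -> Y q t <= 1.
Proof.
move=> q0; rewrite -expR0 ler_expR mulNr oppr_le0 mulr_ge0// ln_ge0//; exact: ch_ge1.
Qed.

Lemma Y_le_exp q t : 0 <= q -> Y q t <= expR (- (q * a * `|t|)).
Proof.
move=> q0; rewrite ler_expR mulNr lerN2 -mulrA ler_wpM2l//.
rewrite -ler_expR lnK ?posrE ?ch_gt0//; have [h|h] := leP 0 t.
  by rewrite (ger0_norm h) /ch lerDl expR_ge0.
by rewrite (ltr0_norm h) mulrN -mulNr /ch lerDr expR_ge0.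
Qed.

Lemma intg_Y q tau : 0 < q -> intg leb (fun t => Y q (t + tau)).
Proof.
move=> q0; have c0 : 0 < q * a by rewrite mulr_gt0.
apply: intg_le (intgZ (expR (q * a * `|tau|)) (intg_exp_abs c0)).
  apply: continuous_measurable_fun; apply: smooth1_continuous.
  apply: (smooth1_comp (g := fun t => t + tau)); first exact: smooth1_Y.
  by apply: smooth1D; [exact: smooth1_id|exact: smooth1_cst].
move=> t; rewrite (gtr0_norm (Y_gt0 _ _)); apply: le_trans (Y_le_exp _ (ltW q0)) _.
rewrite -expRD ler_expR; have := ler_normB (t + tau) tau; rewrite addrK; nra.
Qed.

End sech_profile.

Section profile.
Variables (R : realType) (N : nat) (mu : R).
Hypotheses (N5 : (5 <= N)%N) (mu0 : 0 < mu) (muN : mu < N%:R - 4).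
Notation V := 'rV[R]_N.
Notation leb := (@lebesgue_measure R).
Notation rad := (@rad R N).
Notation kap := (kap R N).
Notation al := (al N mu).
Notation aa := (aa N mu).
Notation bb := (bb N mu).
Notation pp := (pp R N).
Notation K := (KNmu N mu).

Let kp : 0 < kap := kap_gt0 mu0 muN.
Let NK : N%:R = 2 * kap + 4 := NE R N.
Let al0 : 0 < al := al_gt0 mu0 muN.

(** The factor that arises when [(D^2 - aa^2) (D^2 - bb^2)] sends [Y al kap] to a multiple of
    [Y al (kap + 4)]. It is also the base of the power [KNmu], since [N - 4 = 2 kap] turns
    [(N - 4) (N - 2) N (N + 2)] into [16 kap (kap + 1) (kap + 2) (kap + 3)]. *)
Definition Kbase : R := al ^+ 4 * (16 * (kap * (kap + 1) * (kap + 2) * (kap + 3))).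

Lemma Kbase_gt0 : 0 < Kbase.
Proof.
have k0 := kp; apply: mulr_gt0; first exact: exprn_gt0.
by apply: mulr_gt0 => //; do !(apply: mulr_gt0 => //; try lra).
Qed.

Lemma KE : K = Kbase `^ (kap / 4).
Proof.
rewrite /KNmu -/al NK; congr (_ `^ _); last by field.
by rewrite /Kbase; ring.
Qed.

Lemma K_gt0 : 0 < K. Proof. by rewrite KE powR_gt0// Kbase_gt0. Qed.

(** The exponent of [KNmu] is chosen for this: [kap / 4 * (pp - 1) = 1], so [K^(pp - 1)] is the
    factor [Kbase] of the operator. *)
Lemma K_pp : K `^ pp = K * Kbase.
Proof.
have k0 := kp; rewrite KE -powRrM.
have -> : kap / 4 * pp = kap / 4 + 1 by have := ppE mu0 muN; lra.
by rewrite powRD ?powRr1 ?(gt_eqF Kbase_gt0) ?implybT// ltW// Kbase_gt0.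
Qed.

Section translated.
Variable tau : R.

Definition W t : R := K * Y al kap (t + tau).
Definition W1 t : R := K * D1 al kap (t + tau).
Definition W2 t : R := K * D2 al kap (t + tau).
Definition W3 t : R := K * (al ^+ 2 * kap ^+ 2 * D1 al kap (t + tau)
  - 4 * kap * (kap + 1) * al ^+ 2 * D1 al (kap + 2) (t + tau)).
Definition W4 t : R := K * (al ^+ 2 * kap ^+ 2 * D2 al kap (t + tau)
  - 4 * kap * (kap + 1) * al ^+ 2 * D2 al (kap + 2) (t + tau)).

Lemma der_shift (f : R -> R) x a : is_derive (x + tau) 1 f a ->
  is_derive x 1 (fun t => f (t + tau)) a.
Proof.
move=> df; apply: der_eq (der_comp (f := f) (g := fun t => t + tau) df (derD (derI x) (derC tau x))) _.
by rewrite addr0 mulr1.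
Qed.

Lemma dW (t : R) : is_derive t 1 W (W1 t).
Proof. by apply: derZ; apply: der_shift; exact: is_derive_Y. Qed.

Lemma dW1 (t : R) : is_derive t 1 W1 (W2 t).
Proof. by apply: derZ; apply: der_shift; exact: is_derive_D1. Qed.

Lemma dW2 (t : R) : is_derive t 1 W2 (W3 t).
Proof.
by apply: derZ; apply: derB; apply: derZ; apply: der_shift; exact: is_derive_Y.
Qed.

Lemma dW3 (t : R) : is_derive t 1 W3 (W4 t).
Proof.
by apply: derZ; apply: derB; apply: derZ; apply: der_shift; exact: is_derive_D1.
Qed.

Lemma smooth1_W : smooth1 W.
Proof.
apply: smooth1Z; apply: (smooth1_comp (g := fun t => t + tau)); first exact: smooth1_Y.
by apply: smooth1D; [exact: smooth1_id|exact: smooth1_cst].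
Qed.

Lemma W_gt0 t : 0 < W t. Proof. by rewrite mulr_gt0 ?K_gt0 ?Y_gt0. Qed.

Lemma W_pp t : W t `^ pp = K * Kbase * Y al (kap + 4) (t + tau).
Proof.
rewrite /W powRM ?(ltW K_gt0) ?expR_ge0// K_pp; congr (_ * _).
rewrite /Y -expRM; congr expR; have <- := ppE mu0 muN; ring.
Qed.

(** As [aa = al kap] and [bb = al (kap + 2)], the two second-order factors raise the exponent from
    [kap] to [kap + 2] and to [kap + 4], which is [kap * pp]. *)
Lemma W_ode t : W4 t - (aa ^+ 2 + bb ^+ 2) * W2 t + aa ^+ 2 * bb ^+ 2 * W t = W t `^ pp.
Proof.
rewrite W_pp /W4 /W2 /W /D2 /Kbase /aa /bb -[kap + 2 + 2]addrA (_ : 2 + 2 = 4); first ring.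
by rewrite -natrD.
Qed.

(** [W] and its derivatives are all bounded by multiples of this function, which is the weight
    required by [weak_sol_uw]. *)
Let y t := Y al kap (t + tau).

Let y0 t : 0 <= y t. Proof. exact: expR_ge0. Qed.

Let sy : smooth1 y.
Proof.
apply: (smooth1_comp (g := fun t => t + tau)); first exact: smooth1_Y.
by apply: smooth1D; [exact: smooth1_id|exact: smooth1_cst].
Qed.

Let my : measurable_fun setT y.
Proof. by apply: continuous_measurable_fun; exact: smooth1_continuous. Qed.

Let iy : intg leb y. Proof. exact: intg_Y. Qed.

Let iy2 : intg leb (fun t => y t ^+ 2).
Proof.
apply: intg_le iy; first exact: measurable_funX.
move=> t; rewrite ger0_norm ?sqr_ge0// expr2 -[leRHS]mulr1 ler_wpM2l//.
by apply: Y_le1 => //; exact: ltW.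
Qed.

Let domD1 : domy y (fun t => D1 al kap (t + tau)).
Proof.
split; first exact: is_derive_continuous (fun t => der_shift (is_derive_D1 _ _ _)).
exists (kap * al); first by apply: mulr_ge0; exact: ltW.
by move=> t; apply: D1_le => //; exact: ltW.
Qed.

Let domD1' : domy y (fun t => D1 al (kap + 2) (t + tau)).
Proof.
have k0 := kp; split; first exact: is_derive_continuous (fun t => der_shift (is_derive_D1 _ _ _)).
exists ((kap + 2) * al); first by apply: mulr_ge0; [lra|exact: ltW].
move=> t; apply: le_trans (D1_le _ _ _) _ => //; first lra.
by apply: ler_wpM2l; [apply: mulr_ge0; [lra|exact: ltW]|apply: Y_le => //; lra].
Qed.

Let cY q : continuous (fun t => Y al q (t + tau)).
Proof. exact: is_derive_continuous (fun t => der_shift (is_derive_Y _ _ _)). Qed.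

Let domY q : kap <= q -> domy y (fun t => Y al q (t + tau)).
Proof.
move=> kq; split; first exact: cY.
exists 1 => // t; rewrite mul1r gtr0_norm ?Y_gt0//; exact: Y_le.
Qed.

Let domD2 q : kap <= q -> domy y (fun t => D2 al q (t + tau)).
Proof.
move=> kq; have kq2 : kap <= q + 2 by lra.
have := domyD (domyZ (al ^+ 2 * q ^+ 2) (domY kq))
  (domyZ (- (4 * q * (q + 1) * al ^+ 2)) (domY kq2)).
by congr domy; apply/funext => t; rewrite /D2 mulNr.
Qed.

Lemma weak_sol_W : weak_sol N mu (uw W).
Proof.
have k2 : kap <= kap + 2 by lra.
apply: (weak_sol_uw N5 mu0 muN y0 my iy iy2 smooth1_W dW dW1 dW2 dW3 _ _ _ _ _ W_gt0 W_ode).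
- exact: domyZ (domY _).
- exact: domyZ.
- exact: domyZ (domD2 _).
- apply: domyZ; have := domyD (domyZ (al ^+ 2 * kap ^+ 2) domD1)
    (domyZ (- (4 * kap * (kap + 1) * al ^+ 2)) domD1').
  by congr domy; apply/funext => t; rewrite mulNr.
- apply: domyZ; have := domyD (domyZ (al ^+ 2 * kap ^+ 2) (domD2 (lexx _)))
    (domyZ (- (4 * kap * (kap + 1) * al ^+ 2)) (domD2 k2)).
  by congr domy; apply/funext => t; rewrite mulNr.
Qed.

End translated.

Lemma radial_rad (f : R -> R) : radial (rad f).
Proof. by move=> x z xz; rewrite /rad -!enorm_eq0 xz. Qed.

Lemma UmulE lam : 0 < lam -> Umul N mu lam = uw (W (ln lam)).
Proof.
move=> l0; apply/funext => x; rewrite /Umul /Umu /uw /rad.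
(* At the origin a power of 0 with nonzero exponent is 0 by convention, which is the value of [rad]
   there. *)
have [->|x0] := eqVneq x 0.
  have e0 : enorm (lam *: 0 : V) = 0 by apply/eqP; rewrite enorm_eq0 scaler0.
  rewrite e0 powR0 ?mulr0 ?mul0r ?mulr0//.
  by rewrite oppr_eq0 mulf_neq0 ?gt_eqF ?invr_gt0.
have r0 : 0 < enorm x by rewrite enorm_gt0.
set r := enorm x in r0 *.
have -> : enorm (lam *: x) = expR (ln r + ln lam).
  by rewrite (enormZ _ (ltW l0)) expRD !lnK ?posrE// mulrC.
set s := ln r + ln lam; rewrite -[2 * (1 - _)]/(2 * al) -[(N%:R - 4) / 2]/kap /expw /W.
(* Factoring out [e^(al s)] makes the bracket of [Umu] symmetric in [s]; the powers of [|x|] that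
   this releases combine to [e^(-kap t)]. *)
have chE : 1 + expR s `^ (2 * al) = expR (al * s) * ch al s.
  rewrite /ch [RHS]mulrDr -!expRD -expRM addrC mulNr subrr expR0; congr (expR _ + 1); ring.
rewrite chE powRM ?expR_ge0 ?(ltW (ch_gt0 _ _))//.
rewrite -{1}[lam](@lnK R) ?posrE// -!expRM /powR (gt_eqF (ch_gt0 _ _)).
have -> : Y al kap s = expR (- kap * ln (ch al s)) by [].
have me : mu = 2 * kap * (1 - al) := muE mu0 muN.
transitivity (K * expR (- kap * ln (ch al s)) * (expR (ln lam * kap) * expR (s * - (mu / 2)) * expR (al * s * - kap))); first ring.
rewrite -!expRD mulrC; congr (expR _ * _).
have -> : mu / 2 = kap * (1 - al) by rewrite {1}me; field.
rewrite /s; ring.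
Qed.

Lemma existence lam : 0 < lam ->
  [/\ weak_sol N mu (Umul N mu lam), radial (Umul N mu lam) & positive (Umul N mu lam)].
Proof.
move=> l0; rewrite (UmulE l0); split; first exact: (weak_sol_W (ln lam)).
  rewrite /uw; exact: radial_rad.
by apply: uw_gt0 => //; exact: W_gt0.
Qed.

End profile.

(** * From weak solutions to the ODE *)

Section reduction.
Variables (R : realType) (N : nat) (mu : R).
Hypotheses (N5 : (5 <= N)%N) (mu0 : 0 < mu) (muN : mu < N%:R - 4).
Notation V := 'rV[R]_N.
Notation VB := (VB R N).
Notation vol := (@vol R N).
Notation leb := (@lebesgue_measure R).
Notation rad := (@rad R N).
Notation cvol := (cvol R N).
Notation kap := (kap R N).
Notation aa := (aa N mu).
Notation bb := (bb N mu).
Notation pp := (pp R N).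

Let N0 : (0 < N)%N. Proof. exact: leq_trans N5. Qed.
Let kp : 0 < kap := kap_gt0 mu0 muN.
Let NK : N%:R = 2 * kap + 4 := NE R N.

Lemma test1_expw (g : R) (f : R -> R) : test1 f -> test1 (expw g f).
Proof.
by move=> /test1M /(_ (smooth1_expR g)); congr test1; apply/funext => t; rewrite mulrC.
Qed.

Lemma is_derive_expw (g : R) (f : R -> R) (a t : R) : is_derive t 1 f a ->
  is_derive t 1 (expw g f) (expR (g * t) * (a + g * f t)).
Proof. exact: der_expM. Qed.

Lemma lap_expw (g : R) (f f1 f2 : R -> R) : test1 f -> (forall t : R, is_derive t 1 f (f1 t)) ->
  (forall t : R, is_derive t 1 f1 (f2 t)) -> lap (rad (expw g f)) =
  rad (expw (g - 2) (fun t => f2 t + (2 * g + N%:R - 2) * f1 t + g * (g + N%:R - 2) * f t)).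
Proof.
move=> tf d0 d1; apply/funext => x.
have e0 (t : R) := is_derive_expw g (d0 t).
have e1 (t : R) := is_derive_expw g (derD (d1 t) (derZ g (d0 t))).
rewrite (lap_rad x (test1_expw g tf) e0 e1); congr rad; apply/funext => t.
rewrite /expw [(g - 2) * t]mulrDl expRD; ring.
Qed.

Lemma Emu_testfn (psi psi1 : R -> R) : test1 psi -> (forall t : R, is_derive t 1 psi (psi1 t)) ->
  Emu (rad psi).
Proof.
move=> tp dp; have tp1 := test1_der tp dp.
have tr := testfn_rad N tp; have tl := testfn_lap_rad N tp.
have tsq (f : R -> R) g : test1 f -> testfn (rad (expw g (fun t => f t * f t))).
  by move=> tf; apply: testfn_rad; apply: test1_expw; apply: test1M => //; exact: tf.1.
split; first split.
- split; first by apply/measRNP; exact: testfn_meas.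
  have crit0 : crit_exp R N != 0.
    by apply/eqP => h; have := critE mu0 muN; rewrite h mulr0 NK; have := kp; lra.
  apply: lty_intRN; first by move=> x; exact: powR_ge0.
  have [M hM] := testfn_bounded tr; have [_ [r hr]] := tr.
  have c0 : 0 <= crit_exp R N by have := pp_gt1 mu0 muN; rewrite /pp; lra.
  apply: (@intg_bdd_supp _ _ _ (M `^ crit_exp R N) r).
  + apply: (measurableT_comp (measurable_powR _)); apply: measurableT_comp => //; exact: testfn_meas.
  + by move=> x; rewrite ger0_norm ?powR_ge0//; apply: ge0_ler_powR => //; rewrite ?nnegrE// (le_trans _ (hM x)).
  + by move=> x /hr ->; rewrite normr0 powR0.
- exists (lap (rad psi)); split; first exact: wlap_testfn.
  apply: P2inLp; first exact: testfn_meas.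
  by have := intg_testfnM tl tl; congr intg; apply/funext => x; rewrite expr2.
exists (fun i => pd i (rad psi)); split; first exact: wgrad_testfn.
split.
  have -> : (fun x => (gradsq (fun i => pd i (rad psi)) x / enorm x ^+ 2)%:E) =
      (fun x => (rad (expw (-4) (fun t => psi1 t * psi1 t)) x)%:E).
    apply/funext => x; congr EFin; rewrite /gradsq.
    under eq_bigr do rewrite (pd_rad _ tp dp) expr2.
    rewrite sum_crad rad_div; congr rad; apply/funext => t; rewrite /expw.
    rewrite (_ : -4 * t = - 2%:R * t + (2 * t + (-2 * t + -2 * t))); last by ring.
    rewrite !expRD; ring.
  apply: lty_intRN; last by apply: intg_testfn; exact: tsq.
  by move=> x; apply: rad_ge0 => t; rewrite mulr_ge0 ?expR_ge0// -expr2 sqr_ge0.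
have -> : (fun x => (rad psi x ^+ 2 / enorm x ^+ 4)%:E) =
      (fun x => (rad (expw (-4) (fun t => psi t * psi t)) x)%:E).
  by apply/funext => x; congr EFin; rewrite expr2 radM rad_div.
apply: lty_intRN; last by apply: intg_testfn; exact: tsq.
by move=> x; apply: rad_ge0 => t; rewrite mulr_ge0 ?expR_ge0// -expr2 sqr_ge0.
Qed.

Variable u : V -> R.
Hypotheses (wsu : weak_sol N mu u) (ru : radial u) (pu : positive u).

Definition e0 : V := delta_mx ord0 (Ordinal N0).
Definition wof (t : R) : R := expR (kap * t) * u (expR t *: e0).

Lemma enorm_e0 : enorm e0 = 1.
Proof.
rewrite /enorm (bigD1 (Ordinal N0))//= big1 ?addr0; last first.
  by move=> i ij; rewrite mxE (negPf ij) andbF expr0n.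
by rewrite mxE !eqxx expr1n sqrtr1.
Qed.

Lemma enorm_exp_e0 t : enorm (expR t *: e0) = expR t.
Proof. by rewrite enormZ ?expR_ge0// enorm_e0 mulr1. Qed.

Lemma wof_gt0 t : 0 < wof t.
Proof.
rewrite mulr_gt0 ?expR_gt0//; apply: pu.
by rewrite -enorm_gt0 enorm_exp_e0 expR_gt0.
Qed.

Lemma uE x : x != 0 -> u x = expw (- kap) wof (ln (enorm x)).
Proof.
move=> x0; rewrite /expw /wof mulrA -expRD mulNr addNr expR0 mul1r.
by apply: ru; rewrite enorm_exp_e0 lnK// posrE enorm_gt0.
Qed.

Lemma u_rad F x : u x * rad F x = rad (fun t => expw (- kap) wof t * F t) x.
Proof. by rewrite /rad; case: eqP => [_|/eqP x0]; rewrite ?mulr0 ?uE. Qed.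

Let mu' : measurable_fun setT (u : VB -> R).
Proof. by apply/measRNP; have [[[[]]]] := wsu. Qed.

Lemma measurable_wof : measurable_fun setT wof.
Proof.
apply: measurable_funM; first exact: measurable_expRN.
apply: (measurableT_comp mu' (g := fun t => expR t *: e0 : VB)).
apply: measurable_coordP => i.
rewrite (_ : (fun t => _) = (fun t => expR t * e0 ord0 i)); last by apply/funext => t; rewrite mxE.
by apply: measurable_funM => //; exact: measurable_expR.
Qed.

Let mw := measurable_wof.

Let mexpw (g : R) (f : R -> R) : measurable_fun setT f -> measurable_fun setT (expw g f).
Proof. by move=> mf; apply: measurable_funM => //; exact: measurable_expRN. Qed.

Let expwNK (f : R -> R) t : expR (N%:R * t) * expw (- N%:R) f t = f t.
Proof. by rewrite /expw mulrA -expRD mulNr subrr expR0 mul1r. Qed.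

Hypothesis c0 : 0 < cvol.

Let intg_expw f : measurable_fun setT f -> intg vol (rad (expw (- N%:R) f)) -> intg leb f.
Proof.
move=> mf /(intg_rad_inv N0 c0 (mexpw _ mf)); congr intg.
by apply/funext => t; exact: expwNK.
Qed.

Let rint_expw f : intg leb f -> rint vol (rad (expw (- N%:R) f)) = cvol * rint leb f.
Proof.
move=> iF; rewrite (rint_rad N0)//.
- by congr (_ * _); apply: eq_rint => t; exact: expwNK.
- by apply: mexpw; exact: (intg_meas iF).
- by move: iF; congr intg; apply/funext => t; rewrite expwNK.
Qed.

(** The weight [|x|^(-4)] and the Jacobian [e^(N t)] cancel the factor [e^(-2 kap t)] of [u^2]. This
    and [wof_pow] are the only bounds on [u] passed on to the regularity proof. *)
Lemma wof_sq : intg leb (fun t => wof t ^+ 2).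
Proof.
apply: intg_expw; first exact: measurable_funX.
have [[_ [g [_ [_ h]]]] _] := wsu.
have E : (fun x => (u x ^+ 2 / enorm x ^+ 4)) = rad (expw (- N%:R) (fun t => wof t ^+ 2)).
  apply/funext => x; rewrite /rad; case: eqP => [->|/eqP x0].
    have -> : enorm (0 : V) = 0 by apply/eqP; rewrite enorm_eq0.
    by rewrite expr0n invr0 mulr0.
  rewrite uE// -[X in X ^+ 4](@lnK R) ?posrE ?enorm_gt0// -expRM_natl -expRN.
  rewrite /expw exprMn -expRM_natl mulrAC -expRD NK; congr (expR _ * _); ring.
rewrite -E; apply: intRN_lty => //.
  rewrite E; apply: measurable_rad; apply: mexpw; exact: measurable_funX.
by move=> x; rewrite divr_ge0 ?sqr_ge0 ?exprn_even_ge0.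
Qed.

Lemma wof_pow : intg leb (fun t => wof t `^ pp * wof t).
Proof.
have mf : measurable_fun setT (fun t => wof t `^ pp * wof t).
  by apply: measurable_funM => //; exact: (measurableT_comp (measurable_powR _)).
apply: intg_expw => //.
have [[[[_ h] _] _] _] := wsu.
have mU : measurable_fun setT ((fun x => `|u x| `^ crit_exp R N) : VB -> R).
  by apply: (measurableT_comp (measurable_powR _)); exact: measurableT_comp.
have iu := intRN_lty mU (fun x => powR_ge0 _ _) h.
apply: ae_intg iu _; first by apply: measurable_rad; exact: mexpw.
apply: ae_mp (vol_ae_neq0 R N0) _ => x x0; rewrite /rad (negPf x0) ger0_norm ?ltW ?pu// uE//.
set t := ln _; rewrite /expw powRM ?expR_ge0 ?(ltW (wof_gt0 _))// -expRM; congr (expR _ * _).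
  by rewrite -(critE mu0 muN); ring.
rewrite (_ : crit_exp R N = pp + 1); last by rewrite /pp subrK.
by rewrite powRD ?powRr1 ?(ltW (wof_gt0 _))// (gt_eqF (wof_gt0 _)) implybT.
Qed.

(** The other function is smooth, so all derivatives are moved onto it and those of [u] enter only
    through their definitions. The two differential terms carry [Q1 = (D^2 - kap^2) (D^2 - (kap +
    2)^2) x0] and [Q2 = (D^2 - kap^2) x0]. *)
Lemma wof_weak (x0 x1 x2 x3 x4 : R -> R) : test1 x0 ->
  (forall t : R, is_derive t 1 x0 (x1 t)) -> (forall t : R, is_derive t 1 x1 (x2 t)) ->
  (forall t : R, is_derive t 1 x2 (x3 t)) -> (forall t : R, is_derive t 1 x3 (x4 t)) ->
  rint leb (fun t => wof t * (x4 t - (aa ^+ 2 + bb ^+ 2) * x2 t + aa ^+ 2 * bb ^+ 2 * x0 t)) =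
  rint leb (fun t => wof t `^ pp * x0 t).
Proof.
move=> t0 d0 d1 d2 d3.
have t1 := test1_der t0 d0; have t2 := test1_der t1 d1; have t3 := test1_der t2 d2.
have t4 := test1_der t3 d3.
pose psi := expw (- kap) x0; pose phi := rad psi.
have tpsi : test1 psi by exact: test1_expw.
have dpsi (t : R) : is_derive t 1 psi (expw (- kap) (fun t => x1 t + - kap * x0 t) t).
  exact: is_derive_expw.
pose hx t := x2 t + 2 * x1 t + - (kap * (kap + 2)) * x0 t.
pose hx1 t := x3 t + 2 * x2 t + - (kap * (kap + 2)) * x1 t.
pose hx2 t := x4 t + 2 * x3 t + - (kap * (kap + 2)) * x2 t.
have thx : test1 hx by apply: test1D; [apply: test1D => //|]; exact: test1Z.
have dhx (t : R) : is_derive t 1 hx (hx1 t).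
  exact: (derD (derD (d2 t) (derZ 2 (d1 t))) (derZ _ (d0 t))).
have dhx1 (t : R) : is_derive t 1 hx1 (hx2 t).
  exact: (derD (derD (d3 t) (derZ 2 (d2 t))) (derZ _ (d1 t))).
have lE : lap phi = rad (expw (- (kap + 2)) hx).
  rewrite /phi (lap_expw (- kap) t0 d0 d1) (_ : - kap - 2 = - (kap + 2)); last by ring.
  by congr (rad (expw _ _)); apply/funext => t; rewrite /hx NK; ring.
pose Q1 t := hx2 t - 2 * hx1 t - kap * (kap + 2) * hx t.
have llE : lap (lap phi) = rad (expw (- (kap + 4)) Q1).
  rewrite lE (lap_expw (- (kap + 2)) thx dhx dhx1) (_ : - (kap + 2) - 2 = - (kap + 4)); last by ring.
  by congr (rad (expw _ _)); apply/funext => t; rewrite /Q1 NK; ring.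
have tl : testfn (lap phi) by exact: testfn_lap_rad.
have tphi : testfn phi by exact: testfn_rad.
pose kx t := x1 t + - kap * x0 t; pose k := expw (- (kap + 4)) kx.
have tkx : test1 kx by apply: test1D => //; exact: test1Z.
have tk : test1 k by exact: test1_expw.
have tc i : testfn (fun x => x ord0 i * rad k x) by exact: testfn_crad.
pose Q2 t := x2 t - kap ^+ 2 * x0 t.
have dE x : \sum_(i < N) pd i (fun y => y ord0 i * rad k y) x = rad (expw (- (kap + 4)) Q2) x.
  have dkx (t : R) : is_derive t 1 kx (x2 t + - kap * x1 t) := derD (d1 t) (derZ _ (d0 t)).
  rewrite (div_crad x tk (fun t => is_derive_expw (- (kap + 4)) (dkx t))).
  by congr rad; apply/funext => t; rewrite /k /expw /Q2 /kx NK; ring.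
have [[[_ [h [wh _]]] [g [wg _]]] ws] := wsu.
have := ws phi h g (lap phi) (fun i => pd i phi) (Emu_testfn tpsi dpsi) wh wg
  (wlap_testfn tphi tl) (wgrad_testfn tphi).
(* [lap phi] is itself a test function; using it in the weak Laplacian of [u] eliminates the unknown
   [h]. *)
have [lu [lh /(_ _ tl) <-]] := wh.
have [_ [lg gg]] := wg.
pose Q := fun t => x4 t - (aa ^+ 2 + bb ^+ 2) * x2 t + aa ^+ 2 * bb ^+ 2 * x0 t.
have tQ : test1 Q.
  have := test1D (test1D t4 (test1Z (- (aa ^+ 2 + bb ^+ 2)) t2)) (test1Z (aa ^+ 2 * bb ^+ 2) t0).
  by congr test1; apply/funext => t; rewrite /Q mulNr.
have tQ1 : test1 Q1.
  have th1 := test1_der thx dhx; have th2 := test1_der th1 dhx1.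
  have := test1D (test1D th2 (test1Z (- 2) th1)) (test1Z (- (kap * (kap + 2))) thx).
  by congr test1; apply/funext => t; rewrite /Q1 !mulNr.
have tQ2 : test1 Q2.
  by have := test1D t2 (test1Z (- kap ^+ 2) t0); congr test1; apply/funext => t; rewrite /Q2 mulNr.
have tr f : test1 f -> testfn (rad (expw (- (kap + 4)) f)).
  by move=> tf; apply: testfn_rad; exact: test1_expw.
have i1 := intg_locint lu (tr _ tQ1).
have i2 := intg_locint lu (tr _ tQ2).
have i3 := intg_locint lu (tr _ t0).
have -> : intRN (fun x => (u x * lap (lap phi) x)%:E) =
   (rint vol (fun x => u x * rad (expw (- (kap + 4)) Q1) x))%:E by rewrite llE intRN_rint.
have -> : intRN (fun x => (u x * phi x / enorm x ^+ 4)%:E) =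
   (rint vol (fun x => u x * rad (expw (- (kap + 4)) x0) x))%:E.
  rewrite -intRN_rint//; congr intRN; apply/funext => x; congr EFin.
  rewrite -mulrA rad_div; congr (_ * rad _ _); apply/funext => t.
  by rewrite /expw mulrA -expRD; congr (expR _ * _); ring.
have -> : intRN (fun x => (gradprod g (fun i => pd i phi) x / enorm x ^+ 2)%:E) =
   (- rint vol (fun x => u x * rad (expw (- (kap + 4)) Q2) x))%:E.
  have E x : gradprod g (fun i => pd i phi) x / enorm x ^+ 2 =
      \sum_(i < N) g i x * (x ord0 i * rad k x).
    rewrite /gradprod mulr_suml; apply: eq_bigr => i _; rewrite (pd_rad i tpsi dpsi) -mulrA.
    congr (_ * _); rewrite -mulrA rad_div; congr (_ * rad _ _); apply/funext => t.
    by rewrite /k /expw !mulrA -!expRD; congr (expR _ * _); ring.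
  have iG i : intg vol (fun x => g i x * (x ord0 i * rad k x)) by exact: intg_locint.
  have iU i : intg vol (fun x => u x * pd i (fun y => y ord0 i * rad k y) x).
    by apply: intg_locint => //; exact: testfn_pd.
  have -> : (fun x => (gradprod g (fun i => pd i phi) x / enorm x ^+ 2)%:E) =
      (fun x => (\sum_(i < N) g i x * (x ord0 i * rad k x))%:E).
    by apply/funext => x; rewrite E.
  rewrite intRN_rint ?rint_sum//; last by apply: intg_sum.
  congr EFin; rewrite (eq_rint vol (g := fun x => \sum_(i < N) u x * pd i (fun y => y ord0 i * rad k y) x)).
    rewrite rint_sum// -sumrN; apply: eq_bigr => i _.
    have := gg _ (tc i) i; rewrite !intRN_rint// -EFinN => -[->].
    by rewrite opprK.
  by move=> x; rewrite -mulr_sumr dE.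
have bw (f : R -> R) : test1 f -> intg leb (fun t => wof t * f t).
  move=> tf; apply: intg_sq => //.
  - by apply: continuous_measurable_fun; exact: smooth1_continuous tf.1.
  - exact: wof_sq.
  - have t2' : test1 (fun t => expw (- N%:R) (fun t => f t * f t) t).
      by apply: test1_expw; apply: test1M => //; exact: tf.1.
    apply: intg_expw.
      apply: measurable_funX; apply: continuous_measurable_fun; exact: smooth1_continuous tf.1.
    by have := intg_testfn (testfn_rad N t2').
have radE f : (fun x => u x * rad (expw (- (kap + 4)) f) x) = rad (expw (- N%:R) (fun t => wof t * f t)).
  apply/funext => x; rewrite u_rad; congr rad; apply/funext => t; rewrite /expw mulrACA -expRD NK.
  by congr (expR _ * _); ring.
(* Where [w <= 1] the power [w^pp] is at most [w], elsewhere it is at most [w^pp w], which is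
   integrable. *)
have ip : intg leb (fun t => wof t `^ pp * x0 t).
  have [M M0 hM] := test1_bounded t0.
  apply: intg_le (intgD (intg_norm (bw _ t0)) (intgZ M wof_pow)).
    apply: measurable_funM; first exact: (measurableT_comp (measurable_powR _)).
    by apply: continuous_measurable_fun; exact: smooth1_continuous t0.1.
  move=> t; have w0 := wof_gt0 t; rewrite normrM (ger0_norm (powR_ge0 _ _)) normrM (gtr0_norm w0).
  have p1 := pp_gt1 mu0 muN.
  have P0 := powR_ge0 (wof t) pp; have X0 := normr_ge0 (x0 t).
  have [w1|w1] := leP (wof t) 1.
    apply: (@le_trans _ _ (wof t * `|x0 t|)).
      rewrite ler_wpM2r// -[leRHS](powRr1 (ltW w0)); apply: ger_powR => //; last exact: ltW.
      by rewrite w0 w1.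
    by rewrite lerDl; do 2 apply: mulr_ge0 => //; exact: ltW.
  apply: (@le_trans _ _ (M * (wof t `^ pp * wof t))); last by rewrite lerDr mulr_ge0// ltW.
  rewrite mulrC; apply: ler_pM => //.
  by rewrite -{1}[_ `^ _]mulr1 ler_wpM2l// ltW.
have -> : intRN (fun x => (u x `^ (crit_exp R N - 1) * phi x)%:E) =
    (cvol * rint leb (fun t => wof t `^ pp * x0 t))%:E.
  have E : (fun x => (u x `^ (crit_exp R N - 1) * phi x)%:E) =
      (fun x => (rad (expw (- N%:R) (fun t => wof t `^ pp * x0 t)) x)%:E).
    apply/funext => x; congr EFin; rewrite /phi /rad; case: eqP => [_|/eqP xn]; first by rewrite mulr0.
    rewrite uE//; set t := ln _; rewrite /psi /expw powRM ?expR_ge0 ?(ltW (wof_gt0 _))// -expRM mulrACA -expRD.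
    congr (expR _ * _); rewrite NK -/pp.
    transitivity (- (kap * pp + kap) * t); first by ring.
    by rewrite (ppE mu0 muN); ring.
  rewrite E intRN_rint ?rint_expw//; apply: intg_rad => //.
    by apply: mexpw; exact: (intg_meas ip).
  by move: ip; congr intg; apply/funext => t; rewrite expwNK.
rewrite !radE !rint_expw ?bw// -!EFinM -EFinN -!EFinD => -[e].
apply: (mulfI (lt0r_neq0 c0)); rewrite -e.
transitivity (cvol * (rint leb (fun t => wof t * Q1 t) + Cmu1 N mu * rint leb (fun t => wof t * Q2 t) +
   Cmu2 N mu * rint leb (fun t => wof t * x0 t))); last by ring.
congr (_ * _).
rewrite -!rintZ ?bw// -!rintD; try by do ?[apply: intgD|apply: intgZ]; exact: bw.
apply: eq_rint => t; rewrite (Cmu2E mu0 muN) (Cmu1E mu0 muN) /Q1 /Q2 /hx /hx1 /hx2; ring.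
Qed.

End reduction.

(** * Regularity through the Green kernel *)

Section convolution.
Variables (R : realType).
Notation leb := (@lebesgue_measure R).
Implicit Types (a : R) (h g : R -> R).

Definition halfl (x s : R) : R := (s <= x)%R%:R.

Lemma measurable_halfl x : measurable_fun setT (halfl x).
Proof.
rewrite (_ : halfl x = \1_(`]-oo, x]%classic)); first exact: measurable_indic.
by apply/funext => s; rewrite /halfl indicE mem_setE in_itv /=.
Qed.

Lemma halfl_ge0 x s : 0 <= halfl x s. Proof. exact: ler0n. Qed.
Lemma halfl_le1 x s : halfl x s <= 1. Proof. by rewrite lern1 leq_b1. Qed.

Lemma intg_halfl g x : intg leb g -> intg leb (fun s => g s * halfl x s).
Proof.
move=> ig; apply: intg_le (intg_norm ig).
  by apply: measurable_funM; [exact: intg_meas ig|exact: measurable_halfl].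
move=> s; rewrite normrM (ger0_norm (halfl_ge0 _ _)).
by rewrite -[leRHS]mulr1 ler_wpM2l// halfl_le1.
Qed.

Lemma is_derive_prim g (t : R) : intg leb g -> {for t, continuous g} ->
  is_derive t 1 (fun x => rint leb (fun s => g s * halfl x s)) (g t).
Proof.
move=> ig cg.
have i1 : leb.-integrable [set` Interval -oo%O (BRight (t + 1))] (EFin \o g).
  by apply: integrableS ig => //.
have t1 : t < t + 1 by rewrite ltrDl.
have [|d1 d2] := continuous_FTC1 t1 i1 _ cg; first exact: ltNyr.
have E : (fun x => rint leb (fun s => g s * halfl x s)) =
  (fun x => \int[leb]_(s in [set` Interval -oo%O (BRight x)]) g s).
  apply/funext => x; rewrite /rint /Rintegral [in RHS]integral_mkcond; congr fine.
  apply: eq_integral => s _; rewrite patchE /halfl mem_setE in_itv /=.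
  by case: ifP; rewrite ?mulr1 ?mulr0.
by rewrite E; apply: DeriveDef => //; rewrite -derive1E.
Qed.

Lemma near_is_derive (f g : R -> R) (t l : R) : (\forall x \near t, f x = g x) ->
  is_derive t 1 g l -> is_derive t 1 f l.
Proof.
move=> fg [dg <-]; apply: DeriveDef.
  by apply: near_eq_derivable dg => //; near=> x; symmetry; near: x.
by apply: near_eq_derive.
Unshelve. all: by end_near. Qed.

Lemma le_nbhs_near (x z : R) : x < z -> \forall y \near x, y <= z.
Proof. by move=> xz; apply: filterS (lt_nbhsl xz) => y /ltW. Qed.

Lemma gt_nbhs_near (x z : R) : z < x -> \forall y \near x, z < y.
Proof.
move=> xz; have h : - x < - z by rewrite ltrN2.
by apply: filterS (Nlt_nbhsl h) => y; rewrite ltrN2.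
Qed.

(* [Ecv] and [Dcv] satisfy [E' = a D] and [D' = a E - 2 h], so that
   [Ecv a h / (2 a)] solves [a^2 y - y'' = h]. *)
Definition ker a (t s : R) : R := expR (- (a * `|t - s|)).
Definition Ecv a h t : R := rint leb (fun s => ker a t s * h s).
Definition Y1 a h t : R := rint leb (fun s => ker a t s * h s * halfl t s).
Definition Dcv a h t : R := Ecv a h t - 2 * Y1 a h t.

Lemma ker_gt0 a t s : 0 < ker a t s. Proof. exact: expR_gt0. Qed.

Lemma ker_le1 a t s : 0 <= a -> ker a t s <= 1.
Proof. by move=> a0; rewrite -expR0 ler_expR oppr_le0 mulr_ge0. Qed.

Lemma kerC a t s : ker a t s = ker a s t.
Proof. by rewrite /ker distrC. Qed.

Lemma continuous_ker a t : continuous (ker a t).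
Proof.
move=> s; apply: (@continuous_comp _ _ _ (fun s : R => - (a * `|t - s|)) expR); last exact: continuous_expR.
apply: cvgN; apply: cvgM; first exact: cvg_cst.
by apply: cvg_norm; apply: cvgB; [exact: cvg_cst|exact: cvg_id].
Qed.

Lemma measurable_ker a t : measurable_fun setT (ker a t).
Proof. by apply: continuous_measurable_fun; exact: continuous_ker. Qed.

Lemma ker_triangle a t t' s : 0 <= a -> ker a t s <= expR (a * `|t - t'|) * ker a t' s.
Proof.
move=> a0; rewrite /ker -expRD ler_expR.
have := ler_normD (t' - t) (t - s); rewrite subrKA (distrC t' t); nra.
Qed.

Lemma intg_ker a h t : 0 <= a -> measurable_fun setT h -> intg leb (fun s => ker a 0 s * h s) ->
  intg leb (fun s => ker a t s * h s).
Proof.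
move=> a0 mh ih; apply: intg_le (intgZ (expR (a * `|t - 0|)) (intg_norm ih)).
  by apply: measurable_funM => //; exact: measurable_ker.
move=> s; rewrite !normrM (gtr0_norm (ker_gt0 a t s)) (gtr0_norm (ker_gt0 a 0 s)) mulrA.
by apply: ler_wpM2r => //; exact: ker_triangle.
Qed.

Section deriv.
Variables (a : R) (h : R -> R).
Hypotheses (a0 : 0 < a) (ch : continuous h) (ih : intg leb (fun s => ker a 0 s * h s)).

Let mh : measurable_fun setT h. Proof. exact: continuous_measurable_fun. Qed.
Let ik t := intg_ker t (ltW a0) mh ih.

Lemma is_derive_Y1 (t : R) : is_derive t 1 (Y1 a h) (- a * Y1 a h t + h t).
Proof.
(* For [s <= x] the kernel splits as [e^(-a x) e^(a s)], so [Y1] is an exponential times a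
   primitive. Truncation at [u], beyond [t], makes [g] integrable without changing it near [t]. *)
pose u := t + 1; pose g s := expR (a * s) * h s * halfl u s.
have ce : continuous (fun s => expR (a * s) * h s).
  by move=> s; apply: cvgM; [exact: continuous_expR_scale|exact: ch].
have mg : measurable_fun setT g.
  apply: measurable_funM; first exact: continuous_measurable_fun.
  exact: measurable_halfl.
have kE x s : s <= x -> ker a x s = expR (- a * x) * expR (a * s).
  move=> sx; rewrite /ker -expRD ger0_norm ?subr_ge0//; congr expR; ring.
have ig : intg leb g.
  apply: intg_le (intgZ (expR (a * u)) (intg_norm (ik u))) => // s.
  rewrite /g /halfl; case: (leP s u) => su; last first.
    by rewrite mulr0 normr0 mulr_ge0 ?expR_ge0.
  rewrite mulr1 !normrM kE// normrM !(gtr0_norm (expR_gt0 _)) !mulrA -expRD.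
  by rewrite mulNr subrr expR0 mul1r.
have cg : {for t, continuous g}.
  apply: (@cvg_trans _ ((fun s => expR (a * s) * h s) x @[x --> t])).
    apply: near_eq_cvg; near=> s.
    by rewrite /g /halfl (_ : s <= u) ?mulr1//; near: s; apply: le_nbhs_near; rewrite ltrDl.
  by rewrite /g /halfl (_ : t <= u) ?mulr1 ?lerDl//; exact: ce.
have dp := is_derive_prim ig cg.
have gt : g t = expR (a * t) * h t by rewrite /g /halfl lerDl ler01 mulr1.
have YE x : x <= u -> Y1 a h x = expR (- a * x) * rint leb (fun s => g s * halfl x s).
  move=> xu; rewrite -rintZ; last exact: intg_halfl.
  apply: eq_rint => s; rewrite /g /halfl; case: (leP s x) => sx; last by rewrite !mulr0.
  by rewrite kE// (le_trans sx xu) !mulr1 mulrA.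
have := derM (is_derive_expR_scale (- a) t) dp => hd.
have hn : \forall x \near t, Y1 a h x = expR (- a * x) * rint leb (fun s => g s * halfl x s).
  by near=> x; apply: YE; near: x; apply: le_nbhs_near; rewrite ltrDl.
apply: near_is_derive hn _; apply: der_eq hd _.
have tu : t <= u by rewrite lerDl.
have e : expR (- a * t) * (expR (a * t) * h t) = h t.
  by rewrite mulrA -expRD mulNr addNr expR0 mul1r.
by rewrite YE// gt e; ring.
Unshelve. all: by end_near. Qed.

Definition Y2 t : R := Ecv a h t - Y1 a h t.

Lemma is_derive_Y2 (t : R) : is_derive t 1 Y2 (a * Y2 t - h t).
Proof.
pose u := t - 1; pose g s := expR (- a * s) * h s * (1 - halfl u s).
have ce : continuous (fun s => expR (- a * s) * h s).
  by move=> s; apply: cvgM; [exact: continuous_expR_scale|exact: ch].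
have mg : measurable_fun setT g.
  apply: measurable_funM; first exact: continuous_measurable_fun.
  by apply: measurable_funB => //; exact: measurable_halfl.
have kE x s : x < s -> ker a x s = expR (a * x) * expR (- a * s).
  move=> sx; rewrite /ker -expRD ltr0_norm ?subr_lt0//; congr expR; ring.
have ig : intg leb g.
  apply: intg_le (intgZ (expR (- a * u)) (intg_norm (ik u))) => // s.
  rewrite /g /halfl; case: (leP s u) => su.
    by rewrite subrr mulr0 normr0 mulr_ge0 ?expR_ge0.
  rewrite subr0 mulr1 !normrM kE// normrM !(gtr0_norm (expR_gt0 _)) !mulrA -expRD.
  by rewrite -mulrDl addNr mul0r expR0 mul1r.
have tu : u < t by rewrite ltrBlDr ltrDl.
have cg : {for t, continuous g}.
  apply: (@cvg_trans _ ((fun s => expR (- a * s) * h s) x @[x --> t])).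
    apply: near_eq_cvg; near=> s.
    rewrite /g /halfl leNgt (_ : u < s) ?subr0 ?mulr1//; near: s; exact: gt_nbhs_near.
  by rewrite /g /halfl leNgt tu subr0 mulr1; exact: ce.
have dp := is_derive_prim ig cg.
have gt : g t = expR (- a * t) * h t by rewrite /g /halfl leNgt tu subr0 mulr1.
have YE x : u <= x -> Y2 x = expR (a * x) * (rint leb g - rint leb (fun s => g s * halfl x s)).
  move=> xu; rewrite -rintB//; last exact: intg_halfl.
  rewrite -rintZ; last by apply: intgB => //; exact: intg_halfl.
  rewrite /Y2 /Ecv /Y1 -rintB; [|exact: ik|exact: intg_halfl].
  apply: eq_rint => s; rewrite /g /halfl; case: (leP s x) => sx; first by rewrite !mulr1 !subrr mulr0.
  by rewrite kE// leNgt (le_lt_trans xu sx) !mulr0 !subr0 mulr1 mulrA.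
have := derM (is_derive_expR_scale a t) (derB (derC (rint leb g) t) dp) => hd.
have hn : \forall x \near t, Y2 x = expR (a * x) * (rint leb g - rint leb (fun s => g s * halfl x s)).
  by near=> x; apply: YE; apply/ltW; near: x; exact: gt_nbhs_near.
apply: near_is_derive hn _; apply: der_eq hd _.
rewrite (YE _ (ltW tu)) gt mulrA; congr (_ + _).
by rewrite sub0r mulrN mulrA -expRD mulNr subrr expR0 mul1r.
Unshelve. all: by end_near. Qed.

Lemma is_derive_Ecv (t : R) : is_derive t 1 (Ecv a h) (a * Dcv a h t).
Proof.
have -> : Ecv a h = fun x => Y1 a h x + Y2 x by apply/funext => x; rewrite /Y2 addrC subrK.
by apply: der_eq (derD (is_derive_Y1 t) (is_derive_Y2 t)) _; rewrite /Y2 /Dcv; ring.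
Qed.

Lemma is_derive_Dcv (t : R) : is_derive t 1 (Dcv a h) (a * Ecv a h t - 2 * h t).
Proof.
have -> : Dcv a h = fun x => Y2 x - Y1 a h x by apply/funext => x; rewrite /Dcv /Y2; ring.
by apply: der_eq (derB (is_derive_Y2 t) (is_derive_Y1 t)) _; rewrite /Y2; ring.
Qed.

(** The kernel of [Dcv] is [ker] with its sign reversed on [s <= t], so it has the same absolute
    value as that of [Ecv]. *)
Lemma Dcv_le t : `|Dcv a h t| <= Ecv a (fun s => `|h s|) t.
Proof.
have i1 := intg_halfl t (ik t).
have E : Dcv a h t = rint leb (fun s => ker a t s * h s - 2 * (ker a t s * h s * halfl t s)).
  by rewrite rintB ?rintZ//; exact: intgZ.
have i2 : intg leb (fun s => ker a t s * h s - 2 * (ker a t s * h s * halfl t s)).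
  by apply: intgB; [exact: ik|exact: intgZ].
have i3 : intg leb (fun s => ker a t s * `|h s|).
  by have := intg_norm (ik t); congr intg; apply/funext => s; rewrite normrM gtr0_norm ?ker_gt0.
have b s : `|ker a t s * h s - 2 * (ker a t s * h s * halfl t s)| <= ker a t s * `|h s|.
  have -> : ker a t s * h s - 2 * (ker a t s * h s * halfl t s) = (1 - 2 * halfl t s) * (ker a t s * h s).
    by ring.
  rewrite normrM normrM (gtr0_norm (ker_gt0 _ _ _)).
  have [->|->] : halfl t s = 0 \/ halfl t s = 1.
  - by rewrite /halfl; case: (s <= t); [right|left].
  - by rewrite mulr0 subr0 normr1 mul1r.
  - by rewrite mulr1 (_ : 1 - 2 = - 1 :> R) ?normrN ?normr1 ?mul1r//; ring.
rewrite E ler_norml -rintN//; apply/andP; split; apply: le_rint => //; try exact: intgN.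
  by move=> s; have := b s; rewrite ler_norml => /andP[].
by move=> s; have := b s; rewrite ler_norml => /andP[].
Qed.

Lemma Ecv_le t : `|Ecv a h t| <= Ecv a (fun s => `|h s|) t.
Proof.
have i3 : intg leb (fun s => ker a t s * `|h s|).
  by have := intg_norm (ik t); congr intg; apply/funext => s; rewrite normrM gtr0_norm ?ker_gt0.
have b s : `|ker a t s * h s| <= ker a t s * `|h s| by rewrite normrM gtr0_norm ?ker_gt0.
rewrite ler_norml -rintN//; apply/andP; split; apply: le_rint => //; try exact: intgN; try exact: ik.
  by move=> s; have := b s; rewrite ler_norml => /andP[].
by move=> s; have := b s; rewrite ler_norml => /andP[].
Qed.

End deriv.

End convolution.

Section cutoff4.
Variable R : realType.

Lemma cutP4 : exists (c1 c2 c3 c4 : nat -> R -> R) (M : R), [/\ 0 <= M,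
  forall n, test1 (cut n : R -> R),
  [/\ forall n (t : R), is_derive t 1 (cut n) (c1 n t),
  forall n (t : R), is_derive t 1 (c1 n) (c2 n t),
  forall n (t : R), is_derive t 1 (c2 n) (c3 n t) &
  forall n (t : R), is_derive t 1 (c3 n) (c4 n t)],
  [/\ forall n t, `|c1 n t| <= n.+1%:R^-1 * M, forall n t, `|c2 n t| <= n.+1%:R^-1 * M,
   forall n t, `|c3 n t| <= n.+1%:R^-1 * M & forall n t, `|c4 n t| <= n.+1%:R^-1 * M] &
   (forall n t, `|cut n t| <= M) /\ forall t, cut n t @[n --> \oo] --> (1 : R)].
Proof.
have [d1 td1 D1] := test1_derive (test1_cut0 R).
have [d2 td2 D2] := test1_derive td1.
have [d3 td3 D3] := test1_derive td2.
have [d4 td4 D4] := test1_derive td3.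
have [M1 M10 hM1] := test1_bounded td1.
have [M2 M20 hM2] := test1_bounded td2.
have [M3 M30 hM3] := test1_bounded td3.
have [M4 M40 hM4] := test1_bounded td4.
have [_ [_ [M0 [M00 tc _ _ [hM0 _ _ lc]]]]] := cutP R.
pose e n : R := n.+1%:R^-1.
have e0 n : 0 < e n by rewrite invr_gt0.
have e1 n : e n <= 1 by rewrite invf_le1 ?ler1n.
have De n (t : R) : is_derive t 1 (fun t => e n * t) (e n).
  by apply: der_eq (derZ (e n) (derI t)) _; rewrite mulr1.
have eM n x m : `|x| <= m -> `|e n * x| <= m.
  move=> xm; rewrite normrM (gtr0_norm (e0 n)); apply: le_trans xm.
  by rewrite -[leRHS]mul1r ler_wpM2r.
have eM1 n x m : `|x| <= m -> m <= M0 + M1 + M2 + M3 + M4 -> `|e n * x| <= e n * (M0 + M1 + M2 + M3 + M4).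
  by move=> xm mm; rewrite normrM (gtr0_norm (e0 n)) ler_wpM2l ?(ltW (e0 n))//; exact: le_trans mm.
exists (fun n t => e n * d1 (e n * t)), (fun n t => e n * (e n * d2 (e n * t))),
  (fun n t => e n * (e n * (e n * d3 (e n * t)))),
  (fun n t => e n * (e n * (e n * (e n * d4 (e n * t))))), (M0 + M1 + M2 + M3 + M4).
split=> //.
- by rewrite !addr_ge0.
- split.
  + by move=> n t; rewrite mulrC; exact: der_comp (D1 _) (De n t).
  + by move=> n t; apply: derZ; rewrite mulrC; exact: der_comp (D2 _) (De n t).
  + by move=> n t; do 2 apply: derZ; rewrite mulrC; exact: der_comp (D3 _) (De n t).
  + by move=> n t; do 3 apply: derZ; rewrite mulrC; exact: der_comp (D4 _) (De n t).
- split=> n t.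
  + by apply: (eM1 _ _ M1) => //; lra.
  + by apply: (eM1 _ _ M2); [exact: eM|lra].
  + by apply: (eM1 _ _ M3); [do 2 apply: (eM n)|lra].
  + by apply: (eM1 _ _ M4); [do 3 apply: (eM n)|lra].
split=> // n t; apply: le_trans (hM0 n t) _; lra.
Qed.

End cutoff4.

(** * Decay, continuity and symmetry of the potentials *)

Section green_operator.
Variable R : realType.
Notation leb := (@lebesgue_measure R).

(** The combinations of [E], [D] and a smooth function are closed under differentiation, so they
    witness [smooth1 E]. *)
Lemma smooth1_sys (a : R) (E D h : R -> R) : (forall t : R, is_derive t 1 E (a * D t)) ->
  (forall t : R, is_derive t 1 D (a * E t - 2 * h t)) -> smooth1 h -> smooth1 E.
Proof.
move=> dE dD sh.
exists [set f | exists al be g, smooth1 g /\ f = fun t => al * E t + be * D t + g t]; split.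
  exists 1, 0, (fun=> 0); split; first exact: smooth1_cst.
  by apply/funext => t; rewrite mul1r mul0r !addr0.
move=> _ [al [be [g [sg ->]]]]; have [g' sg' dg] := smooth1_derive sg.
exists (fun t => (be * a) * E t + (al * a) * D t + (- (2 * be) * h t + g' t)).
  exists (be * a), (al * a), (fun t => - (2 * be) * h t + g' t); split=> //.
  by apply: smooth1D => //; exact: smooth1Z.
move=> x; apply: der_eq (derD (derD (derZ al (dE x)) (derZ be (dD x))) (dg x)) _.
by ring.
Qed.

Lemma test1_decay (f : R -> R) (a : R) : test1 f -> 0 <= a ->
  exists2 C, 0 <= C & forall t, `|f t| <= C * ker a 0 t.
Proof.
move=> tf a0; have [M M0 hM] := test1_bounded tf; have [_ [r hr]] := tf.
exists (M * expR (a * `|r|)); first by rewrite mulr_ge0 ?expR_ge0.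
move=> t; have [tr|tr] := leP `|t| r; last first.
  by rewrite (hr _ tr) normr0 !mulr_ge0 ?expR_ge0.
apply: (@le_trans _ _ (M * 1)); first by rewrite mulr1.
rewrite -mulrA ler_wpM2l// /ker -expRD -expR0 ler_expR sub0r normrN.
by have := ler_norm r; nra.
Qed.

Lemma intg_ker1 (a : R) : 0 < a -> intg leb (ker a 0).
Proof.
by move=> /intg_exp_abs; congr intg; apply/funext => t; rewrite /ker sub0r normrN.
Qed.

Lemma kerD (a b t : R) : ker a 0 t * ker b 0 t = ker (a + b) 0 t.
Proof. by rewrite /ker -expRD; congr expR; ring. Qed.

Lemma ker_le (a b t s : R) : a <= b -> ker b t s <= ker a t s.
Proof. by move=> ab; rewrite ler_expR lerN2 ler_wpM2r. Qed.

Lemma intg_test1 (f : R -> R) : test1 f -> intg leb f.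
Proof.
move=> tf; have [C C0 hC] := test1_decay tf ler01.
apply: intg_le (intgZ C (intg_ker1 ltr01)) => //.
by apply: continuous_measurable_fun; exact: smooth1_continuous tf.1.
Qed.

Lemma intg_ker_test1 (f : R -> R) (a : R) : 0 <= a -> test1 f -> intg leb (fun s => ker a 0 s * f s).
Proof.
move=> a0 tf; apply: intg_le (intg_norm (intg_test1 tf)).
  apply: measurable_funM; first exact: measurable_ker.
  by apply: continuous_measurable_fun; exact: smooth1_continuous tf.1.
move=> s; rewrite normrM (gtr0_norm (ker_gt0 _ _ _)) -[leRHS]mul1r ler_wpM2r//.
exact: ker_le1.
Qed.

Lemma Ecv_decay (f : R -> R) (a : R) : 0 <= a -> test1 f ->
  exists2 C, 0 <= C & forall t, Ecv a (fun s => `|f s|) t <= C * ker a 0 t.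
Proof.
(* Decay of [f] at the rate [a + 1] leaves [e^(-|s|)] after multiplication by [e^(a |s|)]. *)
move=> a0 tf; have a1 : 0 <= a + 1 by lra.
have [C C0 hC] := test1_decay tf a1.
have mf : measurable_fun setT f by apply: continuous_measurable_fun; exact: smooth1_continuous tf.1.
have ie : intg leb (fun s => expR (a * `|s|) * `|f s|).
  apply: intg_le (intgZ C (intg_ker1 ltr01)).
    apply: measurable_funM; last exact: measurableT_comp.
    apply: (measurableT_comp (@measurable_expR R)).
    by apply: measurable_funM => //.
  move=> t; rewrite ger0_norm ?mulr_ge0 ?expR_ge0//.
  apply: (@le_trans _ _ (expR (a * `|t|) * (C * ker (a + 1) 0 t))).
    by rewrite ler_wpM2l ?expR_ge0.
  have e : expR (a * `|t|) * ker a 0 t = 1 by rewrite /ker sub0r normrN -expRD subrr expR0.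
  by rewrite mulrCA ler_wpM2l// -kerD mulrA e mul1r.
exists (rint leb (fun s => expR (a * `|s|) * `|f s|)).
  by apply: rint_ge0 => s; rewrite mulr_ge0 ?expR_ge0.
move=> t; rewrite mulrC -rintZ//; apply: le_rint.
- have := intg_norm (intg_ker t a0 mf (intg_ker_test1 a0 tf)); congr intg.
  by apply/funext => s; rewrite normrM gtr0_norm ?ker_gt0.
- exact: intgZ.
move=> s; rewrite mulrA ler_wpM2r// /ker -expRD ler_expR sub0r normrN.
have := ler_normD (t - s) s; rewrite subrK; nra.
Qed.

Lemma Ecv_ge0 (h : R -> R) (a t : R) : (forall s, 0 <= h s) -> 0 <= Ecv a h t.
Proof. by move=> h0; apply: rint_ge0 => s; rewrite mulr_ge0 ?(ltW (ker_gt0 _ _ _)). Qed.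

Section nonneg.
Variables (a : R) (f : R -> R).
Hypotheses (a0 : 0 < a) (f0 : forall s, 0 <= f s) (mf : measurable_fun setT f)
  (iff : intg leb (fun s => ker a 0 s * f s)).

Let ik t := intg_ker t (ltW a0) mf iff.

(** The triangle inequality for the kernel. Used in both directions it squeezes [Ecv a f] near each
    point, so that even a merely measurable [f] has a continuous potential. *)
Lemma Ecv_harnack t t' : Ecv a f t <= expR (a * `|t - t'|) * Ecv a f t'.
Proof.
rewrite -rintZ; last exact: ik.
apply: le_rint; [exact: ik|by apply: intgZ; exact: ik|] => s.
by rewrite mulrA ler_wpM2r//; apply: ker_triangle; exact: ltW.
Qed.

Lemma continuous_Ecv : continuous (Ecv a f).
Proof.
move=> t.
have c (s : R) : {for t, continuous (fun x : R => expR (s * `|x - t|) * Ecv a f t)}.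
  apply: cvgM; last exact: cvg_cst.
  apply: (@continuous_comp _ _ _ (fun x : R => s * `|x - t|) expR); last exact: continuous_expR.
  apply: cvgM; first exact: cvg_cst.
  by apply: cvg_norm; apply: cvgB; [exact: cvg_id|exact: cvg_cst].
have l (s : R) : expR (s * `|x - t|) * Ecv a f t @[x --> t] --> Ecv a f t.
  have e : expR (s * `|t - t|) * Ecv a f t = Ecv a f t by rewrite subrr normr0 mulr0 expR0 mul1r.
  by rewrite -[X in _ --> X]e; exact: c.
apply: (@squeeze_cvgr _ _ _ _ (fun x : R => expR (- a * `|x - t|) * Ecv a f t)
  (fun x : R => expR (a * `|x - t|) * Ecv a f t)); [|exact: l|exact: l].
near=> x; rewrite Ecv_harnack andbT.
rewrite -(@ler_pM2l _ (expR (a * `|x - t|))) ?expR_gt0// mulrA -expRD mulNr subrr expR0 mul1r.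
by rewrite distrC Ecv_harnack.
Unshelve. all: by end_near. Qed.

Lemma measurable_Ecv : measurable_fun setT (Ecv a f).
Proof. by apply: continuous_measurable_fun; exact: continuous_Ecv. Qed.

Lemma intg_Ecv_test (chi : R -> R) : test1 chi -> intg leb (fun s => chi s * Ecv a f s).
Proof.
move=> tc; have [C C0 hC] := test1_decay tc (addr_ge0 (ltW a0) ler01).
have mc : measurable_fun setT chi by apply: continuous_measurable_fun; exact: smooth1_continuous tc.1.
apply: intg_le (intgZ (C * Ecv a f 0) (intg_ker1 ltr01)).
  by apply: measurable_funM => //; exact: measurable_Ecv.
move=> s; have E0 := Ecv_ge0 a 0 f0; have Es := Ecv_ge0 a s f0.
rewrite normrM (ger0_norm Es).
apply: (@le_trans _ _ (C * ker (a + 1) 0 s * (expR (a * `|s - 0|) * Ecv a f 0))).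
  by apply: ler_pM => //; exact: Ecv_harnack.
rewrite -kerD /ker sub0r normrN subr0.
have e : expR (- (a * `|s|)) * expR (a * `|s|) = 1 by rewrite -expRD addNr expR0.
have -> : C * (expR (- (a * `|s|)) * expR (- (1 * `|s|))) * (expR (a * `|s|) * Ecv a f 0) =
  C * Ecv a f 0 * expR (- (1 * `|s|)) * (expR (- (a * `|s|)) * expR (a * `|s|)) by ring.
by rewrite e mulr1.
Qed.

(** The kernel is symmetric. Absolute integrability is checked with the inner integral over [t],
    which equals [|chi s * Ecv a f s|] because [f >= 0]. *)
Lemma fubini_Ecv (chi : R -> R) : test1 chi ->
  rint leb (fun t => f t * Ecv a chi t) = rint leb (fun s => chi s * Ecv a f s).
Proof.
move=> tc.
have mc : measurable_fun setT chi by apply: continuous_measurable_fun; exact: smooth1_continuous tc.1.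
pose F (z : R * R) := (f z.1 * (ker a z.1 z.2 * chi z.2))%:E.
have mF : measurable_fun setT (F : measurableTypeR R * measurableTypeR R -> \bar R).
  apply/measurable_EFinP; apply: measurable_funM.
    exact: (measurableT_comp mf measurable_fst).
  apply: measurable_funM; last exact: (measurableT_comp mc measurable_snd).
  apply: (measurableT_comp (@measurable_expR R)); apply: measurableT_comp => //.
  apply: measurable_funM => //; apply: measurableT_comp => //.
  by apply: measurable_funB; [exact: measurable_fst|exact: measurable_snd].
have ikc t := intg_ker t (ltW a0) mc (intg_ker_test1 (ltW a0) tc).
have in2 s : intg leb (fun t => f t * (ker a t s * chi s)).
  have := intgZ (chi s) (ik s); congr intg; apply/funext => t; rewrite kerC; ring.
have iF : (leb \x leb)%E.-integrable setT F.
  apply/(integrable21ltyP leb leb mF).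
  have e s : (\int[leb]_t `|F (t, s)| = (`|chi s * Ecv a f s|)%:E)%E.
    transitivity (\int[leb]_t (`|chi s| * (ker a s t * f t))%:E)%E.
      apply: eq_integral => t _; rewrite /F /= !normrM (ger0_norm (f0 t)) (gtr0_norm (ker_gt0 _ _ _)).
      by rewrite kerC; congr EFin; ring.
    rewrite rintE; last by apply: intgZ; exact: ik.
    by rewrite rintZ ?ik// normrM [in RHS](ger0_norm (Ecv_ge0 a s f0)).
  under eq_integral do rewrite e.
  exact: (intg_lty (intg_Ecv_test tc)).
have := Fubini iF.
rewrite /F /= => H; rewrite /rint; congr fine.
transitivity (\int[leb]_x \int[leb]_y (f x * (ker a x y * chi y))%:E)%E.
  apply: eq_integral => t _; rewrite rintE; last by apply: intgZ; exact: ikc.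
  by rewrite rintZ ?ikc.
rewrite H; apply: eq_integral => s _; rewrite rintE; last exact: in2.
congr EFin; rewrite -rintZ ?ik//; apply: eq_rint => t; rewrite kerC; ring.
Qed.

End nonneg.

End green_operator.

Section green4.
Variables (R : realType) (a b : R).
Hypotheses (a0 : 0 < a) (ab : a < b).
Notation leb := (@lebesgue_measure R).
Implicit Types h : R -> R.

Let b0 : 0 < b. Proof. exact: lt_trans ab. Qed.

(* [G0] inverts [(D^2 - a^2) (D^2 - b^2)], by partial fractions; [G1], ..., [G4] are
   its derivatives. *)
Definition cab : R := (2 * (b ^+ 2 - a ^+ 2))^-1.
Definition G0 h t := cab * (a^-1 * Ecv a h t - b^-1 * Ecv b h t).
Definition G1 h t := cab * (1 * Dcv a h t - 1 * Dcv b h t).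
Definition G2 h t := cab * (a * Ecv a h t - b * Ecv b h t).
Definition G3 h t := cab * (a ^+ 2 * Dcv a h t - b ^+ 2 * Dcv b h t).
Definition G4 h t := cab * (a ^+ 3 * Ecv a h t - b ^+ 3 * Ecv b h t) + h t.

Lemma cab_gt0 : 0 < cab.
Proof.
have := a0; have := ab => ? ?; rewrite /cab invr_gt0 mulr_gt0//; nra.
Qed.

Lemma cabE : cab * (2 * (b ^+ 2 - a ^+ 2)) = 1.
Proof. by rewrite mulVf// -invr_eq0 gt_eqF// cab_gt0. Qed.

Let an : a != 0. Proof. by rewrite gt_eqF. Qed.
Let bn : b != 0. Proof. by rewrite gt_eqF. Qed.

Lemma green_ode h t : G4 h t - (a ^+ 2 + b ^+ 2) * G2 h t + a ^+ 2 * b ^+ 2 * G0 h t = h t.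
Proof. by rewrite /G4 /G2 /G0; field; rewrite an bn. Qed.

Section deriv4.
Variable h : R -> R.
Hypotheses (ch : continuous h) (iha : intg leb (fun s => ker a 0 s * h s))
  (ihb : intg leb (fun s => ker b 0 s * h s)).

Let dEa t := is_derive_Ecv a0 ch iha t.
Let dEb t := is_derive_Ecv b0 ch ihb t.
Let dDa t := is_derive_Dcv a0 ch iha t.
Let dDb t := is_derive_Dcv b0 ch ihb t.

Lemma dG0 (t : R) : is_derive t 1 (G0 h) (G1 h t).
Proof.
apply: der_eq (derZ cab (derB (derZ a^-1 (dEa t)) (derZ b^-1 (dEb t)))) _.
by rewrite /G1; field; rewrite an bn.
Qed.

Lemma dG1 (t : R) : is_derive t 1 (G1 h) (G2 h t).
Proof.
apply: der_eq (derZ cab (derB (derZ 1 (dDa t)) (derZ 1 (dDb t)))) _.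
by rewrite /G2; ring.
Qed.

Lemma dG2 (t : R) : is_derive t 1 (G2 h) (G3 h t).
Proof.
apply: der_eq (derZ cab (derB (derZ a (dEa t)) (derZ b (dEb t)))) _.
by rewrite /G3; ring.
Qed.

Lemma dG3 (t : R) : is_derive t 1 (G3 h) (G4 h t).
Proof.
apply: der_eq (derZ cab (derB (derZ (a ^+ 2) (dDa t)) (derZ (b ^+ 2) (dDb t)))) _.
transitivity (cab * (a ^+ 3 * Ecv a h t - b ^+ 3 * Ecv b h t) +
  cab * (2 * (b ^+ 2 - a ^+ 2)) * h t); first by ring.
by rewrite cabE mul1r.
Qed.

Lemma smooth1_G0 : smooth1 h -> smooth1 (G0 h).
Proof.
move=> sh; apply: smooth1Z; apply: smooth1B; apply: smooth1Z.
- exact: (smooth1_sys dEa dDa sh).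
- exact: (smooth1_sys dEb dDb sh).
Qed.

(** The common shape of [G0], [G1], [G2] and [G3]; this is why [G1] is written with coefficients
    1. *)
Lemma lin_bound (c al be m X Y X' Y' : R) : 0 <= c -> 0 <= al -> 0 <= be -> al <= m -> be <= m ->
  `|X| <= X' -> `|Y| <= Y' -> `|c * (al * X - be * Y)| <= c * m * (X' + Y').
Proof.
move=> c0 al0 be0 alm bem hX hY; rewrite normrM (ger0_norm c0) -mulrA ler_wpM2l//.
apply: le_trans (ler_normB _ _) _; rewrite !normrM (ger0_norm al0) (ger0_norm be0) mulrDr.
by apply: lerD; apply: ler_pM.
Qed.

Lemma G_bound t : let S := Ecv a (fun s => `|h s|) t + Ecv b (fun s => `|h s|) t in
  let m := a^-1 + b^-1 + 1 + a + b + a ^+ 2 + b ^+ 2 in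
  [/\ `|G0 h t| <= cab * m * S, `|G1 h t| <= cab * m * S, `|G2 h t| <= cab * m * S &
      `|G3 h t| <= cab * m * S].
Proof.
have c0 := ltW cab_gt0; have a1 : 0 < a^-1 by rewrite invr_gt0.
have b1 : 0 < b^-1 by rewrite invr_gt0.
have a2 := sqr_ge0 a; have b2 := sqr_ge0 b; have := a0; have := b0 => ? ?.
by split; apply: lin_bound => //; try lra;
  do ?[exact: Ecv_le|exact: Dcv_le].
Qed.

End deriv4.

(** As [a < b], the kernel [e^(-a |r|) / a - e^(-b |r|) / b] is positive. If the integral of a
    positive function vanished, the whole line would be a null set. *)
Lemma G0_gt0 h t : (forall s, 0 < h s) -> measurable_fun setT h ->
  intg leb (fun s => ker a 0 s * h s) -> intg leb (fun s => ker b 0 s * h s) -> 0 < G0 h t.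
Proof.
move=> h0 mh iha ihb.
have ia := intg_ker t (ltW a0) mh iha; have ib := intg_ker t (ltW b0) mh ihb.
rewrite mulr_gt0 ?cab_gt0// /Ecv -!rintZ// -rintB; [|exact: intgZ|exact: intgZ].
set f := fun s : R => _.
have f0 s : 0 < f s.
  rewrite /f !mulrA -mulrBl mulr_gt0// subr_gt0.
  apply: (@lt_le_trans _ _ (a^-1 * ker b t s)).
    by rewrite ltr_pM2r ?ker_gt0// ltf_pV2.
  by rewrite ler_pM2l ?invr_gt0//; apply: ker_le; exact: ltW.
have i_f : intg leb f by apply: intgB; exact: intgZ.
rewrite lt_neqAle; apply/andP; split; last by apply: rint_ge0 => s; exact: ltW.
apply/eqP => e.
have mf := intg_meas i_f.
have e0 : (\int[leb]_(x in setT) `|(f x)%:E| = 0)%E.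
  transitivity (\int[leb]_x (f x)%:E)%E; last by rewrite rintE// -e.
  by apply: eq_integral => s _; rewrite gee0_abs// lee_fin ltW.
have mfE : measurable_fun setT (fun x => (f x)%:E) by exact/measurable_EFinP.
have [N [mN N0 sN]] := (ae_eq_integral_abs leb measurableT mfE).1 e0.
have NT : N = setT.
  apply/seteqP; split=> // s _; apply: sN => /= /(_ I) [fs0].
  by have := f0 s; rewrite fs0 ltxx.
have : (leb `[0%R, 1%R] <= leb N)%E by apply: le_measure; rewrite ?inE ?NT.
by rewrite N0 lebesgue_measure_itv /= lte_fin ltr01 -EFinB subr0 lee_fin ler10.
Qed.

End green4.

Section regularity.
Variables (R : realType) (a b p : R) (w : R -> R).
Notation leb := (@lebesgue_measure R).
Hypotheses (a0 : 0 < a) (ab : a < b) (p1 : 1 < p).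
Hypotheses (mw : measurable_fun setT w) (w0 : forall t, 0 < w t).
Hypotheses (iw2 : intg leb (fun t => w t ^+ 2)) (iwp : intg leb (fun t => w t `^ p * w t)).
Hypothesis weak : forall x0 x1 x2 x3 x4 : R -> R, test1 x0 ->
  (forall t : R, is_derive t 1 x0 (x1 t)) -> (forall t : R, is_derive t 1 x1 (x2 t)) ->
  (forall t : R, is_derive t 1 x2 (x3 t)) -> (forall t : R, is_derive t 1 x3 (x4 t)) ->
  rint leb (fun t => w t * (x4 t - (a ^+ 2 + b ^+ 2) * x2 t + a ^+ 2 * b ^+ 2 * x0 t)) =
  rint leb (fun t => w t `^ p * x0 t).

Let b0 : 0 < b. Proof. exact: lt_trans ab. Qed.
Let f t := w t `^ p.
Let g t := w t ^+ 2 + w t `^ p * w t.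

Let f0 t : 0 < f t. Proof. exact: powR_gt0. Qed.
Let f0' t : 0 <= f t. Proof. exact: ltW. Qed.
Let g0 t : 0 <= g t.
Proof. by apply: addr_ge0; [exact: sqr_ge0|apply: mulr_ge0; [exact: powR_ge0|exact: ltW]]. Qed.
Let mf : measurable_fun setT f. Proof. exact: (measurableT_comp (measurable_powR _)). Qed.
Let ig : intg leb g. Proof. exact: intgD. Qed.

(** From [w^p <= w + w^p w] and [w <= e + w^2 / e]. Thus [w^p], which is not known to be integrable,
    is at most an arbitrarily small constant plus an integrable function. *)
Let f_le e t : 0 < e -> f t <= e + (1 + e^-1) * g t.
Proof.
move=> e0; have wt := w0 t; have ft := f0 t; have ei : 0 < e^-1 by rewrite invr_gt0.
have h1 : f t <= w t + f t * w t.
  have [w1|w1] := leP (w t) 1.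
    apply: (@le_trans _ _ (w t)); last by rewrite lerDl mulr_ge0 ?ltW.
    rewrite -[leRHS](powRr1 (ltW wt)); apply: ger_powR => //; last exact: ltW.
    by rewrite wt w1.
  by have : 0 <= f t * (w t - 1) by [apply: mulr_ge0; [exact: ltW|lra]]; lra.
have h2 : w t <= e + e^-1 * w t ^+ 2.
  have [we|we] := leP (w t) e; first by rewrite (le_trans we)// lerDl mulr_ge0 ?sqr_ge0 ?(ltW ei).
  apply: (@le_trans _ _ (e^-1 * w t ^+ 2)); last by rewrite lerDr ltW.
  by rewrite ler_pdivlMl// expr2 ler_pM2r// ltW.
have w2 := sqr_ge0 (w t); have fw : 0 <= f t * w t by rewrite mulr_ge0 ?ltW.
have : 0 <= e^-1 * (f t * w t) by rewrite mulr_ge0 ?(ltW ei).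
rewrite /g -/(f t); lra.
Qed.

Let ikf c : 0 < c -> intg leb (fun s => ker c 0 s * f s).
Proof.
move=> c0; apply: intg_le (intgD (intg_ker1 c0) (intgZ (1 + 1^-1) ig)).
  by apply: measurable_funM => //; exact: measurable_ker.
move=> s; have k0 := ker_gt0 c 0 s; have k1 : ker c 0 s <= 1 by apply: ker_le1; exact: ltW.
rewrite ger0_norm; last by rewrite mulr_ge0 ?f0'// ltW.
apply: (@le_trans _ _ (ker c 0 s * (1 + (1 + 1^-1) * g s))).
  by rewrite ler_pM2l//; exact: f_le.
rewrite mulrDr mulr1 lerD2l -[leRHS]mul1r ler_wpM2r//.
by apply: mulr_ge0 => //; apply: addr_ge0 => //; rewrite invr1.
Qed.

(** In the splitting [f_le] the constant contributes [e K], with [K] the integral of the kernel; on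
    the integrable part the kernel centred at [n] tends to 0, and dominated convergence applies. *)
Lemma Ecv_cvg0 c : 0 < c -> Ecv c f n%:R @[n --> \oo] --> (0 : R).
Proof.
move=> c0.
have k1 n s : ker c n s <= 1 by apply: ker_le1; exact: ltW.
have mg := intg_meas ig.
have mkg n : measurable_fun setT (fun s => ker c n%:R s * g s).
  by apply: measurable_funM => //; exact: measurable_ker.
have bg (n : nat) s : `|ker c n%:R s * g s| <= g s.
  rewrite ger0_norm ?mulr_ge0 ?(ltW (ker_gt0 _ _ _))//.
  by rewrite -[leRHS]mul1r; apply: ler_wpM2r; [exact: g0|exact: k1].
have cg s : ker c n%:R s * g s @[n --> \oo] --> (0 : R).
  rewrite -(mul0r (g s)); apply: cvgM; last exact: cvg_cst.
  apply/cvgrPdist_lt => e e0; near=> n.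
  rewrite sub0r normrN gtr0_norm ?ker_gt0// /ker.
  apply: (@le_lt_trans _ _ (expR (- (c * (n%:R - s))))).
    by rewrite ler_expR lerN2 ler_wpM2l ?(ltW c0)// ler_norm.
  rewrite -ltr_ln ?posrE ?expR_gt0// expRK ltrNl mulrC -ltr_pdivrMr// ltrBrDr.
  near: n; exact: nbhs_infty_gtr.
have mc (x : R) : measurable_fun setT (fun _ : R => x) by exact: measurable_cst.
have [_ L] := @dct _ _ _ leb (fun n s => ker c n%:R s * g s) (fun=> 0) g mkg (mc 0) cg ig bg.
have r0 : rint leb (fun=> 0 : R) = 0 by rewrite /rint integral0.
rewrite r0 in L.
have ik1 (t : R) : intg leb (ker c t).
  have := intg_ker t (ltW c0) (mc 1).
  by rewrite (_ : (fun s => ker c 0 s * _) = ker c 0); [move=> /(_ (intg_ker1 c0));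
    congr intg; apply/funext => s; rewrite mulr1|apply/funext => s; rewrite mulr1].
pose K := rint leb (ker c 0).
have KE t : rint leb (ker c t) = K.
  rewrite /K /rint (ge0_integral_affine (l := 1) t)//; last 2 first.
  - by move=> s; rewrite lee_fin ltW// ker_gt0.
  - by apply/measurable_EFinP; exact: measurable_ker.
  rewrite mul1e; congr fine; apply: eq_integral => s _; congr EFin.
  rewrite /ker; congr (expR (- (_ * `|_|))); ring.
have K0 : 0 <= K by apply: rint_ge0 => s; exact: ltW (ker_gt0 _ _ _).
have bd e (n : nat) : 0 < e -> Ecv c f n%:R <= e * K + (1 + e^-1) * rint leb (fun s => ker c n%:R s * g s).
  move=> e0; have i2 : intg leb (fun s => ker c n%:R s * g s) by apply: intg_le ig; [exact: mkg|exact: bg].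
  rewrite -(KE n%:R) -(rintZ e (ik1 n%:R)) -(rintZ (1 + e^-1) i2).
  rewrite -rintD; [|exact: intgZ|exact: intgZ]; apply: le_rint.
  - by apply: (intg_ker _ (ltW c0)) => //; exact: ikf.
  - by apply: intgD; exact: intgZ.
  move=> s; have := f_le s e0; have := ker_gt0 c n%:R s; nra.
apply/cvgrPdist_le => d d0.
pose e := d / (2 * (K + 1)).
have e0 : 0 < e by rewrite divr_gt0// mulr_gt0// ltr_wpDl.
have eK : e * K <= d / 2.
  have -> : d / 2 = e * (K + 1) by rewrite /e; field; apply/eqP; lra.
  by rewrite ler_pM2l// lerDl.
have C0 : 0 < 1 + e^-1 by rewrite addr_gt0 ?invr_gt0.
have d2 : 0 < d / 2 / (1 + e^-1) by rewrite !divr_gt0.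
move/cvgrPdist_le : L => /(_ _ d2) L; near=> n.
rewrite sub0r normrN ger0_norm; last exact: Ecv_ge0.
apply: le_trans (bd e n e0) _; rewrite [leRHS]splitr lerD//.
rewrite mulrC -ler_pdivlMr//.
have : `|0 - rint leb (fun s => ker c n%:R s * g s)| <= d / 2 / (1 + e^-1) by near: n.
by apply: le_trans; rewrite sub0r normrN ler_norm.
Unshelve. all: by end_near. Qed.

Let mtest chi : test1 chi -> measurable_fun setT (chi : R -> R).
Proof. by move=> tc; apply: continuous_measurable_fun; exact: smooth1_continuous tc.1. Qed.

Let ikw : intg leb (fun s => w s * ker a 0 s).
Proof.
apply: intg_sq => //; first exact: measurable_ker.
have a2 : 0 < a + a by rewrite addr_gt0.
have := intg_ker1 a2; congr intg; apply/funext => s.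
by rewrite -kerD expr2.
Qed.

(* The test functions are cutoffs of the Green potential of [chi]. *)
Lemma weak_green (chi : R -> R) : test1 chi ->
  rint leb (fun t => w t * chi t) = rint leb (fun t => f t * G0 a b chi t).
Proof.
move=> tc; have cc := smooth1_continuous tc.1.
have ia := intg_ker_test1 (ltW a0) tc; have ib := intg_ker_test1 (ltW b0) tc.
pose psi0 := G0 a b chi; pose psi1 := G1 a b chi; pose psi2 := G2 a b chi.
pose psi3 := G3 a b chi; pose psi4 := G4 a b chi.
have d0 (t : R) : is_derive t 1 psi0 (psi1 t) := dG0 a0 ab cc ia ib t.
have d1 (t : R) : is_derive t 1 psi1 (psi2 t) := dG1 a0 ab cc ia ib t.
have d2 (t : R) : is_derive t 1 psi2 (psi3 t) := dG2 a0 ab cc ia ib t.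
have d3 (t : R) : is_derive t 1 psi3 (psi4 t) := dG3 a0 ab cc ia ib t.
have [C C0 [hp0 hp1 hp2 hp3]] : exists2 C, 0 <= C & [/\ forall t, `|psi0 t| <= C * ker a 0 t,
    forall t, `|psi1 t| <= C * ker a 0 t, forall t, `|psi2 t| <= C * ker a 0 t &
    forall t, `|psi3 t| <= C * ker a 0 t].
  have [Ca Ca0 hCa] := Ecv_decay (ltW a0) tc; have [Cb Cb0 hCb] := Ecv_decay (ltW b0) tc.
  set m := cab a b * (a^-1 + b^-1 + 1 + a + b + a ^+ 2 + b ^+ 2).
  have m0 : 0 <= m.
    apply: mulr_ge0; first exact: ltW (cab_gt0 a0 ab).
    have ai : 0 < a^-1 by rewrite invr_gt0.
    have bi : 0 < b^-1 by rewrite invr_gt0.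
    have := sqr_ge0 a; have := sqr_ge0 b; have := a0; have := b0; lra.
  have S t : m * (Ecv a (fun s => `|chi s|) t + Ecv b (fun s => `|chi s|) t) <= m * (Ca + Cb) * ker a 0 t.
    rewrite -mulrA ler_wpM2l// mulrDl lerD// (le_trans (hCb t))// ler_wpM2l//.
    by apply: ker_le; exact: ltW.
  exists (m * (Ca + Cb)); first by rewrite mulr_ge0// addr_ge0.
  by split=> t; apply: le_trans (S t); have [] := G_bound a0 ab cc ia ib t.
have [c1 [c2 [c3 [c4 [M [M0 tcut [e0 e1 e2 e3] [bc1 bc2 bc3 bc4] [bc lc]]]]]]] := cutP4 R.
pose X0 n t := cut n t * psi0 t.
pose X1 n t := c1 n t * psi0 t + cut n t * psi1 t.
pose X2 n t := c2 n t * psi0 t + 2 * c1 n t * psi1 t + cut n t * psi2 t.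
pose X3 n t := c3 n t * psi0 t + 3 * c2 n t * psi1 t + 3 * c1 n t * psi2 t + cut n t * psi3 t.
pose X4 n t := c4 n t * psi0 t + 4 * c3 n t * psi1 t + 6 * c2 n t * psi2 t + 4 * c1 n t * psi3 t + cut n t * psi4 t.
have dX0 n (t : R) : is_derive t 1 (X0 n) (X1 n t) := derM (e0 n t) (d0 t).
have dX1 n (t : R) : is_derive t 1 (X1 n) (X2 n t).
  apply: der_eq (derD (derM (e1 n t) (d0 t)) (derM (e0 n t) (d1 t))) _.
  by rewrite /X2; ring.
have dX2 n (t : R) : is_derive t 1 (X2 n) (X3 n t).
  apply: der_eq (derD (derD (derM (e2 n t) (d0 t)) (derM (derZ 2 (e1 n t)) (d1 t))) (derM (e0 n t) (d2 t))) _.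
  by rewrite /X3; ring.
have dX3 n (t : R) : is_derive t 1 (X3 n) (X4 n t).
  apply: der_eq (derD (derD (derD (derM (e3 n t) (d0 t)) (derM (derZ 3 (e2 n t)) (d1 t)))
    (derM (derZ 3 (e1 n t)) (d2 t))) (derM (e0 n t) (d3 t))) _.
  by rewrite /X4; ring.
have tX n : test1 (X0 n) by apply: test1M => //; exact: (smooth1_G0 a0 ab cc ia ib tc.1).
pose A := a ^+ 2 + b ^+ 2; pose B := a ^+ 2 * b ^+ 2.
pose Q n t := X4 n t - A * X2 n t + B * X0 n t.
(* The terms in which the cutoff is differentiated. The others add up to [cut n] times the operator
   applied to [psi0], which is [chi]. *)
pose r n t := c4 n t * psi0 t + 4 * (c3 n t * psi1 t) + 6 * (c2 n t * psi2 t) + 4 * (c1 n t * psi3 t)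
  - A * (c2 n t * psi0 t + 2 * (c1 n t * psi1 t)).
have QE n t : Q n t = cut n t * chi t + r n t.
  rewrite -(green_ode a0 ab chi t) -/psi0 -/psi2 -/psi4 -/A -/B /Q /r /X4 /X2 /X0; ring.
have A0 : 0 <= A by rewrite addr_ge0 ?sqr_ge0.
(* The terms of [r] are counted by [15 = 1 + 4 + 6 + 4] and [3 = 1 + 2]; each is at most
   [M C ker a 0 t / (n + 1)]. *)
pose K := (15 + 3 * A) * (M * C).
have K0 : 0 <= K.
  by apply: mulr_ge0; [lra|exact: mulr_ge0].
have rb n t : `|r n t| <= n.+1%:R^-1 * (K * ker a 0 t).
  pose z := n.+1%:R^-1 * (M * (C * ker a 0 t)).
  have P (c : nat -> R -> R) (psi : R -> R) : (forall n t, `|c n t| <= n.+1%:R^-1 * M) ->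
      (forall t, `|psi t| <= C * ker a 0 t) -> `|c n t * psi t| <= z.
    by move=> hc hp; rewrite normrM /z mulrA; apply: ler_pM.
  have := P _ _ bc4 hp0; have := P _ _ bc3 hp1; have := P _ _ bc2 hp2; have := P _ _ bc1 hp3.
  have := P _ _ bc2 hp0; have := P _ _ bc1 hp1.
  have -> : n.+1%:R^-1 * (K * ker a 0 t) = 15 * z + A * (3 * z) by rewrite /K /z; ring.
  rewrite /r; move: (c4 n t * _) (c3 n t * _) (c2 n t * psi2 t) (c1 n t * psi3 t) (c2 n t * psi0 t) (c1 n t * psi1 t).
  move=> x1 x2 x3 x4 x5 x6 h1 h2 h3 h4 h5 h6.
  have hA : `|A * (x5 + 2 * x6)| <= A * (3 * z).
    rewrite normrM (ger0_norm A0) ler_wpM2l//.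
    move: h1 h2; rewrite !ler_norml => /andP[? ?] /andP[? ?]; apply/andP; split; lra.
  move: hA; move: (A * (x5 + 2 * x6)) (A * (3 * z)) => y Az.
  move: h3 h4 h5 h6; rewrite !ler_norml => /andP[? ?] /andP[? ?] /andP[? ?] /andP[? ?] /andP[? ?].
  apply/andP; split; lra.
have eq n : rint leb (fun t => w t * Q n t) = rint leb (fun t => f t * X0 n t).
  exact: (weak (tX n) (dX0 n) (dX1 n) (dX2 n) (dX3 n)).
have n1 n : (n.+1%:R^-1 : R) <= 1 by rewrite invf_le1 ?ler1n.
have [C1 C10 hC1] := test1_decay tc (ltW a0).
have sX0 : smooth1 psi0 by exact: (smooth1_G0 a0 ab cc ia ib tc.1).
have mps : measurable_fun setT psi0 by apply: continuous_measurable_fun; exact: smooth1_continuous.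
have cr t : r n t @[n --> \oo] --> (0 : R).
  apply: norm_cvg0; apply: (@squeeze_cvgr _ _ _ _ (fun=> 0) (fun n => n.+1%:R^-1 * (K * ker a 0 t))).
  - by near=> n; rewrite normr_ge0 rb.
  - exact: cvg_cst.
  - by rewrite -[X in _ --> X](mul0r (K * ker a 0 t)); apply: cvgM; [exact: cvg_harmonic|exact: cvg_cst].
have [_ L1] : intg leb (fun t => w t * chi t) /\
    rint leb (fun t => w t * Q n t) @[n --> \oo] --> rint leb (fun t => w t * chi t).
  apply: (@dct _ _ _ leb (fun n t => w t * Q n t) _ (fun t => (M * C1 + K) * (w t * ker a 0 t))).
  - move=> n; apply: measurable_funM => //.
    have t1 := test1_der (tX n) (dX0 n); have t2 := test1_der t1 (dX1 n).
    have t3 := test1_der t2 (dX2 n); have t4 := test1_der t3 (dX3 n).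
    by apply: measurable_funD; [apply: measurable_funB|]; try (apply: measurable_funM => //); exact: mtest.
  - by apply: measurable_funM => //; exact: mtest.
  - move=> t; apply: cvgM; first exact: cvg_cst.
    rewrite (_ : (fun n => Q n t) = fun n => cut n t * chi t + r n t); last by apply/funext => n.
    rewrite -[X in _ --> X]addr0; apply: cvgD => //.
    by rewrite -[X in _ --> X]mul1r; apply: cvgM; [exact: lc|exact: cvg_cst].
  - exact: intgZ.
  - move=> n t; rewrite normrM (gtr0_norm (w0 t)) QE mulrCA ler_wpM2l ?(ltW (w0 t))//.
    apply: le_trans (ler_normD _ _) _; rewrite mulrDl lerD//.
      by rewrite normrM -mulrA; apply: ler_pM.
    apply: le_trans (rb n t) _; rewrite -[leRHS]mul1r ler_wpM2r//.
    by rewrite mulr_ge0// ltW// ker_gt0.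
have [_ L2] : intg leb (fun t => f t * psi0 t) /\
    rint leb (fun t => f t * X0 n t) @[n --> \oo] --> rint leb (fun t => f t * psi0 t).
  apply: (@dct _ _ _ leb (fun n t => f t * X0 n t) _ (fun t => (M * C) * (ker a 0 t * f t))).
  - by move=> n; apply: measurable_funM => //; exact: mtest.
  - exact: measurable_funM.
  - move=> t; apply: cvgM; first exact: cvg_cst.
    by rewrite -[X in _ --> X]mul1r; apply: cvgM; [exact: lc|exact: cvg_cst].
  - by apply: intgZ; exact: ikf.
  - move=> n t; rewrite normrM (gtr0_norm (f0 t)) /X0 normrM mulrC [leRHS]mulrA ler_wpM2r//.
    by rewrite -mulrA; apply: ler_pM.
by apply: (lim_eq eq L1 L2).
Unshelve. all: by end_near. Qed.

Let v t := G0 a b f t.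

Let cv : continuous v.
Proof.
have ca := continuous_Ecv a0 f0' mf (ikf a0); have cb := continuous_Ecv b0 f0' mf (ikf b0).
move=> t; apply: cvgM; first exact: cvg_cst.
by apply: cvgB; apply: cvgM; [exact: cvg_cst|exact: ca|exact: cvg_cst|exact: cb].
Qed.

Let mv : measurable_fun setT v. Proof. exact: continuous_measurable_fun. Qed.

Let v_gt0 t : 0 < v t.
Proof. by apply: G0_gt0 => //; exact: ikf. Qed.

Let loc_bound (h : R -> R) (c d K : R) : measurable_fun setT h ->
  (forall t, c < t < d -> `|h t| <= K) -> intg leb (fun t => h t * \1_(`]c, d[%classic) t).
Proof.
move=> mh hK; pose m := `|c| + `|d|.
apply: intg_le (intgZ (`|K| * expR m) (intg_ker1 ltr01)).
  by apply: measurable_funM => //; apply: measurable_indic; exact: measurable_itv.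
move=> t; rewrite indicE mem_setE in_itv /=; case: (boolP (c < t < d)) => [ct|_]; last first.
  by rewrite mulr0 normr0 !mulr_ge0 ?expR_ge0.
rewrite mulr1; apply: (@le_trans _ _ (`|K| * 1)).
  by rewrite mulr1 (le_trans (hK _ ct))// ler_norm.
rewrite -mulrA ler_wpM2l// /ker mul1r -expRD -expR0 ler_expR sub0r normrN /m.
move/andP : ct => [ct td]; have := ler_norm (- c); have := ler_norm d; rewrite normrN => ? ?.
have := normr_ge0 c; have := normr_ge0 d; rewrite subr_ge0 ler_norml => ? ?; apply/andP; split; lra.
Qed.

Let intg_test_f c chi : 0 < c -> test1 chi -> intg leb (fun t => f t * Ecv c chi t).
Proof.
move=> c0 tc; have [C C0 hC] := Ecv_decay (ltW c0) tc.
have cc := smooth1_continuous tc.1; have ic := intg_ker_test1 (ltW c0) tc.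
apply: intg_le (intgZ C (ikf c0)).
  apply: measurable_funM => //; apply: continuous_measurable_fun.
  exact: is_derive_continuous (is_derive_Ecv c0 cc ic).
move=> t; rewrite normrM (gtr0_norm (f0 t)) mulrA [leRHS]mulrC ler_wpM2l//.
by apply: le_trans (hC t); exact: Ecv_le.
Qed.

(** By [weak_green] the integral of [w chi] is that of [f] times the potential of [chi], and by
    symmetry of the kernel also that of [v chi]. *)
Lemma ae_rep : {ae leb, forall t, w t = v t}.
Proof.
have h : {ae leb, forall t, w t - v t = 0}; last by apply: ae_mp h _ => t /eqP; rewrite subr_eq0 => /eqP.
apply: dbr1; first exact: measurable_funB.
  move=> c d.
  have i1 : intg leb (fun t => w t * \1_(`]c, d[%classic) t).
    have m1 : measurable_fun setT (\1_(`]c, d[%classic) : R -> R).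
      by apply: measurable_indic; exact: measurable_itv.
    have K1 (t : R) : c < t < d -> `|1 : R| <= 1 by rewrite normr1.
    have mc1 : measurable_fun setT (fun _ : R => 1 : R) by exact: measurable_cst.
    have i0 := loc_bound mc1 K1.
    apply: intg_le (intgD i0 iw2); first exact: measurable_funM.
    move=> t; rewrite mul1r normrM (gtr0_norm (w0 t)) indicE.
    case: (_ \in _) => /=; rewrite ?normr1 ?normr0 ?mulr1 ?mulr0 ?add0r ?sqr_ge0//.
    have := sqr_ge0 (w t - 1); have := sqr_ge0 (w t); have := w0 t; nra.
  have i2 : intg leb (fun t => v t * \1_(`]c, d[%classic) t).
    apply: (loc_bound (K := cab a b * (a^-1 * (expR (a * (`|c| + `|d|)) * Ecv a f 0)))) => // t /andP[ct td].
    have E0 := Ecv_ge0 a 0 f0'; have Eb := Ecv_ge0 b t f0'.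
    rewrite gtr0_norm ?v_gt0// ler_pM2l ?(cab_gt0 a0 ab)//.
    apply: (@le_trans _ _ (a^-1 * Ecv a f t)).
      by rewrite gerDl oppr_le0 mulr_ge0// invr_ge0 ltW.
    rewrite ler_pM2l ?invr_gt0//; apply: le_trans (Ecv_harnack a0 f0' mf (ikf a0) t 0) _.
    rewrite ler_wpM2r// ler_expR ler_pM2l// subr0.
    have := ler_norm (- c); have := ler_norm d; rewrite normrN => ? ?.
    have := normr_ge0 c; have := normr_ge0 d; rewrite ler_norml => ? ?; apply/andP; split; lra.
  have := intgB i1 i2; congr intg; apply/funext => t; ring.
move=> chi tc.
have mc := mtest tc.
have iw : intg leb (fun t => w t * chi t).
  have [C C0 hC] := test1_decay tc (ltW a0).
  apply: intg_le (intgZ C ikw); first exact: measurable_funM.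
  by move=> t; rewrite normrM (gtr0_norm (w0 t)) mulrCA ler_wpM2l ?(ltW (w0 t)).
have ia := intg_Ecv_test a0 f0' mf (ikf a0) tc; have ib := intg_Ecv_test b0 f0' mf (ikf b0) tc.
have E : (fun t => v t * chi t) =
    fun t => cab a b * (a^-1 * (chi t * Ecv a f t) - b^-1 * (chi t * Ecv b f t)).
  by apply/funext => t; rewrite /v /G0; ring.
have iv : intg leb (fun t => v t * chi t).
  by rewrite E; apply: intgZ; apply: intgB; exact: intgZ.
rewrite (eq_rint leb (g := fun t => w t * chi t - v t * chi t)); last by move=> t; ring.
rewrite rintB// (weak_green tc) E.
have -> : (fun t => f t * G0 a b chi t) =
    fun t => cab a b * (a^-1 * (f t * Ecv a chi t) - b^-1 * (f t * Ecv b chi t)).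
  by apply/funext => t; rewrite /G0; ring.
have ja := intg_test_f a0 tc; have jb := intg_test_f b0 tc.
have lin (P Q : R -> R) : intg leb P -> intg leb Q ->
    rint leb (fun t => cab a b * (a^-1 * P t - b^-1 * Q t)) =
    cab a b * (a^-1 * rint leb P - b^-1 * rint leb Q).
  move=> iP iQ; have iP' := intgZ a^-1 iP; have iQ' := intgZ b^-1 iQ.
  by rewrite (rintZ _ (intgB iP' iQ')) (rintB iP' iQ') (rintZ _ iP) (rintZ _ iQ).
by rewrite (lin _ _ ja jb) (lin _ _ ia ib) (fubini_Ecv a0 f0' mf (ikf a0) tc) (fubini_Ecv b0 f0' mf (ikf b0) tc) subrr.
Qed.

(** Replacing [w] by the continuous [v] changes [f] on a null set only and leaves its potentials
    unchanged. So [v] is the potential of the continuous function [fv], hence four times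
    differentiable. *)
Let fv t := v t `^ p.

Let cfv : continuous fv.
Proof.
move=> t; rewrite (_ : fv = fun t => expR (p * ln (v t))); last first.
  by apply/funext => s; rewrite /fv /powR gt_eqF.
apply: (@continuous_comp _ _ _ (fun t => p * ln (v t)) expR); last exact: continuous_expR.
apply: cvgM; first exact: cvg_cst.
by apply: (@continuous_comp _ _ _ v (@ln R)); [exact: cv|exact: continuous_ln].
Qed.

Let mfv : measurable_fun setT fv. Proof. exact: continuous_measurable_fun. Qed.

Let ae_f : {ae leb, forall t, f t = fv t}.
Proof. by apply: ae_mp ae_rep _ => t; rewrite /f /fv => ->. Qed.

Let ikfv c : 0 < c -> intg leb (fun s => ker c 0 s * fv s).
Proof.
move=> c0; apply: ae_intg (ikf c0) _; first by apply: measurable_funM => //; exact: measurable_ker.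
by apply: ae_mp ae_f _ => t ->.
Qed.

Let Ecv_fv c : Ecv c f = Ecv c fv.
Proof.
apply/funext => t; apply: ae_rint.
- by apply: measurable_funM => //; exact: measurable_ker.
- by apply: measurable_funM => //; exact: measurable_ker.
- by apply: ae_mp ae_f _ => s ->.
Qed.

Let vE : v = G0 a b fv. Proof. by apply/funext => t; rewrite /v /G0 !Ecv_fv. Qed.

Let cvg0_bound (h : R -> R) (m : R) :
  (forall t, `|h t| <= m * (Ecv a (fun s => `|fv s|) t + Ecv b (fun s => `|fv s|) t)) ->
  h n%:R @[n --> \oo] --> (0 : R).
Proof.
move=> hm; apply: norm_cvg0.
apply: (@squeeze_cvgr _ _ _ _ (fun=> 0) (fun n => m * (Ecv a f n%:R + Ecv b f n%:R))).
- near=> n; rewrite normr_ge0 /= !Ecv_fv; apply: le_trans (hm n%:R) _.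
  rewrite (_ : (fun s => `|fv s|) = fv)//; apply/funext => s.
  by rewrite ger0_norm// powR_ge0.
- exact: cvg_cst.
- rewrite -[X in _ --> X](mulr0 m) -[X in _ * X](addr0 0); apply: cvgM; first exact: cvg_cst.
  by apply: cvgD; exact: Ecv_cvg0.
Unshelve. all: by end_near. Qed.

(** The limits are along the integers, which suffices to evaluate a conserved quantity. *)
Lemma regular_representative : exists v0 v1 v2 v3 v4 : R -> R,
  [/\ {ae leb, forall t, w t = v0 t}, forall t, 0 < v0 t, intg leb (fun t => v0 t ^+ 2),
   [/\ forall t : R, is_derive t 1 v0 (v1 t), forall t : R, is_derive t 1 v1 (v2 t),
    forall t : R, is_derive t 1 v2 (v3 t) & forall t : R, is_derive t 1 v3 (v4 t)] &
   (forall t, v4 t - (a ^+ 2 + b ^+ 2) * v2 t + a ^+ 2 * b ^+ 2 * v0 t = v0 t `^ p) /\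
   [/\ v0 n%:R @[n --> \oo] --> (0 : R), v1 n%:R @[n --> \oo] --> (0 : R),
    v2 n%:R @[n --> \oo] --> (0 : R) & v3 n%:R @[n --> \oo] --> (0 : R)]].
Proof.
exists v, (G1 a b fv), (G2 a b fv), (G3 a b fv), (G4 a b fv).
have ia := ikfv a0; have ib := ikfv b0.
split.
- exact: ae_rep.
- exact: v_gt0.
- apply: ae_intg iw2 _; first exact: measurable_funX.
  by apply: ae_mp ae_rep _ => t ->.
- split.
  + by rewrite vE; exact: (dG0 a0 ab cfv ia ib).
  + exact: (dG1 a0 ab cfv ia ib).
  + exact: (dG2 a0 ab cfv ia ib).
  + exact: (dG3 a0 ab cfv ia ib).
split; first by move=> t; have := green_ode a0 ab fv t; rewrite -vE.
have Gb t := G_bound a0 ab cfv ia ib t.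
split.
- by rewrite vE; apply: cvg0_bound => t; have [h _ _ _] := Gb t; exact: h.
- by apply: cvg0_bound => t; have [_ h _ _] := Gb t; exact: h.
- by apply: cvg0_bound => t; have [_ _ h _] := Gb t; exact: h.
- by apply: cvg0_bound => t; have [_ _ _ h] := Gb t; exact: h.
Qed.

End regularity.

(** * Comparison for the ODE *)

Section calculus.
Variable R : realType.
Notation leb := (@lebesgue_measure R).
Implicit Types f : R -> R.

Lemma mvt f f' (s t : R) : (forall x : R, is_derive x 1 f (f' x)) -> s < t ->
  exists2 c, s < c < t & f t - f s = f' c * (t - s).
Proof.
move=> df st.
have [|c] := MVT st (fun x _ => df x).
  by apply: continuous_subspaceT; exact: is_derive_continuous df.
by rewrite in_itv /= => cst e; exists c.
Qed.

Lemma mono_der f f' (s t : R) : (forall x : R, is_derive x 1 f (f' x)) -> s <= t ->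
  (forall x, s <= x <= t -> 0 <= f' x) -> f s <= f t.
Proof.
move=> df; rewrite le_eqVlt => /predU1P[->//|st] h.
have [c /andP[sc ct] e] := mvt df st.
rewrite -subr_ge0 e mulr_ge0 ?subr_ge0 ?(ltW st)//.
by apply: h; rewrite !ltW.
Qed.

Lemma mono_der_lt f f' (s t : R) : (forall x : R, is_derive x 1 f (f' x)) -> s < t ->
  (forall x, s < x < t -> 0 < f' x) -> f s < f t.
Proof.
move=> df st h; have [c sct e] := mvt df st.
by rewrite -subr_gt0 e mulr_gt0 ?subr_gt0// h.
Qed.

Lemma mono_lin f f' (s t m : R) : (forall x : R, is_derive x 1 f (f' x)) -> s <= t ->
  (forall x, s <= x <= t -> m <= f' x) -> f s + m * (t - s) <= f t.
Proof.
move=> df st h.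
have dg (x : R) : is_derive x 1 (fun y => f y - m * y) (f' x - m).
  by apply: der_eq (derB (df x) (derZ m (derI x))) _; rewrite mulr1.
have : f s - m * s <= f t - m * t by apply: (mono_der dg st) => x /h; rewrite subr_ge0.
lra.
Qed.

(** The integrating factor [e^(-C y)] makes [f] times it nonincreasing on [[s, t]]. *)
Lemma gronwall f f' (s t C : R) : (forall x : R, is_derive x 1 f (f' x)) -> s <= t ->
  f s <= 0 -> (forall x, s <= x <= t -> f' x <= C * f x) -> f t <= 0.
Proof.
move=> df st fs h.
have dg (x : R) : is_derive x 1 (fun y => - (expR (- C * y) * f y)) (expR (- C * x) * (C * f x - f' x)).
  have := derZ (-1) (derM (is_derive_expR_scale (- C) x) (df x)).
  rewrite (_ : (fun y => -1 * _) = fun y => - (expR (- C * y) * f y)); last by apply/funext => y; rewrite mulN1r.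
  by move=> hd; apply: der_eq hd _; ring.
have := mono_der dg st _ => /(_ _)/wrap[].
  by move=> x /h hx; rewrite mulr_ge0 ?expR_ge0// subr_ge0.
rewrite lerN2 => e.
have : expR (- C * t) * f t <= 0.
  by apply: le_trans e _; rewrite pmulr_rle0 ?expR_gt0.
by rewrite pmulr_rle0 ?expR_gt0.
Qed.

Definition neg (x : R) : R := Num.min x 0.

Lemma neg_le0 x : neg x <= 0. Proof. by rewrite /neg ge_min lexx orbT. Qed.
Lemma neg_le x : neg x <= x. Proof. by rewrite /neg ge_min lexx. Qed.
Lemma neg_sq_ge0 x : neg x = 0 -> 0 <= x.
Proof. by rewrite /neg; case: (leP x 0) => [h ->//|/ltW]. Qed.
Lemma ge0_neg x : 0 <= x -> neg x = 0.
Proof. by move=> x0; rewrite /neg; case: (leP x 0) => // h; apply/le_anti; rewrite h. Qed.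

(** Squaring removes the corner of [neg] at 0, so that [gronwall] applies to a differentiable
    function. *)
Lemma is_derive_neg_sq (x : R) : is_derive x 1 (fun y => neg y ^+ 2) (2 * neg x).
Proof.
have [x0|x0|->] := ltgtP x 0.
- have h : \forall y \near x, neg y ^+ 2 = y * y.
    by near=> y; rewrite /neg min_l ?expr2//; near: y; exact: le_nbhs_near.
  apply: near_is_derive h _; apply: der_eq (derM (derI x) (derI x)) _.
  by rewrite /neg min_l ?(ltW x0)//; ring.
- have h : \forall y \near x, neg y ^+ 2 = 0.
    by near=> y; rewrite ge0_neg ?expr0n//; apply/ltW; near: y; exact: gt_nbhs_near.
  by apply: near_is_derive h _; rewrite ge0_neg ?(ltW x0)// mulr0; exact: derC.
have L : h^-1 *: (neg (h *: 1 + 0) ^+ 2 - neg 0 ^+ 2) @[h --> (0 : R)^'] --> (0 : R).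
  apply: norm_cvg0.
  apply: (@squeeze_cvgr _ _ _ _ (fun=> 0) (fun h : R => `|h|)).
  - near=> h; rewrite normr_ge0 /= /GRing.scale /= mulr1 addr0 (ge0_neg (lexx 0)) expr0n subr0.
    have h0 : h != 0 by near: h; exact: nbhs_dnbhs_neq.
    have hn : `|neg h| <= `|h|.
      by rewrite /neg; case: (leP h 0) => // _; rewrite normr0.
    rewrite normrM normfV ler_pdivrMl ?normr_gt0// normrX expr2.
    by apply: ler_pM.
  - exact: cvg_cst.
  - rewrite -[X in _ --> X](normr0 R); apply: cvg_norm.
    by apply: cvg_within_filter; exact: cvg_id.
rewrite ge0_neg// mulr0; apply: DeriveDef; last exact: cvg_lim L.
by apply/cvg_ex; exists 0; exact: L.
Unshelve. all: by end_near. Qed.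

Lemma powR_lip (p M x y : R) : 1 < p -> 0 < x -> x <= y -> y <= M ->
  y `^ p - x `^ p <= p * M `^ (p - 1) * (y - x).
Proof.
move=> p1 x0; rewrite le_eqVlt => /predU1P[->|xy] yM; first by rewrite !subrr mulr0.
have dp (s : R) : s \in `]x, y[%R -> is_derive s 1 (fun z => z `^ p) (p * s `^ (p - 1)).
  by rewrite in_itv /= => /andP[xs _]; apply: is_derive1_powR; exact: lt_trans xs.
have [|c] := MVT xy dp.
  apply: derivable_within_continuous => s; rewrite in_itv /= => /andP[xs _].
  have sp : 0 < s by exact: lt_le_trans xs.
  by have [] := is_derive1_powR p sp.
rewrite in_itv /= => /andP[xc cy] ->.
have p0 : 0 < p by exact: lt_trans p1.
have c0 : 0 < c by exact: lt_trans xc.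
rewrite ler_pM2r ?subr_gt0// ler_pM2l//; apply: ge0_ler_powR; rewrite ?nnegrE.
- by rewrite subr_ge0 ltW.
- exact: ltW.
- by apply: le_trans yM; apply/ltW; exact: lt_trans xy.
- by apply: le_trans yM; exact: ltW.
Qed.

(** Integrating over sets of measure [n] would bound the integral of [f^2] below by [d^2 n] for
    every [n]. *)
Lemma notL2 f (I : nat -> set R) (d : R) : measurable_fun setT f -> intg leb (fun t => f t ^+ 2) ->
  0 < d -> (forall n, measurable (I n)) -> (forall n, leb (I n) = n%:R%:E) ->
  ~ (forall n t, I n t -> d <= f t).
Proof.
move=> mf i2 d0 mI lI h.
have bd (n : nat) : d ^+ 2 * n%:R <= rint leb (fun t => f t ^+ 2).
  rewrite -lee_fin -rintE// EFinM -lI -(integral_cst leb (mI n)).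
  have m2 : measurable_fun setT (fun t => (f t ^+ 2)%:E).
    by apply/measurable_EFinP; exact: measurable_funX.
  apply: (@le_trans _ _ (\int[leb]_(t in I n) (f t ^+ 2)%:E)%E).
    apply: ge0_le_integral => //.
    - exact: mI.
    - by move=> t _ /=; rewrite lee_fin sqr_ge0.
    - exact: measurable_funS m2.
    move=> t It; rewrite lee_fin ler_sqr ?nnegrE ?(ltW d0)//; first exact: h It.
    by apply: le_trans (h _ _ It); exact: ltW.
  apply: ge0_subset_integral => //; first exact: mI.
  by move=> t _; rewrite lee_fin sqr_ge0.
have d2 : 0 < d ^+ 2 by rewrite exprn_gt0.
have r0 : 0 <= rint leb (fun t => f t ^+ 2) / d ^+ 2.
  by rewrite divr_ge0 ?(ltW d2)//; apply: rint_ge0 => t; exact: sqr_ge0.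
by have := archi_boundP r0; rewrite ltr_pdivrMr// mulrC ltNge bd.
Qed.

(** Weaker than convergence to 0: it follows from measurability and square integrability, and still
    excludes a persistent positive lower bound. *)
Definition vanishes f := forall T d, 0 < d -> ~ (forall t, T <= t -> d <= f t).

Lemma L2_vanishes f : measurable_fun setT f -> intg leb (fun t => f t ^+ 2) ->
  vanishes f /\ vanishes (fun t => f (- t)).
Proof.
have mI (c e : R) : measurable (`[c, e]%classic : set R) by exact: measurable_itv.
have lI (c e : R) (n : nat) : e = c + n%:R -> leb `[c, e] = n%:R%:E.
  move=> ->; rewrite lebesgue_measure_itv /= lte_fin; case: ifP => [_|/negbT].
    by rewrite -EFinB addrC addKr.
  by rewrite -leNgt gerDl lern0 => /eqP ->.
move=> mf i2; split=> T d d0 h.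
  apply: (@notL2 f (fun n => `[T, T + n%:R]%classic) d mf i2 d0 (fun n => mI _ _) (fun n => lI _ _ _ erefl)).
  by move=> n t; rewrite /= in_itv /= => /andP[Tt _]; exact: h.
apply: (@notL2 f (fun n => `[- T - n%:R, - T]%classic) d mf i2 d0 (fun n => mI _ _)).
  by move=> n; apply: lI; rewrite subrK.
move=> n t; rewrite /= in_itv /= => /andP[_ tT]; rewrite -[t]opprK; apply: h.
by rewrite lerNr.
Qed.

End calculus.

Section comparison.
Variables (R : realType) (a b p : R).
Hypothesis p1 : 1 < p.
Notation leb := (@lebesgue_measure R).

(* A function with its first four derivatives. *)
Record jet4 := Jet4 { j0 : R -> R; j1 : R -> R; j2 : R -> R; j3 : R -> R; j4 : R -> R }.

Definition jet4P (v : jet4) := [/\ forall t : R, is_derive t 1 (j0 v) (j1 v t),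
  forall t : R, is_derive t 1 (j1 v) (j2 v t), forall t : R, is_derive t 1 (j2 v) (j3 v t) &
  forall t : R, is_derive t 1 (j3 v) (j4 v t)].

Definition Lop (v : jet4) t := j4 v t - (a ^+ 2 + b ^+ 2) * j2 v t + a ^+ 2 * b ^+ 2 * j0 v t.

(** [Lop] contains only even derivatives, so it commutes with reflection and the forward comparison
    serves backwards in time as well. *)
Definition refl (v : jet4) : jet4 := Jet4 (fun t => j0 v (- t)) (fun t => - j1 v (- t))
  (fun t => j2 v (- t)) (fun t => - j3 v (- t)) (fun t => j4 v (- t)).

Lemma der_refl (f : R -> R) (t l : R) : is_derive (- t) 1 f l ->
  is_derive t 1 (fun t => f (- t)) (- l).
Proof.
move=> df; have dn : is_derive t 1 (fun t : R => - t) (-1).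
  have := derZ (-1) (derI t); rewrite mulr1.
  by rewrite (_ : (fun s => -1 * s) = fun s => - s)//; apply/funext => s; rewrite mulN1r.
by apply: der_eq (der_comp (f := f) (g := fun t => - t) df dn) _; rewrite mulrN1.
Qed.

Lemma der_opp (f : R -> R) (t l : R) : is_derive t 1 f l -> is_derive t 1 (fun t => - f t) (- l).
Proof.
move=> df; have := derZ (-1) df; rewrite mulN1r.
by rewrite (_ : (fun s => -1 * f s) = fun s => - f s)//; apply/funext => s; rewrite mulN1r.
Qed.

Lemma jet4P_refl v : jet4P v -> jet4P (refl v).
Proof.
move=> [d0 d1 d2 d3]; split=> t /=.
- exact: der_refl.
- by apply: der_eq (der_opp (der_refl (d1 (- t)))) _; rewrite opprK.
- exact: der_refl.
- by apply: der_eq (der_opp (der_refl (d3 (- t)))) _; rewrite opprK.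
Qed.

Section coop.
Variables U u : jet4.
Hypotheses (dU : jet4P U) (du : jet4P u) (U_gt0 : forall t, 0 < j0 U t) (u_gt0 : forall t, 0 < j0 u t).
Hypotheses (superU : forall t, j0 U t `^ p <= Lop U t) (subu : forall t, Lop u t <= j0 u t `^ p).

(** With [z = U - u], [x1] is [z] and [x3] is [(D^2 - a^2) z]; [x2] and [x4] are their derivatives.
    The factorization reads [x1'' = a^2 x1 + x3] and [x3'' = b^2 x3 + q]. *)
Let x1 t := j0 U t - j0 u t.
Let x2 t := j1 U t - j1 u t.
Let x3 t := j2 U t - j2 u t - a ^+ 2 * x1 t.
Let x4 t := j3 U t - j3 u t - a ^+ 2 * x2 t.
Let q t := Lop U t - Lop u t.

Let dx1 (t : R) : is_derive t 1 x1 (x2 t).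
Proof. by have [d _ _ _] := dU; have [d' _ _ _] := du; exact: derB. Qed.
Let dx2 (t : R) : is_derive t 1 x2 (a ^+ 2 * x1 t + x3 t).
Proof.
have [_ d _ _] := dU; have [_ d' _ _] := du; apply: der_eq (derB (d t) (d' t)) _.
by rewrite /x3; ring.
Qed.
Let dx3 (t : R) : is_derive t 1 x3 (x4 t).
Proof.
by have [_ _ d _] := dU; have [_ _ d' _] := du; exact: (derB (derB (d t) (d' t)) (derZ _ (dx1 t))).
Qed.
Let dx4 (t : R) : is_derive t 1 x4 (b ^+ 2 * x3 t + q t).
Proof.
have [_ _ _ d] := dU; have [_ _ _ d'] := du.
apply: der_eq (derB (derB (d t) (d' t)) (derZ (a ^+ 2) (dx2 t))) _.
by rewrite /x3 /x1 /q /Lop; ring.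
Qed.

(** Where [U >= u], monotonicity of the power gives [q >= 0]. Elsewhere its Lipschitz constant up to
    [M] bounds the loss by a multiple of the negative part of [x1]. *)
Let q_ge (M t : R) : j0 U t <= M -> j0 u t <= M -> p * M `^ (p - 1) * neg (x1 t) <= q t.
Proof.
move=> UM uM; have hq : j0 U t `^ p - j0 u t `^ p <= q t by exact: lerB.
apply: le_trans hq; have [Uu|uU] := leP (j0 u t) (j0 U t).
  rewrite ge0_neg ?subr_ge0// mulr0 subr_ge0; apply: ge0_ler_powR; rewrite ?nnegrE ?(ltW (U_gt0 t)) ?(ltW (u_gt0 t))//.
  by apply/ltW; exact: lt_trans p1.
rewrite /neg min_l; last by rewrite subr_le0 ltW.
have := powR_lip p1 (U_gt0 t) (ltW uU) uM; rewrite /x1; lra.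
Qed.

Variable t0 : R.
Hypotheses (i1 : 0 <= x1 t0) (i2 : 0 <= x2 t0) (i3 : 0 <= x3 t0) (i4 : 0 <= x4 t0).

(* The vector [(x1, x2, x3, x4)] satisfies a differential inequality with a cooperative
   linear system, so that Gronwall applies to the squares of the negative parts. *)
Lemma coop_ge0 t : t0 <= t -> [/\ 0 <= x1 t, 0 <= x2 t, 0 <= x3 t & 0 <= x4 t].
Proof.
move=> tt.
have cU : {within `[t0, t], continuous (j0 U)}.
  by apply: continuous_subspaceT; have [d _ _ _] := dU; exact: is_derive_continuous d.
have cu : {within `[t0, t], continuous (j0 u)}.
  by apply: continuous_subspaceT; have [d _ _ _] := du; exact: is_derive_continuous d.
have [s1 _ hs1] := EVT_max tt cU; have [s2 _ hs2] := EVT_max tt cu.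
pose M := j0 U s1 + j0 u s2; pose L := p * M `^ (p - 1).
have L0 : 0 <= L by rewrite mulr_ge0 ?powR_ge0// (le_trans _ (ltW p1)).
have qL s : t0 <= s <= t -> L * neg (x1 s) <= q s.
  move=> ss; apply: q_ge.
    by rewrite (le_trans (hs1 _ _))// lerDl ltW.
  by rewrite (le_trans (hs2 _ _))// lerDr ltW.
pose F s := neg (x1 s) ^+ 2 + neg (x2 s) ^+ 2 + neg (x3 s) ^+ 2 + neg (x4 s) ^+ 2.
pose F' s := 2 * (neg (x1 s) * x2 s + neg (x2 s) * (a ^+ 2 * x1 s + x3 s) +
  neg (x3 s) * x4 s + neg (x4 s) * (b ^+ 2 * x3 s + q s)).
have dF (s : R) : is_derive s 1 F (F' s).
  have dn (f : R -> R) l : is_derive s 1 f l -> is_derive s 1 (fun r => neg (f r) ^+ 2) (2 * neg (f s) * l).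
    by move=> df; exact: (der_comp (f := fun z => neg z ^+ 2) (is_derive_neg_sq (f s)) df).
  apply: der_eq (derD (derD (derD (dn _ _ (dx1 s)) (dn _ _ (dx2 s))) (dn _ _ (dx3 s))) (dn _ _ (dx4 s))) _.
  by rewrite /F'; ring.
have F0 : F t0 <= 0 by rewrite /F !ge0_neg// expr0n !addr0.
have Fb s : t0 <= s <= t -> F' s <= (3 + a ^+ 2 + b ^+ 2 + L) * F s.
  move=> ss; have hq := qL s ss; rewrite /F' /F.
  move: (neg_le0 (x1 s)) (neg_le0 (x2 s)) (neg_le0 (x3 s)) (neg_le0 (x4 s)).
  move: (neg_le (x1 s)) (neg_le (x2 s)) (neg_le (x3 s)) (neg_le (x4 s)) hq.
  move: (neg (x1 s)) (neg (x2 s)) (neg (x3 s)) (neg (x4 s)) => m1 m2 m3 m4 h1 h2 h3 h4 hq n1 n2 n3 n4.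
  move: (sqr_ge0 a) (sqr_ge0 b); move: (a ^+ 2) (b ^+ 2) => a2 b2 a20 b20.
  (* Multiplication by a nonpositive number reverses [neg y <= y]. As the coefficients of the system
     are nonnegative, each right-hand side may be replaced by its value at the negative parts. *)
  have e1 : m1 * x2 s <= m1 * m2 by rewrite ler_wnM2l.
  have e2 : m2 * (a2 * x1 s + x3 s) <= m2 * (a2 * m1 + m3).
    by rewrite ler_wnM2l// lerD// ler_wpM2l.
  have e3 : m3 * x4 s <= m3 * m4 by rewrite ler_wnM2l.
  have e4 : m4 * (b2 * x3 s + q s) <= m4 * (b2 * m3 + L * m1).
    by rewrite ler_wnM2l// lerD// ler_wpM2l.
  have sq (x y : R) : 2 * (x * y) <= x ^+ 2 + y ^+ 2 by have := sqr_ge0 (x - y); nra.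
  have s12 := sq m1 m2; have s23 := sq m2 m3; have s34 := sq m3 m4; have s14 := sq m1 m4.
  pose S := m1 ^+ 2 + m2 ^+ 2 + m3 ^+ 2 + m4 ^+ 2.
  have [p1' p2' p3' p4'] : [/\ 0 <= m1 ^+ 2, 0 <= m2 ^+ 2, 0 <= m3 ^+ 2 & 0 <= m4 ^+ 2].
    by split; exact: sqr_ge0.
  have k1 : a2 * (2 * (m1 * m2)) <= a2 * S by rewrite ler_wpM2l// /S; lra.
  have k2 : b2 * (2 * (m3 * m4)) <= b2 * S by rewrite ler_wpM2l// /S; lra.
  have k3 : L * (2 * (m1 * m4)) <= L * S by rewrite ler_wpM2l// /S; lra.
  have k4 : 2 * (m1 * m2) + 2 * (m2 * m3) + 2 * (m3 * m4) <= 3 * S by rewrite /S; lra.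
  rewrite -/S.
  have -> : (3 + a2 + b2 + L) * S = 3 * S + a2 * S + b2 * S + L * S by ring.
  have : 2 * (m1 * m2 + m2 * (a2 * m1 + m3) + m3 * m4 + m4 * (b2 * m3 + L * m1)) =
    2 * (m1 * m2) + 2 * (m2 * m3) + 2 * (m3 * m4) + a2 * (2 * (m1 * m2)) + b2 * (2 * (m3 * m4)) + L * (2 * (m1 * m4)).
    by ring.
  lra.
have := gronwall dF tt F0 Fb; rewrite /F.
have [n1 n2 n3 n4] : [/\ 0 <= neg (x1 t) ^+ 2, 0 <= neg (x2 t) ^+ 2, 0 <= neg (x3 t) ^+ 2 & 0 <= neg (x4 t) ^+ 2].
  by split; exact: sqr_ge0.
move=> h; have z (y : R) : neg y ^+ 2 <= 0 -> 0 <= y.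
  by move=> h0; apply: neg_sq_ge0; apply/eqP; rewrite -sqrf_eq0 eq_le h0 sqr_ge0.
by split; apply: z; lra.
Qed.

(** Both [x4] and [x3] are nondecreasing. If one were positive at [t0], then [x3] would stay above
    some [m > 0] from some time on, and two integrations would keep [U], which exceeds [x1], away
    from 0. *)
Lemma coop_vanishes : vanishes (j0 U) -> x3 t0 = 0 /\ x4 t0 = 0.
Proof.
move=> vU.
have qge t : t0 <= t -> 0 <= q t.
  move=> tt; have [h1 _ _ _] := coop_ge0 tt.
  have := @q_ge (j0 U t + j0 u t) t; rewrite (ge0_neg h1) mulr0; apply.
    by rewrite lerDl ltW.
  by rewrite lerDr ltW.
have contra (m T : R) : t0 <= T -> 0 < m -> (forall t, T <= t -> m <= x3 t) -> False.
  move=> tT m0 h.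
  have g2 t : T <= t -> m * (t - T) <= x2 t.
    move=> Tt; have [_ h2 _ _] := coop_ge0 tT.
    have := mono_lin dx2 Tt (m := m) _ => /(_ _)/wrap[]; last lra.
    move=> s /andP[Ts st]; have [h1 _ _ _] := coop_ge0 (le_trans tT Ts).
    have := h s Ts; have := mulr_ge0 (sqr_ge0 a) h1; lra.
  (* One unit of time after [T] brings [x2] above [m], and a second one brings [x1] above [m]. *)
  apply: (vU (T + 1 + 1) m) => // t Tt.
  have T1 : t0 <= T + 1 by lra.
  have T1t : T + 1 <= t by lra.
  have [h1 _ _ _] := coop_ge0 T1.
  have := mono_lin dx1 T1t (m := m) _ => /(_ _)/wrap[].
    by move=> s /andP[Ts st]; have := g2 s _ => /(_ _)/wrap[]; [lra|nra].
  have := u_gt0 t; rewrite /x1; have : m * 1 <= m * (t - (T + 1)) by rewrite ler_pM2l//; lra.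
  move: h1; rewrite /x1; lra.
have x4m t s : t0 <= t -> t <= s -> x4 t <= x4 s.
  move=> tt ts; apply: (mono_der dx4 ts) => r /andP[tr _].
  have [_ _ h3 _] := coop_ge0 (le_trans tt tr).
  by apply: addr_ge0; [apply: mulr_ge0 => //; exact: sqr_ge0|apply: qge; exact: le_trans tr].
have x3m s : t0 <= s -> x3 t0 + x4 t0 * (s - t0) <= x3 s.
  by move=> ts; apply: (mono_lin dx3 ts) => r /andP[tr _]; exact: x4m.
split; apply/eqP; rewrite eq_le ?i3 ?i4 andbT leNgt; apply/negP => h.
  apply: (contra (x3 t0) t0) => // t tt; apply: le_trans (x3m t tt).
  by rewrite lerDl mulr_ge0// subr_ge0.
apply: (contra (x4 t0) (t0 + 1)) => //; first lra.
move=> t tt; have tt0 : t0 <= t by lra.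
apply: le_trans (x3m t tt0); have : x4 t0 * 1 <= x4 t0 * (t - t0) by rewrite ler_pM2l//; lra.
have := i3; lra.
Qed.

End coop.

Lemma touching_jets (U u : jet4) (t0 : R) : jet4P U -> jet4P u ->
  (forall t, 0 < j0 U t) -> (forall t, 0 < j0 u t) ->
  (forall t, j0 U t `^ p <= Lop U t) -> (forall t, Lop u t <= j0 u t `^ p) ->
  vanishes (j0 U) -> vanishes (fun t => j0 U (- t)) ->
  j0 U t0 = j0 u t0 -> j1 U t0 = j1 u t0 -> j2 u t0 <= j2 U t0 ->
  j2 U t0 = j2 u t0 /\ j3 U t0 = j3 u t0.
Proof.
move=> dU du pU pu sU su vU vU' e0 e1 e2.
(* The sign of the difference of the third derivatives decides the direction of time, since
   reflection reverses it. *)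
have [e3|/ltW e3] := leP (j3 u t0) (j3 U t0).
  have := @coop_vanishes U u dU du pU pu sU su t0; rewrite e0 e1 !subrr mulr0 !subr0 !subr_ge0.
  by move=> /(_ (lexx _) (lexx _) e2 e3 vU) [/eqP + /eqP]; rewrite !subr_eq0 => /eqP -> /eqP ->.
have := @coop_vanishes (refl U) (refl u) (jet4P_refl dU) (jet4P_refl du) (fun t => pU (- t))
  (fun t => pu (- t)) (fun t => sU (- t)) (fun t => su (- t)) (- t0).
rewrite /= opprK e0 e1 !subrr mulr0 !subr0 subr_ge0 opprK addrC subr_ge0.
by move=> /(_ (lexx _) (lexx _) e2 e3 vU') [/eqP + /eqP]; rewrite !subr_eq0 => /eqP -> /eqP ->.
Qed.

(** A solution is both a sub- and a supersolution, so [coop_ge0] applies in either order. *)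
Lemma jets_unique_right (U u : jet4) (t0 t : R) : jet4P U -> jet4P u ->
  (forall t, 0 < j0 U t) -> (forall t, 0 < j0 u t) ->
  (forall t, Lop U t = j0 U t `^ p) -> (forall t, Lop u t = j0 u t `^ p) ->
  j0 U t0 = j0 u t0 -> j1 U t0 = j1 u t0 -> j2 U t0 = j2 u t0 -> j3 U t0 = j3 u t0 ->
  t0 <= t -> j0 U t = j0 u t.
Proof.
move=> dU du pU pu sU su e0 e1 e2 e3 tt.
have le1 s : j0 U s `^ p <= Lop U s by rewrite sU.
have le2 s : Lop U s <= j0 U s `^ p by rewrite sU.
have le3 s : j0 u s `^ p <= Lop u s by rewrite su.
have le4 s : Lop u s <= j0 u s `^ p by rewrite su.
have := @coop_ge0 U u dU du pU pu le1 le4 t0.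
rewrite e0 e1 e2 e3 !subrr mulr0 subr0 => /(_ (lexx _) (lexx _) (lexx _) (lexx _) _ tt) [h1 _ _ _].
have := @coop_ge0 u U du dU pu pU le3 le2 t0.
rewrite e0 e1 e2 e3 !subrr mulr0 subr0 => /(_ (lexx _) (lexx _) (lexx _) (lexx _) _ tt) [h2 _ _ _].
by apply/le_anti; rewrite -subr_ge0 h2 -subr_ge0 h1.
Qed.

Lemma jets_unique (U u : jet4) (t0 : R) : jet4P U -> jet4P u ->
  (forall t, 0 < j0 U t) -> (forall t, 0 < j0 u t) ->
  (forall t, Lop U t = j0 U t `^ p) -> (forall t, Lop u t = j0 u t `^ p) ->
  j0 U t0 = j0 u t0 -> j1 U t0 = j1 u t0 -> j2 U t0 = j2 u t0 -> j3 U t0 = j3 u t0 ->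
  forall t, j0 U t = j0 u t.
Proof.
move=> dU du pU pu sU su e0 e1 e2 e3 t; have [tt|/ltW tt] := leP t0 t.
  exact: (jets_unique_right dU du pU pu sU su e0 e1 e2 e3 tt).
have := @jets_unique_right (refl U) (refl u) (- t0) (- t) (jet4P_refl dU) (jet4P_refl du)
  (fun t => pU (- t)) (fun t => pu (- t)) (fun t => sU (- t)) (fun t => su (- t)).
by rewrite /= !opprK e0 e1 e2 e3; apply => //; rewrite lerN2.
Qed.

(** The ODE multiplied by [v'] integrates to the conserved quantity [H]. Its limit along the
    integers is 0, so it vanishes; where [v' = 0] only [v] and [v''] are left in it. *)
Lemma energy (v : jet4) : jet4P v -> (forall t, 0 < j0 v t) ->
  (forall t, Lop v t = j0 v t `^ p) ->
  j0 v n%:R @[n --> \oo] --> (0 : R) -> j1 v n%:R @[n --> \oo] --> (0 : R) ->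
  j2 v n%:R @[n --> \oo] --> (0 : R) -> j3 v n%:R @[n --> \oo] --> (0 : R) ->
  forall t, j1 v t = 0 -> j2 v t ^+ 2 = a ^+ 2 * b ^+ 2 * j0 v t ^+ 2 - 2 / (p + 1) * (j0 v t `^ p * j0 v t).
Proof.
move=> [d0 d1 d2 d3] pv sv l0 l1 l2 l3.
have p0 : 0 < p + 1 by have := p1; lra.
pose H t := j3 v t * j1 v t - 2^-1 * (j2 v t * j2 v t) - (a ^+ 2 + b ^+ 2) / 2 * (j1 v t * j1 v t)
  + a ^+ 2 * b ^+ 2 / 2 * (j0 v t * j0 v t) - (p + 1)^-1 * (j0 v t `^ (p + 1)).
have dH (t : R) : is_derive t 1 H 0.
  have dp : is_derive t 1 (fun t => j0 v t `^ (p + 1)) ((p + 1) * j0 v t `^ p * j1 v t).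
    have := is_derive1_powR (p + 1) (pv t); rewrite addrK => dpw.
    exact: (der_comp (f := fun x => x `^ (p + 1)) dpw (d0 t)).
  apply: der_eq (derB (derD (derB (derB (derM (d3 t) (d1 t)) (derZ 2^-1 (derM (d2 t) (d2 t))))
    (derZ _ (derM (d1 t) (d1 t)))) (derZ _ (derM (d0 t) (d0 t)))) (derZ _ dp)) _.
  rewrite -(sv t) /Lop; field; exact/lt0r_neq0.
have Hc s t : H s = H t.
  wlog st : s t / s <= t => [hw|].
    by have [|/ltW] := leP s t => st; [exact: hw|symmetry; exact: hw].
  apply/le_anti; rewrite (mono_der dH st)//=.
  have := mono_lin (m := 0) (fun x => der_opp (dH x)) st _ => /(_ _)/wrap[].
    by move=> x _; rewrite oppr0.
  rewrite mul0r addr0 lerN2; exact.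
have lp : j0 v n%:R `^ (p + 1) @[n --> \oo] --> (0 : R).
  apply: (@squeeze_cvgr _ _ _ _ (fun=> 0) (fun n => j0 v n%:R)) => //; last exact: cvg_cst.
  near=> n; rewrite powR_ge0 /= -[leRHS](powRr1 (ltW (pv _))); apply: ger_powR; last by have := p1; lra.
  rewrite pv /=; near: n; move/cvgrPdist_le : l0 => /(_ 1 ltr01); apply: filterS => n.
  by rewrite sub0r normrN gtr0_norm.
have lH : H n%:R @[n --> \oo] --> (0 : R).
  rewrite (_ : (0 : R) = 0 * 0 - 2^-1 * (0 * 0) - (a ^+ 2 + b ^+ 2) / 2 * (0 * 0)
    + a ^+ 2 * b ^+ 2 / 2 * (0 * 0) - (p + 1)^-1 * 0); last by ring.
  have lc (c : R) (g h : nat -> R) : g n @[n --> \oo] --> (0 : R) -> h n @[n --> \oo] --> (0 : R) ->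
    c * (g n * h n) @[n --> \oo] --> c * (0 * 0).
    by move=> gl hl; apply: cvgM; [exact: cvg_cst|exact: cvgM].
  apply: cvgB; last by apply: cvgM; [exact: cvg_cst|exact: lp].
  apply: cvgD; last exact: lc.
  apply: cvgB; last exact: lc.
  by apply: cvgB; [exact: cvgM|exact: lc].
move=> t e1.
have Ht : H t = 0.
  apply: (cvg_unique (@Rhausdorff R) _ lH).
  rewrite (_ : (fun n => H n%:R) = fun=> H t); last by apply/funext => n; exact: Hc.
  exact: cvg_cst.
have pe : j0 v t `^ (p + 1) = j0 v t `^ p * j0 v t.
  by rewrite powRD ?powRr1 ?ltW// (gt_eqF (pv t)) implybT.
move: Ht; rewrite /H e1 pe => Ht.
have -> : 2 / (p + 1) * (j0 v t `^ p * j0 v t) = 2 * ((p + 1)^-1 * (j0 v t `^ p * j0 v t)) by ring.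
move: Ht; move: ((p + 1)^-1 * _) => E; rewrite !expr2; nra.
Unshelve. all: by end_near. Qed.

(** Values below [f 0] on both sides of 0 make the maximum over [[r, s]] interior. A positive second
    derivative there would make [f] increase just to the right. *)
Lemma local_max (f f1 f2 f3 : R -> R) : (forall t : R, is_derive t 1 f (f1 t)) ->
  (forall t : R, is_derive t 1 f1 (f2 t)) -> (forall t : R, is_derive t 1 f2 (f3 t)) ->
  (forall t, 0 < f t) -> vanishes f -> vanishes (fun t => f (- t)) ->
  exists2 t0, f1 t0 = 0 & f2 t0 <= 0.
Proof.
move=> d0 d1 d2 f_gt0 v1 v2.
have [s s0 fs] : exists2 s, 0 <= s & f s < f 0.
  apply: contrapT => h; apply: (v1 0 (f 0)) => // t t0; rewrite leNgt; apply/negP => ft.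
  by apply: h; exists t.
have [r r0 fr] : exists2 r, r <= 0 & f r < f 0.
  apply: contrapT => h; apply: (v2 0 (f 0)) => // t t0; rewrite leNgt; apply/negP => ft.
  by apply: h; exists (- t) => //; rewrite oppr_le0.
have rs : r <= s by exact: le_trans s0.
have cf : {within `[r, s], continuous f}.
  by apply: continuous_subspaceT; exact: is_derive_continuous d0.
have [t0 t0I hm] := EVT_max rs cf.
have f0m : f 0 <= f t0 by apply: hm; rewrite in_itv /= r0 s0.
have rt : r < t0.
  move: t0I; rewrite in_itv /= => /andP[]; rewrite le_eqVlt => /predU1P[e|//] _.
  by move: f0m; rewrite -e leNgt fr.
have ts : t0 < s.
  move: t0I; rewrite in_itv /= => /andP[_]; rewrite le_eqVlt => /predU1P[e|//].
  by move: f0m; rewrite e leNgt fs.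
have e1 : f1 t0 = 0.
  have t0o : t0 \in `]r, s[ by rewrite in_itv /= rt ts.
  have : is_derive t0 1 f 0.
    apply: (derive1_at_max rs) t0o _ => t; first by have [] := d0 t.
    by rewrite in_itv /= => /andP[rt' ts']; apply: hm; rewrite in_itv /= !ltW.
  by move=> [_ <-]; have [_ <-] := d0 t0.
exists t0 => //; rewrite leNgt; apply/negP => f2p.
have : \forall x \near t0, 0 < f2 x.
  have c2 := is_derive_continuous d2 (x := t0).
  exact: (c2 _ (gt_nbhs_near f2p)).
move=> [e /= e0 he].
pose x := Num.min (t0 + e / 2) s.
have e2 : 0 < e / 2 by rewrite divr_gt0.
have tx : t0 < x by rewrite /x lt_min ts andbT ltrDl.
have f2x y : t0 <= y <= x -> 0 < f2 y.
  move=> /andP[ty]; rewrite le_min => /andP[yx _]; apply: he => /=.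
  by rewrite ler0_norm ?subr_le0// opprB ltrBlDr; lra.
have f1x y : t0 < y < x -> 0 < f1 y.
  move=> /andP[ty yx]; rewrite -e1; apply: (mono_der_lt d1 ty) => z /andP[tz zy].
  by apply: f2x; rewrite (ltW tz) ltW// (lt_trans zy).
have := mono_der_lt d0 tx f1x; rewrite ltNge hm// in_itv /= (ltW (lt_trans rt tx)) /=.
by rewrite /x ge_min lexx orbT.
Unshelve. all: by end_near. Qed.

End comparison.

(** * Uniqueness *)

Section uniqueness.
Variables (R : realType) (N : nat) (mu : R).
Hypotheses (N5 : (5 <= N)%N) (mu0 : 0 < mu) (muN : mu < N%:R - 4).
Notation V := 'rV[R]_N.
Notation VB := (VB R N).
Notation vol := (@vol R N).
Notation leb := (@lebesgue_measure R).
Notation rad := (@rad R N).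
Notation cvol := (cvol R N).
Notation kap := (kap R N).
Notation al := (al N mu).
Notation aa := (aa N mu).
Notation bb := (bb N mu).
Notation pp := (pp R N).
Notation W := (W N mu).
Notation Lop := (Lop aa bb).

Let N0 : (0 < N)%N. Proof. exact: leq_trans N5. Qed.
Let kp : 0 < kap := kap_gt0 mu0 muN.
Let al0 : 0 < al := al_gt0 mu0 muN.
Let p1 : 1 < pp := pp_gt1 mu0 muN.

Definition Wjet (k tau : R) : jet4 R := Jet4 (fun t => k * W tau t) (fun t => k * W1 N mu tau t)
  (fun t => k * W2 N mu tau t) (fun t => k * W3 N mu tau t) (fun t => k * W4 N mu tau t).

Lemma jet4P_Wjet k tau : jet4P (Wjet k tau).
Proof. by split=> t; apply: derZ; [exact: dW|exact: dW1|exact: dW2|exact: dW3]. Qed.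

(** To be compared with [(k W)^pp = k^pp W^pp]: as [pp > 1], [k W] is a supersolution for [k < 1]
    and a subsolution for [k > 1]. *)
Lemma Lop_Wjet k tau t : Lop (Wjet k tau) t = k * W tau t `^ pp.
Proof. by rewrite -(W_ode mu0 muN) /Lop /=; ring. Qed.

Lemma intg_Wsq k tau : intg leb (fun t => (k * W tau t) ^+ 2).
Proof.
have iy : intg leb (fun t => Y al kap (t + tau)) := intg_Y al0 tau kp.
apply: intg_le (intgZ ((k * KNmu N mu) ^+ 2) iy).
  apply: measurable_funX; apply: continuous_measurable_fun.
  by have [d _ _ _] := jet4P_Wjet k tau; exact: is_derive_continuous d.
move=> t; rewrite ger0_norm ?sqr_ge0// /W mulrA exprMn ler_wpM2l ?sqr_ge0//.
rewrite expr2 -[leRHS]mulr1 ler_wpM2l ?expR_ge0//; apply: Y_le1 => //; exact: ltW.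
Qed.

(** At the centre [ch] is 2, so each unit in the exponent of [Y] divides by 2. The third identity is
    the relation of [energy] for [W], obtained here by computation. *)
Lemma W_center t0 : [/\ W1 N mu (- t0) t0 = 0, W2 N mu (- t0) t0 = - (al ^+ 2 * kap * W (- t0) t0) &
  W2 N mu (- t0) t0 ^+ 2 = aa ^+ 2 * bb ^+ 2 * W (- t0) t0 ^+ 2
    - 2 / (pp + 1) * (W (- t0) t0 `^ pp * W (- t0) t0)].
Proof.
have ch0 : ch al 0 = 2 by rewrite /ch !mulr0 expR0.
have Y1E q : Y al (q + 1) 0 = Y al q 0 / 2 by rewrite (YS al q) ch0; field.
have Y2E : Y al (kap + 2) 0 = Y al kap 0 / 4.
  by rewrite -[2](natrD _ 1 1) addrA !Y1E; field.
have Y4E : Y al (kap + 4) 0 = Y al kap 0 / 16.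
  by rewrite (_ : kap + 4 = kap + 1 + 1 + 1 + 1) ?Y1E; [field|ring].
have e1 : W1 N mu (- t0) t0 = 0 by rewrite /W1 subrr /D1 /sh !mulr0 subrr mulr0 mul0r mulr0.
have e2 : W2 N mu (- t0) t0 = - (al ^+ 2 * kap * W (- t0) t0).
  by rewrite /W2 /W subrr /D2 Y2E; field.
split=> //; rewrite e2 (W_pp mu0 muN) /W subrr Y4E /Kbase /aa /bb.
have k0 := kp; have -> : 2 / (pp + 1) = kap / (kap + 2).
  have := ppE mu0 muN => pe; have ppp : kap * (pp + 1) = 2 * (kap + 2) by rewrite mulrDr pe; ring.
  have n1 : pp + 1 != 0 by apply/eqP; have := p1; lra.
  have n2 : kap + 2 != 0 by apply/eqP; lra.
  by apply/eqP; rewrite eqr_div// ppp.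
by field; apply/eqP; lra.
Qed.

(* The case distinction is on the ratio [k] of the maxima: the energy identity orders the
   second derivatives of [v] and of [k W] at the maximum in the way that [touching_jets]
   excludes. *)
Lemma unique1d (v : jet4 R) : jet4P v -> (forall t, 0 < j0 v t) ->
  (forall t, Lop v t = j0 v t `^ pp) -> intg leb (fun t => j0 v t ^+ 2) ->
  j0 v n%:R @[n --> \oo] --> (0 : R) -> j1 v n%:R @[n --> \oo] --> (0 : R) ->
  j2 v n%:R @[n --> \oo] --> (0 : R) -> j3 v n%:R @[n --> \oo] --> (0 : R) ->
  exists tau, forall t, j0 v t = W tau t.
Proof.
move=> dv pv sv iv l0 l1 l2 l3.
have mj (z : jet4 R) : jet4P z -> measurable_fun setT (j0 z).
  by move=> [d _ _ _]; apply: continuous_measurable_fun; exact: is_derive_continuous d.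
have [vv vv'] := L2_vanishes (mj _ dv) iv.
have [d0 d1 d2 d3] := dv.
have [t0 e1 e2] := local_max d0 d1 d2 pv vv vv'.
have ev := energy p1 dv pv sv l0 l1 l2 l3 e1.
have [W1c W2c eW] := W_center t0.
exists (- t0); set tau := - t0 in W1c W2c eW *.
set w0 := W tau t0 in W2c eW; have w0p : 0 < w0 by exact: W_gt0.
set v0 := j0 v t0 in ev; have v0p : 0 < v0 by exact: pv.
pose k := v0 / w0; have k0 : 0 < k by rewrite divr_gt0.
have kw : k * w0 = v0 by rewrite /k divfK// gt_eqF.
have Wp t : 0 < W tau t by exact: W_gt0.
have pW c t : 0 < c -> 0 < c * W tau t by move=> c0; exact: mulr_gt0.
have [vW vW'] := L2_vanishes (mj _ (jet4P_Wjet k tau)) (intg_Wsq k tau).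
have W2n : W2 N mu tau t0 < 0.
  rewrite W2c oppr_lt0; apply: mulr_gt0 => //; apply: mulr_gt0; last exact: kp.
  exact: exprn_gt0.
have pw (x : R) : 0 < x -> x `^ pp = x * x `^ (pp - 1).
  move=> x0; rewrite -{2}[x](powRr1 (ltW x0)) -powRD; last by rewrite (gt_eqF x0) implybT.
  by congr (_ `^ _); ring.
pose B := aa ^+ 2 * bb ^+ 2; pose c := 2 / (pp + 1).
have c0 : 0 < c by rewrite divr_gt0//; have := p1; lra.
(* Apart from the common factor [v0^2], the squared second derivatives are values of the decreasing
   function [B - c h^(pp - 1)], at the height [v0] for [v] and at [w0] for [k W]. The profile of
   smaller height thus bends more sharply. *)
have ev' : j2 v t0 ^+ 2 = v0 ^+ 2 * (B - c * v0 `^ (pp - 1)).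
  by rewrite ev (pw _ v0p) /B /c; ring.
have eW' : (k * W2 N mu tau t0) ^+ 2 = v0 ^+ 2 * (B - c * w0 `^ (pp - 1)).
  by rewrite exprMn eW (pw _ w0p) -kw /B /c; ring.
have v02 : 0 < v0 ^+ 2 by rewrite exprn_gt0.
have kW2 : k * W2 N mu tau t0 < 0 by rewrite pmulr_rlt0.
have kpow t : (k * W tau t) `^ pp = k `^ pp * W tau t `^ pp.
  exact: (powRM _ (ltW k0) (ltW (Wp t))).
have sq_lt (x y : R) : y <= 0 -> x <= 0 -> x ^+ 2 < y ^+ 2 -> y < x.
  by move=> y0 x0 h; rewrite ltNge; apply/negP => xy; move: h; rewrite ltNge => /negP; apply; nra.
have mp (x y : R) : 0 < x -> x < y -> x `^ (pp - 1) < y `^ (pp - 1).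
  move=> x0 xy; apply: gt0_ltr_powR => //; rewrite ?nnegrE ?(ltW x0) ?subr_gt0//.
  by rewrite ltW// (lt_trans x0).
have [vw|wv|vw] := ltgtP v0 w0.
- have k1 : k < 1 by rewrite ltr_pdivrMr// mul1r.
  have lt2 : j2 v t0 < k * W2 N mu tau t0.
    apply: sq_lt => //; first exact: ltW.
    by rewrite ev' eW' ltr_pM2l// ltrD2l ltrN2 ltr_pM2l// mp.
  have sW t : j0 (Wjet k tau) t `^ pp <= Lop (Wjet k tau) t.
    rewrite Lop_Wjet /= kpow ler_wpM2r ?powR_ge0//.
    rewrite -[leRHS](powRr1 (ltW k0)); apply: ger_powR; last exact: ltW.
    by rewrite k0 ltW.
  have sv' t : Lop v t <= j0 v t `^ pp by rewrite sv.
  have i0 : j0 (Wjet k tau) t0 = j0 v t0 by exact: kw.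
  have i1 : j1 (Wjet k tau) t0 = j1 v t0 by rewrite /= W1c mulr0 e1.
  have [e2' _] := touching_jets p1 (jet4P_Wjet k tau) dv (fun t => pW k t k0) pv sW sv' vW vW' i0 i1 (ltW lt2).
  by move: lt2; rewrite -e2' /= ltxx.
- have k1 : 1 < k by rewrite ltr_pdivlMr// mul1r.
  have lt2 : k * W2 N mu tau t0 < j2 v t0.
    apply: sq_lt => //; first exact: ltW.
    by rewrite ev' eW' ltr_pM2l// ltrD2l ltrN2 ltr_pM2l// mp.
  have sW t : Lop (Wjet k tau) t <= j0 (Wjet k tau) t `^ pp.
    rewrite Lop_Wjet /= kpow ler_wpM2r ?powR_ge0//.
    by rewrite -[leLHS](powRr1 (ltW k0)); apply: ler_powR; exact: ltW.
  have sv' t : j0 v t `^ pp <= Lop v t by rewrite sv.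
  have i0 : j0 v t0 = j0 (Wjet k tau) t0 by symmetry; exact: kw.
  have i1 : j1 v t0 = j1 (Wjet k tau) t0 by rewrite /= W1c mulr0 e1.
  have [e2' _] := touching_jets p1 dv (jet4P_Wjet k tau) pv (fun t => pW k t k0) sv' sW vv vv' i0 i1 (ltW lt2).
  by move: lt2; rewrite e2' /= ltxx.
(* Equal heights give equal squares; both second derivatives are nonpositive and that of [W] is
   negative, so the opposite sign is excluded. *)
have e2' : j2 v t0 = W2 N mu tau t0.
  have k1 : k = 1 by rewrite /k vw divff// gt_eqF.
  have := eW'; rewrite k1 mul1r -vw -ev' => h.
  have : (W2 N mu tau t0 - j2 v t0) * (W2 N mu tau t0 + j2 v t0) = 0 by rewrite -subr_sqr h subrr.
  move/eqP; rewrite mulf_eq0 => /orP[|/eqP]; first by rewrite subr_eq0 => /eqP ->.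
  by move=> h'; exfalso; lra.
have dW1' := jet4P_Wjet 1 tau; have pW1 t := pW 1 t ltr01.
have sW1 t : Lop (Wjet 1 tau) t = j0 (Wjet 1 tau) t `^ pp by rewrite Lop_Wjet /= !mul1r.
have i0 : j0 v t0 = j0 (Wjet 1 tau) t0 by rewrite /= mul1r -/w0 -vw.
have i1 : j1 v t0 = j1 (Wjet 1 tau) t0 by rewrite /= W1c mulr0 e1.
have i2 : j2 v t0 = j2 (Wjet 1 tau) t0 by rewrite /= mul1r.
have sv1 t : j0 v t `^ pp <= Lop v t by rewrite sv.
have sW2 t : Lop (Wjet 1 tau) t <= j0 (Wjet 1 tau) t `^ pp by rewrite sW1.
have i2' : j2 (Wjet 1 tau) t0 <= j2 v t0 by rewrite i2.
have [_ i3] := touching_jets p1 dv dW1' pv pW1 sv1 sW2 vv vv' i0 i1 i2'.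
by move=> t; rewrite (jets_unique p1 dv dW1' pv pW1 sv sW1 i0 i1 i2 i3 t) /= mul1r.
Qed.

(** A radial set is null in space when its image in [t] is null for the polar density. The origin,
    where [ln] has a default value, is added as a null set. *)
Lemma nullRN_radial (Z : set R) (f g : V -> R) : measurable Z ->
  (cvol%:E * \int[leb]_t ((expR (N%:R * t))%:E * (\1_Z t)%:E) = 0)%E ->
  (forall x, x != 0 -> f x != g x -> Z (ln (enorm x))) -> ae_eqRN f g.
Proof.
move=> mZ z0 h.
have ml := @measurable_lnenorm R N.
pose P : set VB := (fun x : VB => ln (enorm (x : V))) @^-1` Z.
have mP : measurable P by have := ml measurableT Z mZ; rewrite setTI.
pose B : set VB := [set 0] `|` P.
have mB : measurable B by apply: measurableU => //; exact: measurable_set1_0.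
exists B; split; first exact: mB.
split.
  move=> x /= fg; have [->|x0] := eqVneq x 0; first by left.
  by right; exact: h.
rewrite intRN_ge0E//; last first.
  by apply/measurable_EFinP; exact: measurable_indic.
rewrite integral_indic// setIT.
have vP : vol P = 0.
  rewrite -[P]setIT -integral_indic//.
  have := @ge0_radial_integral R N N0 (fun t => (\1_Z t)%:E) => /(_ _ _)/wrap[].
  - by move=> t; rewrite lee_fin.
  - by apply/measurable_EFinP; exact: measurable_indic.
  by rewrite z0.
apply/eqP; rewrite eq_le measure_ge0 andbT.
pose O : set VB := [set (0%R : V)].
have h0 : (vol B <= vol O + vol P)%E.
  by apply: measureU2 => //; exact: measurable_set1_0.
by rewrite (le_trans h0)// vP vol_set1_0// adde0.
Qed.

Lemma uniqueness (u : V -> R) : weak_sol N mu u -> radial u -> positive u ->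
  exists lam : R, 0 < lam /\ ae_eqRN u (Umul N mu lam).
Proof.
move=> wsu ru pu.
(* If the sphere had area 0, polar coordinates would give every set volume 0 and any two functions
   would agree almost everywhere. This replaces a proof that [cvol] is positive. *)
have [c0|c0] := leP cvol 0.
  exists 1; split=> //; apply: (@nullRN_radial setT) => //.
  have -> : cvol = 0 by apply/le_anti; rewrite c0 cvol_ge0.
  by rewrite mul0e.
pose w := wof N5 u.
have mw := measurable_wof N5 wsu.
have wp := wof_gt0 N5 pu.
have [v0 [v1 [v2 [v3 [v4 [ae_v pv iv [d0 d1 d2 d3] [ode [l0 l1 l2 l3]]]]]]]] :=
  regular_representative (aa_gt0 mu0 muN) (aa_lt_bb mu0 muN) p1 mw wp
  (wof_sq N5 wsu ru c0) (wof_pow N5 mu0 muN wsu ru pu c0)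
  (wof_weak N5 mu0 muN wsu ru pu c0).
have [tau ht] := @unique1d (Jet4 v0 v1 v2 v3 v4) (And4 d0 d1 d2 d3) pv ode iv l0 l1 l2 l3.
exists (expR tau); split; first exact: expR_gt0.
rewrite (UmulE mu0 muN (expR_gt0 _)) expRK.
pose Z := [set t | w t != W tau t].
have mW : measurable_fun setT (W tau).
  by apply: continuous_measurable_fun; exact: is_derive_continuous (dW N mu tau).
have mZ : measurable Z.
  have mD : measurable_fun setT (fun t => w t - W tau t) by exact: measurable_funB.
  rewrite (_ : Z = (fun t => w t - W tau t) @^-1` (~` [set 0])); last first.
    apply/seteqP; split=> t /= h; first by apply/eqP; rewrite subr_eq0.
    by apply/eqP => e; apply: h; rewrite e subrr.
  by have := mD measurableT (~` [set 0]) (measurableC (measurable_set1 _)); rewrite setTI.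
apply: (nullRN_radial mZ); last first.
  move=> x x0; rewrite (uE N5 ru x0) /uw /rad (negPf x0) /expw => h.
  by rewrite /Z /=; apply: contraNneq h => e; rewrite -/w e.
rewrite (_ : (\int[leb]_t _ = 0)%E) ?mule0//.
rewrite (@ae_eq_integral _ _ _ leb setT (fun=> 0%E)) ?integral0//.
- apply: emeasurable_funM; apply/measurable_EFinP; first exact: measurable_expRN.
  exact: measurable_indic.
- apply: ae_mp ae_v _ => t wt _; rewrite indicE memNset ?mule0// /Z /= => /negP; apply.
  by apply/eqP; rewrite /w wt; exact: ht.
Qed.

End uniqueness.

Theorem theorem1p1 (R : realType) (N : nat) (mu : R) :
  (5 <= N)%N -> 0 < mu -> mu < N%:R - 4 ->
  (forall lam : R, 0 < lam ->
     weak_sol N mu (Umul N mu lam) /\ radial (Umul N mu lam)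
     /\ positive (Umul N mu lam)) /\
  (forall u : 'rV[R]_N -> R,
     weak_sol N mu u -> radial u -> positive u ->
     exists lam : R, 0 < lam /\ ae_eqRN u (Umul N mu lam)).
Proof.
move=> N5 mu0 muN; split=> [lam lam0|u wsu ru pu].
  by have [ws r p] := existence N5 mu0 muN lam0.
exact: (uniqueness N5 mu0 muN wsu ru pu).
Qed.
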